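(* Let $\mathbb{F}_q$ be a finite field of odd characteristic, and let $0\ne k<n$ be integers (so $1\le k<n$). Let $O_{k+}$ and $O_{k-}$ be the isometry groups of the two inequivalent non-degenerate symmetric bilinear forms on $\mathbb{F}_q^k$, and let $\eta$ denote the associated eta correspondences $\widehat{O}_{k\pm}\to\widehat{Sp}_{2n}$ defined in the context. Then these produce all irreducible representations of $Sp_{2n}(\mathbb{F}_q)$ of tensor rank $k$: $$\eta(\widehat{O}_{k+})\sqcup\eta(\widehat{O}_{k-})=(\widehat{Sp}_{2n})_{\otimes,k}.$$
   Context: All representations are finite dimensional and complex; $\widehat G$ is the set of isomorphism classes of irreducible representations of $G$. Oscillator representation: for a symplectic space $(W,\langle\,,\rangle)$ over $\mathbb{F}_q$, the Heisenberg group is $H(W)=W\oplus\mathbb{F}_q$ with law $(w,t)(w',t')=(w+w',t+t'+\frac12\langle w,w'\rangle)$. For a nontrivial additive character $\chi$ of $\mathbb{F}_q$ let $\rho_\chi$ be the unique irreducible representation of $H(W)$ with central character $\chi$. The oscillator (Weil) representation $\omega=\omega_\chi$ is the representation of $Sp(W)$ on the space of $\rho_\chi$ with $\omega(g)\rho_\chi(w,t)\omega(g)^{-1}=\rho_\chi(gw,t)$. Up to isomorphism $Sp_{2n}$ has two oscillator representations (depending on $\chi$ modulo squares), each a sum of two irreducible components, giving four irreducible components in total. Dual pair and eta correspondence: fix $\chi$. Let $V$ be $\mathbb{F}_q^k$ with a non-degenerate symmetric bilinear form $B$, with isometry group $O_k$, and $W=\mathbb{F}_q^{2n}$ with its symplectic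 form. Then $W\otimes V$ with the tensor product form is symplectic of dimension $2nk$, and $Sp_{2n}\times O_k$ acts on its oscillator representation $\omega_{2nk}$, which decomposes as $\omega_{2nk}\simeq\sum_{\tau\in\widehat{O}_k}\Omega_\tau\otimes\tau$ with $\Omega_\tau$ a representation of $Sp_{2n}$. $U$-rank: let $U\subset Sp_{2n}$ be the Siegel unipotent group of matrices $\begin{bmatrix} I_n&S\\0&I_n\end{bmatrix}$ with $S$ a symmetric $n\times n$ matrix. Each character of $U$ has the form $S\mapsto\chi_0(\mathrm{trace}(TS))$ with $T$ symmetric ($\chi_0$ a fixed nontrivial additive character), and its rank is the rank of $T$. The $U$-rank of a representation of $Sp_{2n}$ is the maximal rank of a character of $U$ appearing in its restriction to $U$. For $k<n$ it is known that each $\Omega_\tau$ contains a unique irreducible representation $\eta(\tau)$ of $U$-rank $k$, appearing with multiplicity one, all other constituents having smaller $U$-rank, that $\tau\mapsto\eta(\tau)$ is injective on $\widehat O_k$, and that the images for the two forms $B$ are disjoint. Tensor rank: $\sigma\in\widehat{Sp}_{2n}$ has tensor rank $\le k$ if it is a constituent of an $\ell$-fold tensor product, $\ell\le k$, of the four irreducible components of the two oscillator representations of $Sp_{2n}$ (the case $\ell=0$ being the trivial representation); the tensor rank is the smallest such $k$. $(\widehat{Sp}_{2n})_{\otimes,k}$ is the set of irreducible representations of tensor rank exactly $k$. *)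

(* Defs.v *)
From HB Require Import structures.
From mathcomp Require Import all_boot all_order all_algebra all_fingroup.
From mathcomp Require Import all_solvable all_field all_character mxtens ring.

Set Implicit Arguments.
Unset Strict Implicit.
Unset Printing Implicit Defensive.

Import Order.TTheory GRing.Theory Num.Theory.
Local Open Scope ring_scope.

(* Conventions.  Complex representations are taken over algC, the coefficient *)
(* field of the character library; isomorphism classes of irreducible *)
(* representations of a finite group G are the indices Iirr G.  Vectors are *)
(* columns, matrices act on the left, and A : 'M_m stands for the bilinear *)
(* form (w, w') |-> w^T A w'. *)

Section IsometryGroup.

Variables (F : finFieldType) (m : nat).

Definition is_isometry (A : 'M[F]_m) : pred 'M[F]_m :=
  fun g => (g \in unitmx) && (g^T *m A *m g == A).

Inductive form_isometry (A : 'M[F]_m) := Isometry g of is_isometry A g.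

Definition isometry_val A (x : form_isometry A) := let: Isometry g _ := x in g.

HB.instance Definition _ A := [isSub for @isometry_val A].
HB.instance Definition _ A := [Finite of form_isometry A by <:].

Variable A : 'M[F]_m.
Implicit Types x y z : form_isometry A.

Fact isometry_one_subproof : is_isometry A 1%:M.
Proof. by rewrite /is_isometry unitmx1 trmx1 mul1mx mulmx1 eqxx. Qed.

Fact isometry_mul_subproof x y : is_isometry A (val x *m val y).
Proof.
have /andP[Ux /eqP Ax] := valP x; have /andP[Uy /eqP Ay] := valP y.
rewrite /is_isometry unitmx_mul Ux Uy /= trmx_mul.
have ->: (val y)^T *m (val x)^T *m A *m (val x *m val y)
       = (val y)^T *m ((val x)^T *m A *m val x) *m val y by rewrite !mulmxA.
by rewrite Ax Ay.
Qed.

Fact isometry_inv_subproof x : is_isometry A (invmx (val x)).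
Proof.
have /andP[Ux /eqP Ax] := valP x.
rewrite /is_isometry unitmx_inv Ux /= -[X in _ *m X *m _]Ax trmx_inv.
by rewrite !mulmxA mulVmx ?unitmx_tr // mul1mx -mulmxA mulmxV // mulmx1.
Qed.

Definition isometry_one : form_isometry A := Isometry isometry_one_subproof.
Definition isometry_mul x y : form_isometry A :=
  Isometry (isometry_mul_subproof x y).
Definition isometry_inv x : form_isometry A :=
  Isometry (isometry_inv_subproof x).

Fact isometry_mulA : associative isometry_mul.
Proof. by move=> x y z; apply: val_inj; rewrite /= mulmxA. Qed.

Fact isometry_mul1 : left_id isometry_one isometry_mul.
Proof. by move=> x; apply: val_inj; rewrite /= mul1mx. Qed.

Fact isometry_mulV : left_inverse isometry_one isometry_inv isometry_mul.
Proof.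
move=> x; apply: val_inj; rewrite /= mulVmx //.
by have /andP[] := valP x.
Qed.

HB.instance Definition _ := Finite_isGroup.Build (form_isometry A)
  isometry_mulA isometry_mul1 isometry_mulV.

End IsometryGroup.

Section Heisenberg.

Variables (F : finFieldType) (m : nat).

Inductive heis (A : 'M[F]_m) := Heis of 'cV[F]_m & F.

Definition heis_pair A (x : heis A) := let: Heis w t := x in (w, t).
Definition pair_heis A (x : 'cV[F]_m * F) : heis A := Heis A x.1 x.2.

Fact heis_pairK A : cancel (@heis_pair A) (@pair_heis A).
Proof. by case. Qed.

HB.instance Definition _ A := Finite.copy (heis A) (can_type (@heis_pairK A)).

Variable A : 'M[F]_m.
Implicit Types x y z : heis A.

Definition bform (w w' : 'cV[F]_m) : F := (w^T *m A *m w') 0 0.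

Definition heis_one : heis A := Heis A 0 0.
Definition heis_mul x y : heis A :=
  let: Heis w t := x in let: Heis w' t' := y in
  Heis A (w + w') (t + t' + 2%:R^-1 * bform w w').
(* The last term vanishes when the form is alternating; it only serves to give *)
(* a group for every A. *)
Definition heis_inv x : heis A :=
  let: Heis w t := x in Heis A (- w) (- t + 2%:R^-1 * bform w w).

Fact heis_mulA : associative heis_mul.
Proof.
case=> [u r] [v s] [w t] /=; rewrite addrA; congr (Heis _ _ _).
have bDl a b c : bform (a + b) c = bform a c + bform b c.
  by rewrite /bform linearD /= !mulmxDl mxE.
have bDr a b c : bform a (b + c) = bform a b + bform a c.
  by rewrite /bform mulmxDr mxE.
by rewrite bDl bDr; ring.
Qed.

Fact heis_mul1 : left_id heis_one heis_mul.
Proof.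
by case=> w t; rewrite /= /bform trmx0 !mul0mx mxE mulr0 addr0 !add0r.
Qed.

Fact heis_mulV : left_inverse heis_one heis_inv heis_mul.
Proof.
case=> w t; rewrite /= addNr; congr (Heis _ _ _).
have ->: bform (- w) w = - bform w w by rewrite /bform linearN /= !mulNmx mxE.
by ring.
Qed.

HB.instance Definition _ := Finite_isGroup.Build (heis A)
  heis_mulA heis_mul1 heis_mulV.

End Heisenberg.

Section Oscillator.

Variable F : finFieldType.

(* F is regarded as a finite group under addition. *)
Definition nontrivial_char (chi : 'CF([set: F])) : Prop :=
  chi \is a linear_char /\ chi != 1.

Variable m : nat.

Definition is_heis_rep (A : 'M[F]_m) (chi : 'CF([set: F])) d
    (rho : mx_representation algC [set: heis A] d) : Prop :=
  mx_irreducible rho /\ forall t, rho (Heis A 0 t) = (chi t)%:M.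

(* om is the oscillator representation attached to chi, on the space of rho. *)
Definition is_oscillator (A : 'M[F]_m) (chi : 'CF([set: F])) d
    (rho : mx_representation algC [set: heis A] d)
    (om : mx_representation algC [set: form_isometry A] d) : Prop :=
  is_heis_rep chi rho /\
  forall (g : form_isometry A) (w : 'cV[F]_m) (t : F),
    om g *m rho (Heis A w t) *m om g^-1%g = rho (Heis A (val g *m w) t).

End Oscillator.

Section Symplectic.

Variables (F : finFieldType) (n : nat).

Definition symplJ : 'M[F]_(n + n) := block_mx 0 1%:M (- 1%:M) 0.

Definition siegelU : {set form_isometry symplJ} :=
  [set g | [exists S : 'M[F]_n,
    (S^T == S) && (val g == block_mx 1%:M S 0 1%:M)]].

Fact siegelU_group_set : group_set siegelU.
Proof.
apply/group_setP; split=> [|x y].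
  rewrite inE; apply/existsP; exists 0; rewrite trmx0 eqxx /=.
  by apply/eqP; exact: scalar_mx_block.
rewrite !inE => /existsP[S /andP[/eqP sS /eqP xS]].
case/existsP=> T /andP[/eqP sT /eqP yT].
apply/existsP; exists (S + T); rewrite linearD /= sS sT eqxx /=.
apply/eqP; rewrite /= -![isometry_val _]/(val _) xS yT mulmx_block.
by rewrite !mul1mx !mulmx1 !mul0mx !mulmx0 !addr0 !add0r addrC.
Qed.

Canonical siegelU_group := Group siegelU_group_set.

Definition siegel_char (chi0 : 'CF([set: F])) (T : 'M[F]_n)
    (i : Iirr siegelU) : bool :=
  [forall g in siegelU, 'chi_i g == chi0 (\tr (T *m ursubmx (val g)))].

(* The value does not depend on the nontrivial character chi0. *)
Definition Urank (chi0 : 'CF([set: F]))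
    (phi : 'CF([set: form_isometry symplJ])) : nat :=
  \max_(T : 'M[F]_n | (T^T == T) &&
      [exists i in irr_constt ('Res[siegelU] phi), siegel_char chi0 T i])
    \rank T.

(* chi ranges over all nontrivial additive characters of F: these give the two *)
(* oscillator representations up to isomorphism, hence the four components. *)
Definition oscillator_component (i : Iirr [set: form_isometry symplJ]) : Prop :=
  exists (chi : 'CF([set: F])) (d : nat)
         (rho : mx_representation algC [set: heis symplJ] d)
         (om : mx_representation algC [set: form_isometry symplJ] d),
    [/\ nontrivial_char chi, is_oscillator chi rho om
      & i \in irr_constt (cfRepr om)].

Definition tensor_rank_le (sigma : Iirr [set: form_isometry symplJ])
    (k : nat) : Prop :=
  exists s : seq (Iirr [set: form_isometry symplJ]),
    [/\ (size s <= k)%N, forall i, i \in s -> oscillator_component i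
      & sigma \in irr_constt (\prod_(i <- s) 'chi_i)].

Definition has_tensor_rank (sigma : Iirr [set: form_isometry symplJ])
    (k : nat) : Prop :=
  tensor_rank_le sigma k /\ forall j, tensor_rank_le sigma j -> (k <= j)%N.

End Symplectic.

Section DualPair.

Variable F : finFieldType.

Fact tens_isometry_subproof m1 m2 (A : 'M[F]_m1) (B : 'M[F]_m2)
    (g : form_isometry A) (h : form_isometry B) :
  is_isometry (tensmx A B) (tensmx (val g) (val h)).
Proof.
have /andP[Ug /eqP Ag] := valP g; have /andP[Uh /eqP Bh] := valP h.
rewrite /is_isometry trmx_tens !tensmx_mul Ag Bh eqxx andbT.
have: tensmx (val g) (val h) *m tensmx (invmx (val g)) (invmx (val h)) = 1%:M.
  rewrite tensmx_mul !mulmxV //; apply/matrixP=> i j.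
  case: (mxtens_indexP i) => [i1 i2]; case: (mxtens_indexP j) => [j1 j2].
  rewrite tensmxE !mxE (can_eq (@mxtens_indexK _ _)) xpair_eqE.
  by case: eqP; case: eqP; rewrite ?mulr1 ?mulr0 ?mul0r.
by case/mulmx1_unit.
Qed.

Definition tens_isometry m1 m2 (A : 'M[F]_m1) (B : 'M[F]_m2)
    (g : form_isometry A) (h : form_isometry B) : form_isometry (tensmx A B) :=
  Isometry (tens_isometry_subproof g h).

Variables (n k : nat) (B : 'M[F]_k).

Let Sp := [set: form_isometry (symplJ F n)].
Let O := [set: form_isometry B].

(* The isomorphism omega = \sum_tau Omega_tau (x) tau over Sp x O, stated on *)
(* characters. *)
Definition howe_decomposition d
    (om : mx_representation algC [set: form_isometry (tensmx (symplJ F n) B)] d)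
    (Omega : Iirr O -> 'CF(Sp)) : Prop :=
  (forall tau, Omega tau \is a character) /\
  forall (g : form_isometry (symplJ F n)) (h : form_isometry B),
    cfRepr om (tens_isometry g h) =
      \sum_(tau : Iirr O) Omega tau g * 'chi_tau h.

(* The constituent of U-rank k of Omega_tau.  For k < n it exists and is *)
(* unique, so neither the choice made by pick nor the default value matters. *)
Definition eta (chi0 : 'CF([set: F])) (Omega : Iirr O -> 'CF(Sp))
    (tau : Iirr O) : Iirr Sp :=
  odflt 0 [pick sigma in irr_constt (Omega tau) | Urank chi0 'chi_sigma == k].

End DualPair.

(* Main.v *)
Require Import Defs.
From mathcomp Require Import all_boot all_order all_algebra all_fingroup.
From mathcomp Require Import all_solvable all_field all_character mxtens ring.

(** Let omega be the oscillator representation of Sp(W (x) V), restricted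
    to Sp(W), for a form B on V of dimension k < n. The theorem compares
    two filtrations, by U-rank and by tensor rank, and rests on three
    facts.

    The spectrum of U. In the Schrodinger model U acts diagonally on the
    points x of an n by k matrix space, through the character with matrix
    (al / 2) x B x^T, where al is the nonzero scalar with chi (b) = chi0
    (al b) (om_siegelU). A product of l oscillator representations is the
    omega of an l-dimensional form, since orthogonal sums of forms
    correspond to tensor products; hence the U-rank never exceeds the
    tensor rank. For rank k the matrix x B x^T determines B up to
    congruence, so the two forms give disjoint sets of representations of
    U-rank k. The group O(B) acts freely on the x of rank k, so every tau
    occurs in that part of omega: each Omega_tau has a constituent of
    U-rank k (tau_full_moment), and eta tau has tensor rank exactly k.

    The commutant of Sp(W). It is spanned by sums of Heisenberg operators
    over orbits of Sp(W) on W (x) V. By Witt's theorem an orbit is given by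
    a row space and a Gram matrix, and Fourier inversion turns the orbit
    sums into Gauss sums attached to a subspace of V and a bilinear form on
    it. When that form is nondegenerate, its Cayley transform h lies in
    O(B) and the Gauss sum is proportional to omega(h) (gauss_regular).
    Otherwise the image of the Gauss sum is fixed by W (x) v for an
    isotropic vector v (gauss_singular). The vectors fixed by W (x) v carry
    the oscillator representation for the form induced on v^perp / v, of
    dimension k - 2, so their constituents have tensor rank less than k
    (line_kill). Modulo smaller tensor rank the commutant is thus the group
    algebra of O(B), and Omega_tau has only one constituent of tensor rank
    k, namely eta tau (eta_unique).

    Exhaustion. A representation of tensor rank k occurs in a product of k
    oscillator representations, that is, in the omega of a diagonal form,
    which is congruent to one of the two given forms (form_dichotomy). The
    uniqueness theorem of Stone and von Neumann identifies the
    representations attached to congruent forms up to a character of Sp(W),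
    and such a character is trivial because n > 1 (osc_char_unique).

    The oscillator representations are given only for the forms of the
    theorem and inside the products defining tensor rank. Those needed for
    the lines of V are cut out of omega itself (osc_char_of_anisotropic). *)

Set Implicit Arguments.
Unset Strict Implicit.
Unset Printing Implicit Defensive.

Import GRing.Theory Num.Theory.
Local Open Scope ring_scope.

(** * Additive characters, the form of a tensor product, and linear spans *)

Lemma mx_neq0P (R : nzRingType) m n (D : 'M[R]_(m, n)) :
  D != 0 -> exists i j, D i j != 0.
Proof.
move=> D0; suff /existsP[i /existsP[j h]] : [exists i, [exists j, D i j != 0]].
  by exists i, j.
apply: contraNT D0; rewrite negb_exists => /forallP h.
apply/eqP/matrixP=> i j; rewrite mxE; apply/eqP; apply/negPn.
by have := h i; apply: contra => h1; apply/existsP; exists j.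
Qed.

Lemma mxtrace_mul_delta (R : comNzRingType) m n (D : 'M[R]_(n, m)) i j :
  \tr (delta_mx j i *m D) = D i j.
Proof.
rewrite mxtrace_mulC /mxtrace (bigD1 i) //= big1 => [|l li]; last first.
  by rewrite mxE big1 // => s _; rewrite !mxE (negPf li) andbF mulr0.
rewrite addr0 mxE (bigD1 j) //= big1 => [|s sj]; last first.
  by rewrite !mxE (negPf sj) mulr0.
by rewrite !mxE !eqxx mulr1 addr0.
Qed.

Section AdditiveChar.
Variables (F : finFieldType) (chi : 'CF([set: F])).
Hypothesis chi_nt : nontrivial_char chi.

Lemma chiD a b : chi (a + b) = chi a * chi b.
Proof. by case: chi_nt => lin _; rewrite -(lin_charM lin) ?inE. Qed.

Lemma chi_0 : chi 0 = 1.
Proof. by case: chi_nt => lin _; exact: (lin_char1 lin). Qed.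

Lemma chi_neq0 a : chi a != 0.
Proof. by case: chi_nt => lin _; rewrite lin_char_neq0 ?inE. Qed.

Lemma chiN a : chi (- a) = (chi a)^*.
Proof. by case: chi_nt => lin _; rewrite -(lin_charV_conj lin) ?inE. Qed.

Lemma chiNK a : chi (- a) * chi a = 1.
Proof. by rewrite -chiD addNr chi_0. Qed.

Lemma chi_nontriv : exists a, chi a != 1.
Proof.
case: chi_nt => lin ntr; have [/existsP[a ha]|] := boolP [exists a, chi a != 1].
  by exists a.
rewrite negb_exists => /forallP h; case/negP: ntr; apply/eqP/cfunP=> a.
by rewrite cfun1E inE; apply/eqP/negPn/h.
Qed.

Lemma chi_scale_nontriv b : b != 0 -> exists a, chi (a * b) != 1.
Proof.
by move=> b0; have [a ha] := chi_nontriv; exists (a / b); rewrite divfK.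
Qed.

Lemma sum_chi_mx m n (D : 'M[F]_(n, m)) :
  \sum_(X : 'M[F]_(m, n)) chi (\tr (X *m D))
    = if D == 0 then #|{: 'M[F]_(m, n)}|%:R else 0.
Proof.
have [->|D0] := eqVneq.
  under eq_bigr do rewrite mulmx0 mxtrace0 chi_0.
  by rewrite sumr_const.
have [i [j Dij]] := mx_neq0P D0.
have [a ha] := chi_scale_nontriv Dij.
set S := \sum_X _; apply/eqP.
have : S = chi (a * D i j) * S.
  rewrite {1}/S (reindex_inj (addrI (a *: delta_mx j i))) mulr_sumr /=.
  apply: eq_bigr => X _; rewrite mulmxDl mxtraceD chiD //; congr (chi _ * _).
  by rewrite -scalemxAl mxtraceZ mxtrace_mul_delta.
move/eqP; rewrite -subr_eq0 -{1}[S]mul1r -mulrBl mulf_eq0 subr_eq0 eq_sym.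
by rewrite (negPf ha).
Qed.

End AdditiveChar.

Section TraceForm.
Variables (F : finFieldType) (m k : nat) (J : 'M[F]_m) (B : 'M[F]_k).
Implicit Types w : 'M[F]_(m, k).

(** The form of W (x) V, whose elements are written as matrices: the column
    w and the vector v give the matrix w v^T. *)
Definition tform w w' : F := \tr (w^T *m J *m w' *m B).

Lemma tformDl u v w : tform (u + v) w = tform u w + tform v w.
Proof. by rewrite /tform linearD /= !mulmxDl mxtraceD. Qed.
Lemma tformDr u v w : tform u (v + w) = tform u v + tform u w.
Proof. by rewrite /tform mulmxDr !mulmxDl mxtraceD. Qed.
Lemma tformZl a u v : tform (a *: u) v = a * tform u v.
Proof. by rewrite /tform linearZ /= -!scalemxAl mxtraceZ. Qed.
Lemma tformZr a u v : tform u (a *: v) = a * tform u v.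
Proof. by rewrite /tform -scalemxAr -!scalemxAl mxtraceZ. Qed.
Lemma tformNl u v : tform (- u) v = - tform u v.
Proof. by rewrite -scaleN1r tformZl mulN1r. Qed.
Lemma tformNr u v : tform u (- v) = - tform u v.
Proof. by rewrite -scaleN1r tformZr mulN1r. Qed.

Hypotheses (Jskew : J^T = - J) (Bsym : B^T = B).

Lemma tformC u v : tform u v = - tform v u.
Proof.
rewrite /tform -mxtrace_tr !trmx_mul Bsym Jskew trmxK mxtrace_mulC.
by rewrite mulNmx mulmxN mulNmx linearN /= !mulmxA.
Qed.

Hypothesis two_neq0 : (2 : F) != 0.

Lemma tformxx u : tform u u = 0.
Proof.
have /eqP := tformC u u; rewrite -subr_eq0 opprK -mulr2n -mulr_natl.
by rewrite mulf_eq0 (negPf two_neq0) => /eqP.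
Qed.

Hypotheses (Junit : J \in unitmx) (Bunit : B \in unitmx).

Lemma tform_nondeg w : w != 0 -> exists v, tform v w != 0.
Proof.
move=> w0; have D0 : J *m w *m B != 0.
  apply: contraNneq w0 => h.
  have := congr1 (fun X => invmx J *m X *m invmx B) h.
  by rewrite !mulmxA mulVmx // mul1mx mulmxK // mulmx0 mul0mx => ->.
have [i [j Dij]] := mx_neq0P D0.
exists (delta_mx i j); rewrite /tform -2!mulmxA trmx_delta mxtrace_mul_delta.
by rewrite mulmxA.
Qed.

End TraceForm.

Section Span.
Variables (I : finType) (d : nat) (R : I -> 'M[algC]_d).
Definition rspan X := exists c : I -> algC, X = \sum_i c i *: R i.

Lemma rspan0 : rspan 0.
Proof. by exists (fun=> 0); rewrite big1 // => i _; rewrite scale0r. Qed.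

Lemma rspanD X Y : rspan X -> rspan Y -> rspan (X + Y).
Proof.
move=> [a ->] [b ->]; exists (fun i => a i + b i); rewrite -big_split.
by apply: eq_bigr => i _; rewrite scalerDl.
Qed.

Lemma rspanZ a X : rspan X -> rspan (a *: X).
Proof.
move=> [b ->]; exists (fun i => a * b i); rewrite scaler_sumr.
by apply: eq_bigr => i _; rewrite scalerA.
Qed.

Lemma rspan_id i : rspan (R i).
Proof.
exists (fun j => (j == i)%:R); rewrite (bigD1 i) //= eqxx scale1r big1 ?addr0 //.
by move=> j /negPf->; rewrite scale0r.
Qed.

Lemma rspan_sum (K : Type) (r : seq K) (P : pred K) (G : K -> 'M_d) :
  (forall i, P i -> rspan (G i)) -> rspan (\sum_(i <- r | P i) G i).
Proof.
move=> h; apply: (big_ind rspan) => //; [exact: rspan0 | exact: rspanD].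
Qed.
End Span.

(** * Systems of Heisenberg operators *)

Lemma mulmx_deltaE (R : comNzRingType) m n p q (A : 'M[R]_(m, n))
    (C : 'M[R]_(p, q)) i j s t :
  (A *m delta_mx i j *m C) s t = A s i * C j t.
Proof.
rewrite -mulmxA mxE (bigD1 i) //= big1 => [|u ui]; last first.
  by rewrite mxE big1 ?mulr0 // => v _; rewrite mxE (negPf ui) mul0r.
rewrite addr0 mxE (bigD1 j) //= big1 => [|v vj]; last first.
  by rewrite mxE (negPf vj) andbF mul0r.
by rewrite mxE !eqxx mul1r addr0.
Qed.

Lemma scalar_mx_cent (R : comNzRingType) d (X : 'M[R]_d) :
  (forall Y, X *m Y = Y *m X) -> exists a, X = a%:M.
Proof.
case: d X => [|d] X cX; first by exists 0; apply/matrixP=> [[]].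
exists (X 0 0); apply/matrixP=> i j.
have := congr1 (fun M : 'M_d.+1 => M i 0) (cX (delta_mx j 0)).
rewrite -[X *m delta_mx _ _]mulmx1 -[delta_mx _ _ *m X]mul1mx mulmxA.
by rewrite !mulmx_deltaE !mxE eqxx mulr1 mulr_natl.
Qed.

(** Schur's lemma: the hypotheses make the row kernel and the column
    cokernel of Y stable under all matrices, so both vanish. *)
Lemma intertwiner_inv (K : fieldType) d d' (Y : 'M[K]_(d', d)) : Y != 0 ->
  (forall X, exists X', Y *m X = X' *m Y) ->
  (forall X', exists X, X' *m Y = Y *m X) ->
  exists Z, Y *m Z = 1%:M /\ Z *m Y = 1%:M.
Proof.
move=> Y0 hX hX'; have [i [j Yij]] := mx_neq0P Y0.
exists (pinvmx Y); split.
  apply: mulmxVp; rewrite -kermx_eq0; apply: contraNT Yij => /mx_neq0P[a [b Kab]].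
  have h X : kermx Y *m X *m Y = 0.
    by case: (hX' X) => X' E; rewrite -mulmxA E mulmxA mulmx_ker mul0mx.
  have := congr1 (fun M : 'M_(d', d) => M a j) (h (delta_mx b i)).
  rewrite mulmx_deltaE [RHS]mxE => /eqP; rewrite mulf_eq0 (negPf Kab) => /eqP.
  by move->.
apply: mulVpmx; apply/negPn; apply: contraNN Yij => nf.
have C0 : cokermx Y != 0.
  rewrite -mxrank_eq0 mxrank_coker subn_eq0 -ltnNge ltn_neqAle rank_leq_col.
  by rewrite andbT.
have [a [b Cab]] := mx_neq0P C0.
have h X : Y *m X *m cokermx Y = 0.
  by case: (hX X) => X' ->; rewrite -mulmxA mulmx_coker mulmx0.
have := congr1 (fun M : 'M_(d', d) => M i b) (h (delta_mx j a)).
rewrite mulmx_deltaE [RHS]mxE => /eqP; rewrite mulf_eq0 (negPf Cab) orbF.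
by move=> ->.
Qed.

(** Skew-symmetric forms are the alternating ones, the characteristic being
    odd. *)
Definition nondeg_alt (F : finFieldType) m (J : 'M[F]_m) :=
  J^T = - J /\ J \in unitmx.
Definition nondeg_sym (F : finFieldType) k (B : 'M[F]_k) :=
  B^T = B /\ B \in unitmx.

Section HeisenbergSystem.

Variables (F : finFieldType) (chi : 'CF([set: F])).
Hypothesis chi_nt : nontrivial_char chi.
Hypothesis two_neq0 : (2 : F) != 0.

(** An irreducible representation of the Heisenberg group of W (x) V with
    central character chi, seen as a projective representation of the
    additive group W (x) V. Irreducibility appears in the form given by
    Burnside's theorem: the operators span all matrices. *)
Definition heis_sys m k (J : 'M[F]_m) (B : 'M[F]_k) d
    (R : 'M[F]_(m, k) -> 'M[algC]_d) : Prop :=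
  [/\ (0 < d)%N, R 0 = 1%:M,
      forall w w', R w *m R w' = chi (2^-1 * tform J B w w') *: R (w + w')
    & forall X, rspan R X].

Lemma half_add (a : F) : 2^-1 * a + 2^-1 * a = a.
Proof. by rewrite -mulrDl -[2^-1 + _]mulr2n -[_ *+ 2]mulr_natl divff // mul1r. Qed.

Section OneSystem.
Variables (m k : nat) (J : 'M[F]_m) (B : 'M[F]_k).
Hypotheses (Jalt : nondeg_alt J) (Bsym : nondeg_sym B).
Variables (d : nat) (R : 'M[F]_(m, k) -> 'M[algC]_d).
Hypothesis hR : heis_sys J B R.
Local Notation f := (tform J B).

Let Js : J^T = - J. Proof. by case: Jalt. Qed.
Let Ju : J \in unitmx. Proof. by case: Jalt. Qed.
Let Bs : B^T = B. Proof. by case: Bsym. Qed.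
Let Bu : B \in unitmx. Proof. by case: Bsym. Qed.

Lemma hs_d : (0 < d)%N. Proof. by case: hR. Qed.
Lemma hs0 : R 0 = 1%:M. Proof. by case: hR. Qed.
Lemma hsM w w' : R w *m R w' = chi (2^-1 * f w w') *: R (w + w').
Proof. by case: hR. Qed.
Lemma hs_full X : rspan R X.
Proof. by case: hR. Qed.

Lemma hsM0 w w' : f w w' = 0 -> R w *m R w' = R (w + w').
Proof. by move=> h; rewrite hsM h mulr0 chi_0 // scale1r. Qed.

Lemma hsV w : R w *m R (- w) = 1%:M.
Proof. by rewrite hsM0 ?subrr ?hs0 // tformNr tformxx ?oppr0. Qed.

Lemma hsVl w : R (- w) *m R w = 1%:M.
Proof. by have := hsV (- w); rewrite opprK. Qed.

Lemma hs_comm v w : R v *m R w = chi (f v w) *: (R w *m R v).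
Proof.
rewrite !hsM scalerA -chiD //; congr (chi _ *: R _); last exact: addrC.
by apply/eqP; rewrite [f w v]tformC // mulrN eq_sym subr_eq half_add.
Qed.

Lemma hs_conj v w : R v *m R w *m R (- v) = chi (f v w) *: R w.
Proof. by rewrite hs_comm -scalemxAl -mulmxA hsV mulmx1. Qed.

(** Conjugation by R v multiplies R w by chi (f v w), which differs from 1
    for a suitable v. *)
Lemma hs_tr w : w != 0 -> \tr (R w) = 0.
Proof.
move=> w0; have [v fv] := tform_nondeg Ju Bu w0.
have [a ha] := chi_scale_nontriv chi_nt fv.
have : \tr (R w) = chi (a * f v w) * \tr (R w).
  rewrite -mxtraceZ -tformZl -hs_conj mxtrace_mulC mulmxA hsVl mul1mx //.
move/eqP; rewrite -subr_eq0 -{1}[\tr _]mul1r -mulrBl mulf_eq0 subr_eq0 eq_sym.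
by rewrite (negPf ha) /= => /eqP.
Qed.

Lemma hs_tr0 : \tr (R 0) = d%:R.
Proof. by rewrite hs0 mxtrace1. Qed.

Lemma hs_d_neq0 : d%:R != 0 :> algC.
Proof. by rewrite pnatr_eq0 -lt0n hs_d. Qed.

(** By hs_tr the operators R w are orthogonal for the trace form. *)
Lemma hs_free c : \sum_w c w *: R w = 0 -> forall v, c v = 0.
Proof.
move=> h v; have := congr1 (fun X => \tr (X *m R (- v))) h.
rewrite /= mul0mx mxtrace0 mulmx_suml raddf_sum (bigD1 v) //= big1 => [|w wv].
  rewrite addr0 -scalemxAl mxtraceZ hsV mxtrace1 => /eqP.
  by rewrite mulf_eq0 (negPf hs_d_neq0) orbF => /eqP.
by rewrite -scalemxAl mxtraceZ hsM mxtraceZ hs_tr ?mulr0 // subr_eq0.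
Qed.

Lemma hs_scalar X : (forall w, X *m R w = R w *m X) -> exists a, X = a%:M.
Proof.
move=> h; apply: scalar_mx_cent => Y; have [c ->] := hs_full Y.
rewrite mulmx_sumr mulmx_suml; apply: eq_bigr => w _.
by rewrite -scalemxAr h scalemxAl.
Qed.

End OneSystem.

Section Uniqueness.
Variables (m k : nat) (J : 'M[F]_m) (B : 'M[F]_k).
Hypotheses (Jalt : nondeg_alt J) (Bsym : nondeg_sym B).
Variables (d d' : nat).
Variables (R : 'M[F]_(m, k) -> 'M[algC]_d) (R' : 'M[F]_(m, k) -> 'M[algC]_d').
Hypotheses (hR : heis_sys J B R) (hR' : heis_sys J B R').

(** The average of R' w X R (- w) over w intertwines the two systems for
    every X. It is nonzero for some elementary X because the R' w are
    linearly independent, and then invertible because both systems span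
    full matrix algebras. *)
Lemma stone_von_neumann : exists (Y : 'M_(d', d)) (Z : 'M_(d, d')),
  [/\ Y *m Z = 1%:M, Z *m Y = 1%:M & forall w, Y *m R w = R' w *m Y].
Proof.
have [Js Ju] := Jalt; have [Bs Bu] := Bsym.
pose Phi (X : 'M_(d', d)) := \sum_w R' w *m X *m R (- w).
have PhiI X v : Phi X *m R v = R' v *m Phi X.
  rewrite /Phi mulmx_suml mulmx_sumr [RHS](reindex_inj (addrI (- v))) /=.
  apply: eq_bigr => w _; rewrite -mulmxA (hsM hR) !mulmxA (hsM hR').
  rewrite addNKr opprD opprK [- w + v]addrC -scalemxAr -!scalemxAl.
  congr (chi (_ * _) *: _); rewrite tformNl tformDr tformNr tformxx //.
  by rewrite oppr0 add0r [tform J B v w]tformC.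
have [X PhiX] : exists X, Phi X != 0.
  have d0 := hs_d hR; have d0' := hs_d hR'.
  pose i := Ordinal d0; pose i' := Ordinal d0'.
  have [/existsP[a /existsP[b h]]|] :=
     boolP [exists a, [exists b, Phi (delta_mx a b) != 0]].
    by exists (delta_mx a b).
  rewrite negb_exists => /forallP h; exfalso.
  have {}h a b : Phi (delta_mx a b) = 0.
    have := h a; rewrite negb_exists => /forallP /(_ b).
    by rewrite negbK => /eqP.
  (* A linear relation whose coefficient at w = 0 is 1, as R 0 is the
     identity. *)
  have E : \sum_w R (- w) i i *: R' w = 0.
    apply/matrixP=> a b; have := congr1 (fun M : 'M_(d', d) => M a i) (h b i).
    rewrite /Phi summxE [RHS]mxE => E0; rewrite summxE [RHS]mxE -[RHS]E0.
    apply: eq_bigr => w _.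
    by rewrite mulmx_deltaE mxE mulrC.
  have := hs_free Jalt Bsym hR' E 0; rewrite oppr0 (hs0 hR) mxE eqxx.
  by move/eqP; rewrite oner_eq0.
exists (Phi X); have [||Z [h1 h2]] := intertwiner_inv PhiX.
- move=> M; have [c ->] := hs_full hR M; exists (\sum_w c w *: R' w).
  rewrite mulmx_sumr mulmx_suml; apply: eq_bigr => w _.
  by rewrite -scalemxAr PhiI scalemxAl.
- move=> M; have [c ->] := hs_full hR' M; exists (\sum_w c w *: R w).
  rewrite mulmx_suml [RHS]mulmx_sumr; apply: eq_bigr => w _.
  by rewrite -scalemxAl -PhiI scalemxAr.
by exists Z; split.
Qed.

End Uniqueness.

Section Compression.
Variables (m k : nat) (J : 'M[F]_m) (B : 'M[F]_k).
Hypotheses (Jalt : nondeg_alt J) (Bsym : nondeg_sym B).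
Variables (d : nat) (R : 'M[F]_(m, k) -> 'M[algC]_d).
Hypothesis hR : heis_sys J B R.
Local Notation f := (tform J B).

(** For a totally isotropic subspace N, the projector onto the vectors
    fixed by all R y with y in N. *)
Definition iso_avg (N : {set 'M[F]_(m, k)}) : 'M[algC]_d :=
  #|N|%:R^-1 *: \sum_(y in N) R y.

Variable N : {set 'M[F]_(m, k)}.
Hypothesis N0 : 0 \in N.
Hypothesis ND : forall x y, x \in N -> y \in N -> x + y \in N.
Hypothesis NZ : forall a x, x \in N -> a *: x \in N.
Hypothesis Niso : forall x y, x \in N -> y \in N -> f x y = 0.
Local Notation e := (iso_avg N).

Let NN x : x \in N -> - x \in N.
Proof. by move=> /(NZ (-1)); rewrite scaleN1r. Qed.

Lemma card_iso_neq0 : #|N|%:R != 0 :> algC.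
Proof. by rewrite pnatr_eq0 -lt0n; apply/card_gt0P; exists 0. Qed.

Lemma iso_avgMl x : x \in N -> R x *m e = e.
Proof.
move=> Nx; rewrite /iso_avg -scalemxAr mulmx_sumr; congr (_ *: _).
rewrite [RHS](reindex_inj (addrI x)) /=; apply: eq_big => [y|y Ny].
  apply/idP/idP => [|h]; first exact: ND.
  by rewrite -(addKr x y) ND // NN.
by rewrite (hsM0 hR) // Niso.
Qed.

Lemma iso_avgMr x : x \in N -> e *m R x = e.
Proof.
move=> Nx; rewrite -{2}(iso_avgMl Nx) /iso_avg -scalemxAr -scalemxAl.
rewrite mulmx_suml mulmx_sumr; congr (_ *: _); apply: eq_bigr => y Ny.
by rewrite !(hsM0 hR) ?Niso // addrC.
Qed.

Lemma iso_avg_idem : e *m e = e.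
Proof.
rewrite {1}/iso_avg -scalemxAl mulmx_suml.
under eq_bigr => y Ny do rewrite iso_avgMl //.
by rewrite sumr_const -[e *+ _]scaler_nat scalerA mulVf ?scale1r // card_iso_neq0.
Qed.

Lemma iso_avg_tr : \tr e = #|N|%:R^-1 * d%:R.
Proof.
rewrite /iso_avg mxtraceZ raddf_sum (bigD1 0) //= big1 => [|y /andP[_ y0]].
  by rewrite addr0 (hs_tr0 hR).
exact: (hs_tr Jalt Bsym hR).
Qed.

Lemma iso_avg_neq0 : e != 0.
Proof.
apply/eqP=> h; have := iso_avg_tr; rewrite h mxtrace0 => /esym/eqP.
by rewrite mulf_eq0 invr_eq0 (negPf card_iso_neq0) (negPf (hs_d_neq0 hR)).
Qed.

(** R x commutes with R y up to the scalar chi (f x y), so it maps vectors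
    fixed by N to vectors on which N acts by a nontrivial character. *)
Lemma iso_avg_kill x : ~ (forall y, y \in N -> f x y = 0) -> e *m R x *m e = 0.
Proof.
move=> hx; have [Js _] := Jalt; have [Bs _] := Bsym.
have [/existsP[y /andP[Ny fy]]|] := boolP [exists y, (y \in N) && (f x y != 0)].
  have [a ha] := chi_scale_nontriv chi_nt fy.
  have : e *m R x *m e = chi (a * f x y) *: (e *m R x *m e).
    have E : R x *m e = R x *m R (a *: y) *m e.
      by rewrite -mulmxA (iso_avgMl (NZ a Ny)).
    rewrite -[LHS]mulmxA E (hs_comm Jalt Bsym hR) tformZr.
    rewrite -(scalemxAl (chi _)) -(scalemxAr (chi _)).
    by rewrite !mulmxA (iso_avgMr (NZ a Ny)).
  move/eqP; rewrite -subr_eq0 -{1}[_ *m e]scale1r -scalerBl scaler_eq0 subr_eq0.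
  by rewrite eq_sym (negPf ha) => /eqP.
rewrite negb_exists => /forallP h; case: hx => y Ny.
by have := h y; rewrite Ny negbK => /eqP.
Qed.

Lemma idem_split (K : fieldType) (E : 'M[K]_d) : E *m E = E ->
  exists r (b : 'M_(r, d)) (c : 'M_(d, r)),
    [/\ b *m c = 1%:M, c *m b = E & r%:R = \tr E].
Proof.
move=> EE; exists (\rank E), (row_base E), (col_base E).
have h : row_base E *m col_base E = 1%:M.
  apply: (row_full_inj (col_base_full E)); rewrite mulmxA mulmx_base mulmx1.
  by apply: (row_free_inj (row_base_free E)); rewrite /= -mulmxA mulmx_base EE.
split; rewrite ?mulmx_base //.
by rewrite -{2}(mulmx_base E) mxtrace_mulC h mxtrace1.
Qed.

Variables (m' k' : nat) (J' : 'M[F]_m') (B' : 'M[F]_k').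
Variable i : 'M[F]_(m', k') -> 'M[F]_(m, k).
Hypothesis iD : forall x y, i (x + y) = i x + i y.
Hypothesis if_ : forall x y, f (i x) (i y) = tform J' B' x y.
Hypothesis iN : forall x y, y \in N -> f (i x) y = 0.
Hypothesis iperp : forall x, (forall y, y \in N -> f x y = 0) ->
  exists x', x - i x' \in N.

(** The vectors fixed by an isotropic N carry a system for N^perp / N: an
    operator R x with x outside N^perp compresses to 0 by iso_avg_kill, so
    the compressions for x in N^perp still span everything. The map i
    chooses representatives of N^perp / N, and b, c are the factors of the
    projector. *)
Lemma compress_sys r (b : 'M_(r, d)) (c : 'M_(d, r)) :
  b *m c = 1%:M -> c *m b = e -> heis_sys J' B' (fun x => b *m R (i x) *m c).
Proof.
move=> bc cb; have [Js _] := Jalt; have [Bs _] := Bsym.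
have be : b *m e = b by rewrite -cb mulmxA bc mul1mx.
have ec : e *m c = c by rewrite -cb -mulmxA bc mulmx1.
have comm x : e *m R (i x) = R (i x) *m e.
  rewrite /iso_avg -scalemxAl -scalemxAr mulmx_suml mulmx_sumr; congr (_ *: _).
  apply: eq_bigr => y Ny; rewrite (hs_comm Jalt Bsym hR) tformC // iN // oppr0.
  by rewrite chi_0 // scale1r.
have i0 : i 0 = 0 by apply: (addrI (i 0)); rewrite -iD !addr0.
split.
- rewrite lt0n; apply/eqP=> r0; case/eqP: iso_avg_neq0; rewrite -cb.
  by apply/matrixP=> s t; rewrite !mxE big1 // => u _; have := ltn_ord u; rewrite {2}r0.
- by rewrite i0 (hs0 hR) mulmx1.
- move=> x y; rewrite iD -(if_ x y).
  rewrite (_ : b *m _ *m c *m _ = b *m (R (i x) *m R (i y)) *m c).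
    by rewrite (hsM hR) -(scalemxAr (chi _)) -(scalemxAl (chi _)).
  rewrite -!mulmxA; congr (b *m (_ *m _)).
  by rewrite (mulmxA c) cb (mulmxA e) comm -mulmxA ec.
move=> Y; have -> : Y = b *m (c *m Y *m b) *m c.
  by rewrite !mulmxA bc mul1mx -mulmxA bc mulmx1.
have [a ->] := hs_full hR (c *m Y *m b).
rewrite mulmx_sumr mulmx_suml; apply: rspan_sum => x _.
rewrite -(scalemxAr (a x)) -(scalemxAl (a x)); apply: rspanZ.
have [/forallP h|] := boolP [forall y, (y \in N) ==> (f x y == 0)].
  have [y Ny|x' Nx] := iperp (x := x).
    by have := h y; rewrite Ny => /eqP.
  have -> : R x = R (i x') *m R (x - i x').
    by rewrite (hsM0 hR) ?iN // addrC subrK.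
  rewrite -ec !mulmxA -[_ *m R (x - _) *m e]mulmxA iso_avgMl // -mulmxA ec.
  exact: (rspan_id (fun x => b *m R (i x) *m c)).
move=> h; rewrite -be -ec.
have -> : b *m e *m R x *m (e *m c) = b *m (e *m R x *m e) *m c.
  by rewrite !mulmxA.
rewrite iso_avg_kill ?mulmx0 ?mul0mx; first exact: rspan0.
by move=> h'; case/negP: h; apply/forallP=> y; apply/implyP=> Ny; rewrite h'.
Qed.

End Compression.

End HeisenbergSystem.

(** * Isometries: Witt's theorem and perfectness of the symplectic group *)

Lemma row_free_ker (K : fieldType) m n (A : 'M[K]_(m, n)) :
  (forall y : 'rV_m, y *m A = 0 -> y = 0) -> row_free A.
Proof.
move=> h; rewrite -kermx_eq0; apply/eqP/row_matrixP=> i.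
by rewrite row0; apply: h; rewrite -row_mul mulmx_ker row0.
Qed.

Lemma row_free_col_mx (K : fieldType) d m (u : 'M[K]_(d, m)) (x : 'rV_m) :
  row_free u -> ~~ (x <= u)%MS -> row_free (col_mx u x).
Proof.
move=> fu nx; apply: row_free_ker => y; rewrite -[y]hsubmxK.
set a := lsubmx y; set b := rsubmx y; rewrite mul_row_col => h.
have b0 : b = 0.
  rewrite [b]mx11_scalar; have [->|b0] := eqVneq (b 0 0) 0.
    by rewrite scalemx0 || rewrite raddf0.
  case/negP: nx; apply/submxP; exists (- (b 0 0)^-1 *: a).
  move/eqP: h; rewrite {1}[b]mx11_scalar mul_scalar_mx addr_eq0 => /eqP E.
  by rewrite -scalemxAl E scaleNr scalerN opprK scalerA mulVf // scale1r.
move: h; rewrite b0 mul0mx addr0 => h.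
have -> : a = 0 by apply: (row_free_inj fu); rewrite h mul0mx.
by rewrite row_mx0.
Qed.

Section Isometries.

Variables (F : finFieldType) (m : nat) (A : 'M[F]_m).

Lemma isometry_of (g : 'M[F]_m) :
  A \in unitmx -> g^T *m A *m g = A -> is_isometry A g.
Proof.
move=> uA E; rewrite /is_isometry E eqxx andbT.
by move: uA; rewrite -{1}E unitmx_mul => /andP[].
Qed.

Implicit Types g h : form_isometry A.

Lemma isometryP g : (val g)^T *m A *m val g = A.
Proof. by have /andP[_ /eqP] := valP g. Qed.

Lemma isometry_unit g : val g \in unitmx.
Proof. by have /andP[] := valP g. Qed.

Lemma isometry_valM g h : val (g * h)%g = val g *m val h.
Proof. by []. Qed.

Lemma isometry_valV g : val g^-1%g = invmx (val g).
Proof. by []. Qed.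

Lemma isometry_val1 : val (1%g : form_isometry A) = 1%:M.
Proof. by []. Qed.

End Isometries.

Section Witt.

Variables (F : finFieldType) (m : nat) (J : 'M[F]_m).
Hypothesis two_neq0 : (2 : F) != 0.
Hypothesis Jalt : nondeg_alt J.
Let Js : J^T = - J. Proof. by case: Jalt. Qed.
Let Ju : J \in unitmx. Proof. by case: Jalt. Qed.

Lemma skew_rows p q (u : 'M_(p, m)) (v : 'M_(q, m)) :
  (u *m J *m v^T)^T = - (v *m J *m u^T).
Proof. by rewrite !trmx_mul trmxK Js mulNmx mulmxN mulmxA. Qed.

Lemma alt_row (x : 'rV_m) : x *m J *m x^T = 0.
Proof.
have := skew_rows x x; rewrite [X in X^T]mx11_scalar tr_scalar_mx -mx11_scalar.
move/eqP; rewrite -subr_eq0 opprK -mulr2n -scaler_nat scaler_eq0.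
by rewrite (negPf two_neq0) => /eqP.
Qed.

(** The image x' of a new vector x is a solution of the linear system S. If
    all solutions lay in the span of u', so would the orthogonal of u';
    counting dimensions of radicals, the orthogonal of u would lie in the
    span of u, and so would x. *)
Lemma witt_step d (u u' : 'M[F]_(d, m)) : (d < m)%N ->
    row_free u -> row_free u' -> u *m J *m u^T = u' *m J *m u'^T ->
  exists x x' : 'rV_m, [/\ row_free (col_mx u x), row_free (col_mx u' x') &
    col_mx u x *m J *m (col_mx u x)^T = col_mx u' x' *m J *m (col_mx u' x')^T].
Proof.
move=> ltdm fu fu' G.
have [x nx] : exists x : 'rV_m, ~~ (x <= u)%MS.
  have : ~~ (1%:M <= u)%MS.
    by apply: contraL ltdm => /mxrankS; rewrite mxrank1 (eqP fu) -leqNgt.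
  by case/row_subPn => i hi; exists (row i 1%:M).
have fA (v : 'M_(d, m)) : row_free v -> row_free (v *m J).
  by rewrite /row_free mxrankMfree // row_free_unit.
pose S x' := u' *m J *m x'^T == u *m J *m x^T.
suff [x' /eqP Sx' nx'] : exists2 x' : 'rV_m, S x' & ~~ (x' <= u')%MS.
  exists x, x'; split; try exact: row_free_col_mx.
  rewrite (mul_col_mx u x J) (mul_col_mx u' x' J) !tr_col_mx !mul_col_row.
  rewrite G Sx' !alt_row.
  congr block_mx; rewrite -[LHS]trmxK -[RHS]trmxK !skew_rows.
  by rewrite Sx'.
have [x0 Sx0] : exists x0, S x0.
  exists (pinvmx (u' *m J) *m (u *m J *m x^T))^T.
  by rewrite /S trmxK mulmxA mulmxVp ?mul1mx // fA.
apply/exists_inP; apply: contraNT nx.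
rewrite negb_exists => /forallP hn.
have {}hn x' : S x' -> (x' <= u')%MS.
  by move=> Sx'; have := hn x'; rewrite Sx' negbK.
pose K v := kermx (v *m J : 'M_(d, m))^T; pose Kg := kermx (u *m J *m u^T)^T.
have rK v : row_free v -> \rank (K v) = (m - d)%N.
  by move=> fv; rewrite mxrank_ker mxrank_tr (eqP (fA _ fv)).
have memK v y : (y <= K v)%MS = (v *m J *m y^T == 0).
  apply/sub_kermxP/eqP => h; apply: trmx_inj; rewrite trmx_mul ?trmxK h trmx0 //.
have K'u' : (K u' <= u')%MS.
  apply/row_subP=> i; have Ki : S (x0 + row i (K u')).
    have := row_sub i (K u'); rewrite memK /S linearD /= mulmxDr => /eqP ->.
    by rewrite addr0.
  by rewrite -(addKr x0 (row _ _)) addmx_sub ?eqmx_opp ?hn.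
have le_mg : (m - d <= \rank Kg)%N.
  rewrite -(rK u') //; case/submxP: K'u' => Z EZ; rewrite EZ.
  apply: leq_trans (mxrankM_maxl _ _) _; apply: mxrankS; apply/sub_kermxP.
  by rewrite G trmx_mul trmxK mulmxA -EZ mulmx_ker.
have KgK : (Kg *m u <= K u)%MS.
  apply/sub_kermxP; rewrite -mulmxA -[u in u *m (_)^T]trmxK -trmx_mul.
  exact: mulmx_ker.
have KKg : (K u <= Kg *m u)%MS.
  rewrite -(mxrank_leqif_sup KgK) eqn_leq mxrankS //= mxrankMfree //.
  by rewrite rK.
case/submxP: (hn x0 Sx0) => a Ea.
rewrite -[x](subrK (a *m u)) addmx_sub ?submxMl //.
have Ku := submx_trans KKg (submxMl Kg u); apply: submx_trans Ku.
rewrite memK linearB /= mulmxBr trmx_mul !mulmxA G -(eqP Sx0) Ea trmx_mul.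
by rewrite !mulmxA subrr.
Qed.

Lemma witt_row_free e d (u u' : 'M[F]_(d, m)) : (d + e)%N = m ->
    row_free u -> row_free u' -> u *m J *m u^T = u' *m J *m u'^T ->
  exists2 g : 'M_m, is_isometry J g & g *m u^T = u'^T.
Proof.
elim: e d u u' => [|e IH] d u u'.
  rewrite addn0 => dm; rewrite dm in u u' * => fu fu' G.
  rewrite !row_free_unit in fu fu'.
  have E : (u'^T *m invmx u^T) *m u^T = u'^T by rewrite mulmxKV ?unitmx_tr.
  exists (u'^T *m invmx u^T) => //; rewrite /is_isometry unitmx_mul.
  rewrite unitmx_inv !unitmx_tr fu fu' /= trmx_mul trmxK trmx_inv trmxK.
  rewrite (_ : _ *m _ = invmx u *m (u' *m J *m u'^T) *m invmx u^T).
    by rewrite -G !mulmxA mulVmx // mul1mx mulmxK // unitmx_tr.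
  by rewrite !mulmxA.
move=> dem fu fu' G; have [|x [x' [fx fx' Gx]]] := witt_step _ fu fu' G.
  by rewrite -dem addnS ltnS leq_addr.
have [|g Ig] := IH _ _ _ _ fx fx' Gx; first by rewrite -dem addn1 addSnnS.
rewrite !tr_col_mx mul_mx_row => /eq_row_mx[E _].
by exists g.
Qed.

(** Equal row spaces mean that the columns of w and w' satisfy the same
    linear relations: both are images, under one and the same matrix C, of
    linearly independent families, to which witt_row_free applies. *)
Lemma witt k (w w' : 'M[F]_(m, k)) : <<w>>%MS = <<w'>>%MS ->
    w^T *m J *m w = w'^T *m J *m w' ->
  exists g : form_isometry J, val g *m w = w'.
Proof.
move=> E G; set C := row_base w.
have [u Eu] : exists u, w = u^T *m C.
  have /submxP[D ED] : (w <= C)%MS by rewrite eq_row_base.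
  by exists D^T; rewrite trmxK.
have [u' Eu'] : exists u', w' = u'^T *m C.
  have /submxP[D ED] : (w' <= C)%MS by rewrite eq_row_base -genmxE -E genmxE.
  by exists D^T; rewrite trmxK.
have fC : row_free C := row_base_free w.
have rww' : \rank w' = \rank w by rewrite -mxrank_gen -E mxrank_gen.
have fu : row_free u.
  by rewrite /row_free -mxrank_tr -(mxrankMfree _ fC) -Eu.
have fu' : row_free u'.
  by rewrite /row_free -mxrank_tr -(mxrankMfree _ fC) -Eu' rww'.
have Gu : u *m J *m u^T = u' *m J *m u'^T.
  have {}G : (u^T *m C)^T *m J *m (u^T *m C) = (u'^T *m C)^T *m J *m (u'^T *m C).
    by rewrite -Eu -Eu'.
  clear -fC G; move: fC G; move: C => D fC G.
  rewrite !trmx_mul !trmxK !mulmxA in G; have {}G := row_free_inj fC G.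
  apply: trmx_inj; apply: (row_free_inj fC); apply: trmx_inj => /=.
  by rewrite !trmx_mul !trmxK !mulmxA in G *.
have [g Ig gu] := witt_row_free (subnKC (rank_leq_row w)) fu fu' Gu.
by exists (Isometry Ig); rewrite /= Eu mulmxA gu Eu'.
Qed.

End Witt.

Section Perfect.

Variables (F : finFieldType) (m : nat) (J : 'M[F]_m).
Hypothesis two_neq0 : (2 : F) != 0.
Hypothesis Jalt : nondeg_alt J.
Let Js : J^T = - J. Proof. by case: Jalt. Qed.
Let Ju : J \in unitmx. Proof. by case: Jalt. Qed.

Lemma alt_col (x : 'cV[F]_m) : x^T *m J *m x = 0.
Proof. by have := alt_row two_neq0 Jalt x^T; rewrite trmxK. Qed.

Definition transvection_mx (u : 'cV[F]_m) c : 'M_m := 1%:M + c *: (u *m u^T *m J).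

Lemma transvection_isometry u c : is_isometry J (transvection_mx u c).
Proof.
have ET : (transvection_mx u c)^T = 1%:M - c *: (J *m u *m u^T).
  rewrite [LHS]linearD /= trmx1 [X in _ + X]linearZ /= !trmx_mul trmxK Js.
  by rewrite mulNmx scalerN mulmxA.
have E0 : J *m u *m u^T *m J *m (u *m u^T *m J) = 0.
  by rewrite !mulmxA -2!(mulmxA (J *m u)) alt_col mulmx0 !mul0mx.
apply: (isometry_of Ju); rewrite ET /transvection_mx mulmxDr mulmx1.
rewrite mulmxBl mul1mx -scalemxAl mulmxBl -scalemxAl -!scalemxAr E0 !scaler0.
by rewrite subr0 !mulmxA subrK.
Qed.

Definition transvection u c : form_isometry J :=
  Isometry (transvection_isometry u c).

Lemma transvectionD u c c' :
  (transvection u c * transvection u c')%g = transvection u (c + c').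
Proof.
have E0 : u *m u^T *m J *m (u *m u^T *m J) = 0.
  by rewrite !mulmxA -2!(mulmxA u) alt_col mulmx0 !mul0mx.
apply: val_inj; rewrite isometry_valM /= /transvection_mx mulmxDl mul1mx mulmxDr.
by rewrite mulmx1 -scalemxAl -scalemxAr E0 !scaler0 addr0 scalerDl addrAC addrA.
Qed.

Lemma transvectionJ u c (g : form_isometry J) :
  (g * transvection u c * g^-1)%g = transvection (val g *m u) c.
Proof.
apply: val_inj; rewrite !isometry_valM isometry_valV /= /transvection_mx.
have Ug := isometry_unit g; rewrite mulmxDr mulmx1 mulmxDl mulmxV //.
congr (_ + _); rewrite -scalemxAr -scalemxAl trmx_mul; congr (_ *: _).
have E : J *m invmx (val g) = (val g)^T *m J.
  by rewrite -[RHS](mulmxK Ug) isometryP.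
by rewrite -!mulmxA E.
Qed.

Variable la : form_isometry J -> algC.
Hypothesis la1 : la 1%g = 1.
Hypothesis laM : forall g h, la (g * h)%g = la g * la h.

Lemma la_conj g h : la (g * h * g^-1)%g = la h.
Proof. by rewrite !laM mulrAC -laM mulgV la1 mul1r. Qed.

Hypothesis la_tv : forall u c, la (transvection u c) = 1.

(** Multiplying g by the transvection along (g - 1) w multiplies g - 1 on
    the left, so the rank of g - 1 does not grow; it drops for a suitable c
    when w^T J g w is nonzero. *)
Lemma transvection_mulE (g : form_isometry J) (w : 'cV[F]_m) c :
  let a := val g - 1%:M in
  val (transvection (a *m w) c * g)%g - 1%:M = (1%:M - c *: (a *m w *m w^T *m J)) *m a.
Proof.
move=> a; have Eg : val g = a + 1%:M by rewrite /a subrK.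
have E : (a *m w)^T *m J *m val g = - (w^T *m J *m a).
  have Ea : a^T *m J *m val g = - (J *m a).
    rewrite /a linearB /= trmx1 !mulmxBl mul1mx isometryP mulmxBr mulmx1.
    by rewrite opprB.
  by rewrite trmx_mul -!mulmxA (mulmxA a^T) Ea mulmxN.
have -> : val (transvection (a *m w) c * g)%g
    = val g + c *: (a *m w *m ((a *m w)^T *m J *m val g)).
  by rewrite isometry_valM /= /transvection_mx mulmxDl mul1mx -scalemxAl !mulmxA.
rewrite E mulmxN scalerN addrAC -/a; clearbody a.
rewrite mulmxBl mul1mx -scalemxAl.
by rewrite !mulmxA.
Qed.

(** Transvections generate the group: induction on the rank of g - 1
    through transvection_mulE. When w^T J g w vanishes for all w, a first
    transvection leads to an element for which it does not, without raising
    the rank. *)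
Lemma la_eq1 g : la g = 1.
Proof.
have [r le_r] := ubnP (\rank (val g - 1%:M)); elim: r => // r IH in g le_r *.
have step (h : form_isometry J) (w : 'cV_m) : (\rank (val h - 1%:M)%R <= r)%N ->
    w^T *m J *m val h *m w != 0 -> la h = 1.
  move=> le_hr whw; set a := val h - 1%:M; have Ea : val h = a + 1%:M by rewrite subrK.
  have waw : w^T *m J *m a *m w != 0.
    by rewrite /a mulmxBr mulmx1 mulmxBl alt_col subr0.
  pose c := ((w^T *m J *m a *m w) 0 0)^-1.
  have c0 : (w^T *m J *m a *m w) 0 0 != 0.
    by apply: contraNneq waw => E; rewrite [_ *m w]mx11_scalar E raddf0.
  have E : val (transvection (a *m w) c * h)%g - 1%:M
      = (1%:M - c *: (a *m w *m w^T *m J)) *m a := transvection_mulE h w c.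
  set t := transvection _ _ in E; rewrite -/a in le_hr; clearbody a.
  have kw : (val (t * h)%g - 1%:M) *m w = 0.
    rewrite E mulmxBl mul1mx mulmxBl -2!scalemxAl.
    have -> : a *m w *m w^T *m J *m a *m w = a *m w *m (w^T *m J *m a *m w).
      by rewrite !mulmxA.
    by rewrite [w^T *m _ *m _ *m w]mx11_scalar mul_mx_scalar scalerA mulVf // scale1r subrr.
  have <- : la (t * h)%g = la h by rewrite laM la_tv mul1r.
  apply: IH.
  apply: leq_trans le_hr; rewrite ltn_neqAle.
  rewrite {2}E mxrankM_maxr andbT; apply/negP=> /eqP rk.
  have : (a <= val (t * h)%g - 1%:M)%MS.
    by rewrite -(mxrank_leqif_sup _) ?rk // E submxMl.
  case/submxP=> D ED; case/eqP: waw.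
  by rewrite -mulmxA ED -(mulmxA D) kw !mulmx0.
have [/existsP[w gw]|] := boolP [exists w : 'cV_m, w^T *m J *m val g *m w != 0].
  exact: step gw.
rewrite negb_exists => /forallP h0; set a := val g - 1%:M.
have {}h0 (w : 'cV_m) : w^T *m J *m val g *m w = 0.
  by apply/eqP; have := h0 w; rewrite negbK.
have [a0|a0] := eqVneq a 0.
  have -> : g = 1%g; last exact: la1.
  by apply: val_inj; rewrite isometry_val1 -[LHS](subrK 1%:M) -/a a0 add0r.
have [w u0] : exists w : 'cV_m, a *m w != 0.
  have [i [j aij]] := mx_neq0P a0; exists (delta_mx j 0).
  apply: contraNneq aij => E; have := congr1 (fun M : 'cV_m => M i 0) E.
  by rewrite -colE !mxE => ->.
set u := a *m w in u0;
have E : val (transvection u 1 * g)%g - 1%:M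
    = (1%:M - 1 *: (u *m w^T *m J)) *m a := transvection_mulE g w 1.
clearbody u.
have <- : la (transvection u 1 * g)%g = la g by rewrite laM la_tv mul1r.
have le_tg : (\rank (val (transvection u 1 * g)%g - 1%:M)%R <= r)%N.
  by rewrite E (leq_trans (mxrankM_maxr _ _)).
pose l1 (z : 'cV_m) := u^T *m J *m val g *m z; pose l2 (z : 'cV_m) := u^T *m J *m z.
have nz (v : 'cV_m) : v != 0 -> exists z : 'cV_m, v^T *m J *m z != 0.
  move=> v0; have : v^T *m J != 0.
    apply: contraNneq v0 => E1; have := congr1 (fun M => M *m invmx J) E1.
    by rewrite mulmxK // mul0mx -trmx0 => /trmx_inj ->.
  case/mx_neq0P=> i [j]; rewrite [i]ord1 => vj; exists (delta_mx j 0).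
  apply: contraNneq vj => E1; have := congr1 (fun M : 'M_1 => M 0 0) E1.
  by rewrite -colE !mxE => ->.
have [z1 hz1] : exists z, l1 z != 0.
  have [|z hz] := nz (invmx (val g) *m u).
    apply: contraNneq u0 => E1; have := congr1 (fun M => val g *m M) E1.
    by rewrite mulmxA mulmxV ?isometry_unit // mul1mx mulmx0 => ->.
  have Eg : invmx (val g)^T *m J = J *m val g.
    have Ug : (val g)^T \in unitmx by rewrite unitmx_tr isometry_unit.
    by rewrite -[RHS](mulKmx Ug) (mulmxA _^T) isometryP.
  exists z; apply: contraNneq hz => E1; apply/eqP; rewrite -[RHS]E1 /l1.
  by rewrite trmx_mul trmx_inv -[u^T *m invmx _ *m J]mulmxA Eg mulmxA.
have [z2 hz2] := nz _ u0; rewrite -/(l2 z2) in hz2.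
(* Two nonzero linear forms have a common point where neither vanishes. *)
have [z [hz hz']] : exists z, l1 z != 0 /\ l2 z != 0.
  have [h2|h2] := eqVneq (l2 z1) 0; last by exists z1.
  have [h1|h1] := eqVneq (l1 z2) 0; last by exists z2.
  by exists (z1 + z2); rewrite /l1 /l2 !mulmxDr -!/(l1 _) -!/(l2 _) h1 h2 addr0 add0r.
apply: (step _ z) le_tg _; rewrite isometry_valM /= /transvection_mx scale1r.
rewrite mulmxDl mul1mx mulmxDr mulmxDl h0 add0r.
have -> : z^T *m J *m (u *m u^T *m J *m val g) *m z = z^T *m J *m u *m l1 z.
  by rewrite /l1 !mulmxA.
rewrite [z^T *m J *m u](_ : _ = - (l2 z)^T); last first.
  by rewrite /l2 !trmx_mul trmxK Js mulNmx mulmxN opprK mulmxA.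
rewrite mulNmx oppr_eq0 [l1 z]mx11_scalar [l2 z]mx11_scalar tr_scalar_mx.
have E1 (M : 'M[F]_1) : M != 0 -> M 0 0 != 0.
  by apply: contraNneq => E1; rewrite [M]mx11_scalar E1 raddf0.
rewrite -scalar_mxM; move: (E1 _ hz) (E1 _ hz'); move: (l1 z 0 0) (l2 z 0 0).
move=> x y x0 y0; apply/eqP=> /matrixP/(_ 0 0)/eqP.
by rewrite !mxE mulr1n mulf_eq0 (negPf x0) (negPf y0).
Qed.

End Perfect.

Section PerfectEnd.

Variables (F : finFieldType) (m : nat) (J : 'M[F]_m).
Hypothesis two_neq0 : (2 : F) != 0.
Hypothesis Jalt : nondeg_alt J.
Variables a b : 'cV[F]_m.
Hypotheses (a0 : a != 0) (b0 : b != 0).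
Hypotheses (ab0 : a + b != 0) (amb0 : a - b != 0) (aJb : a^T *m J *m b = 0).

Variable la : form_isometry J -> algC.
Hypothesis la1 : la 1%g = 1.
Hypothesis laM : forall g h, la (g * h)%g = la g * la h.

(** By Witt's theorem, transvections with the same scalar c are conjugate,
    so la takes a value mu c on them. Since the squares u u^T of u = a + b
    and u = a - b add up to twice those of a and b, mu (c)^2 = mu (2 c)^2;
    also mu (2 c) = mu (c)^2. Hence mu (2 c) = 1. *)
Lemma isometry_perfect g : la g = 1.
Proof.
have [Js Ju] := Jalt.
have bJa : b^T *m J *m a = 0.
  apply: trmx_inj; rewrite !trmx_mul trmxK Js mulNmx mulmxN mulmxA aJb.
  by rewrite oppr0 trmx0.
pose t := transvection two_neq0 Jalt; pose mu c := la (t a c).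
have tE (u : 'cV_m) c : u != 0 -> la (t u c) = mu c.
  move=> u0; have fr (v : 'cV[F]_m) : v != 0 -> row_full v.
    move=> v0; rewrite /row_full eqn_leq rank_leq_col lt0n mxrank_eq0.
    exact: v0.
  have [||h hu] := @witt _ _ _ two_neq0 Jalt _ a u.
  - by apply/genmxP; rewrite !submx_full ?fr.
  - by rewrite !alt_col.
  by rewrite /mu /t -hu -transvectionJ (la_conj la1 laM).
have tM (u v : 'cV_m) c : u^T *m J *m v = 0 -> v^T *m J *m u = 0 ->
    val (t u c * t v c)%g = 1%:M + c *: ((u *m u^T + v *m v^T) *m J).
  move=> uv _; rewrite isometry_valM /= /transvection_mx mulmxDl mul1mx mulmxDr.
  rewrite mulmx1 -scalemxAl -scalemxAr.
  have -> : u *m u^T *m J *m (v *m v^T *m J) = 0.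
    by rewrite !mulmxA -2!(mulmxA u) uv mulmx0 !mul0mx.
  by rewrite !scaler0 addr0 mulmxDl scalerDr addrA addrAC.
have E c : (t (a + b) c * t (a - b) c)%g = (t a (c + c) * t b (c + c))%g.
  apply: val_inj; rewrite !tM //.
  - congr (_ + _); rewrite scalerDl -scalerDr -mulmxDl; congr (_ *: (_ *m _)).
    rewrite !linearD linearN /= !(mulmxDl, mulmxDr) !mulNmx !mulmxN opprK.
    move: (a *m a^T) (a *m b^T) (b *m a^T) (b *m b^T) => X Y Z W.
    by apply/matrixP=> i j; rewrite !mxE; ring.
  - rewrite [(a + b)^T]linearD /= 2!mulmxDl 2!mulmxBr aJb bJa !alt_col //.
    by rewrite !subr0 addr0.
  - rewrite [(a - b)^T]linearB /= 2!mulmxBl 2!mulmxDr aJb bJa !alt_col //.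
    by rewrite !addr0 subrr.
have mu2 c : mu c * mu c = mu (c + c) * mu (c + c).
  by have := congr1 la (E c); rewrite !laM !tE.
have muD c : mu (c + c) = mu c * mu c.
  by rewrite /mu -laM transvectionD.
have mu0 c : mu c != 0.
  apply/eqP=> h; have := la1; rewrite -(mulgV (t a c)) laM -/(mu c) h mul0r.
  by move/esym/eqP; rewrite oner_eq0.
have mu1 c : mu (c + c) = 1.
  have := mu2 c; rewrite -muD => /esym h; apply: (mulfI (mu0 (c + c))).
  by rewrite h mulr1.
refine (@la_eq1 _ _ _ two_neq0 Jalt la la1 laM _ g) => u c.
have [->|u0] := eqVneq u 0.
  rewrite -[RHS]la1; congr la; apply: val_inj => /=.
  by rewrite /transvection_mx mul0mx mul0mx scaler0 addr0.
by rewrite tE // -(half_add two_neq0 c) mu1.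
Qed.

End PerfectEnd.

(** * Oscillator representations as equivariant systems *)

Lemma symplJ_alt (F : finFieldType) n : nondeg_alt (symplJ F n).
Proof.
split; first by rewrite /symplJ tr_block_mx opp_block_mx !linearN /= !trmx0 !trmx1 opprK oppr0.
have : symplJ F n *m (- symplJ F n) = 1%:M.
  rewrite /symplJ opp_block_mx oppr0 opprK mulmx_block !(mul0mx, mulmx0).
  by rewrite !addr0 !add0r mulmxN mulNmx opprK mul1mx -scalar_mx_block.
by case/mulmx1_unit.
Qed.

Lemma cfReprE gT (G : {group gT}) d (rG : mx_representation algC G d) x :
  x \in G -> cfRepr rG x = \tr (rG x).
Proof. by move=> Gx; rewrite cfunE Gx mulr1n. Qed.

Lemma mxtrace_tens (R : comNzRingType) m n (A : 'M[R]_m) (B : 'M[R]_n) :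
  \tr (A *t B) = \tr A * \tr B.
Proof. by rewrite /mxtrace mulr_sum; apply: eq_bigr => i _; rewrite !mxE. Qed.

Lemma tensmx11 (R : comNzRingType) m n : (1%:M : 'M[R]_m) *t (1%:M : 'M[R]_n) = 1%:M.
Proof.
apply/matrixP=> i j; case: (mxtens_indexP i) => i1 i2.
case: (mxtens_indexP j) => j1 j2; rewrite tensmxE !mxE (can_eq (@mxtens_indexK _ _)).
by rewrite xpair_eqE; case: eqP; case: eqP; rewrite ?mulr1 ?mulr0 ?mul0r.
Qed.

Lemma tensmxZ (R : comNzRingType) m n p q (A : 'M[R]_(m, n)) (B : 'M[R]_(p, q)) a b :
  (a *: A) *t (b *: B) = (a * b) *: (A *t B).
Proof. by apply/matrixP=> s t; rewrite !mxE mulrACA. Qed.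

Section TensRepr.
Variables (gT : finGroupType) (G : {group gT}) (d1 d2 : nat).
Variables (r1 : mx_representation algC G d1) (r2 : mx_representation algC G d2).

Lemma tens_mx_repr : mx_repr G (fun g => r1 g *t r2 g).
Proof.
split=> [|x y Gx Gy]; first by rewrite !repr_mx1 tensmx11.
by rewrite !repr_mxM // tensmx_mul.
Qed.
Definition tens_repr := MxRepresentation tens_mx_repr.

Lemma cfRepr_tens : cfRepr tens_repr = cfRepr r1 * cfRepr r2.
Proof.
by apply/cfun_inP=> x Gx; rewrite [RHS]cfunE !cfReprE //= mxtrace_tens.
Qed.
End TensRepr.

Section OscillatorSystem.
Variables (F : finFieldType) (chi : 'CF([set: F])) (n : nat).
Hypothesis chi_nt : nontrivial_char chi.
Hypothesis two_neq0 : (2 : F) != 0.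
Local Notation J := (symplJ F n).
Local Notation Sp := (form_isometry J).
Local Notation Jalt := (symplJ_alt F n).

(** The restriction to Sp(W) of an oscillator representation of Sp(W (x)
    V), up to a character of Sp(W). *)
Definition osc_sys k (B : 'M[F]_k) d (R : 'M[F]_(n + n, k) -> 'M[algC]_d)
    (om : mx_representation algC [set: Sp] d) :=
  heis_sys chi J B R /\
  forall (g : Sp) w, om g *m R w = R (val g *m w) *m om g.

Lemma osc_conj k (B : 'M[F]_k) d R (om : mx_representation algC [set: Sp] d) :
  osc_sys B R om -> forall (g : Sp) w, om g *m R w *m om g^-1%g = R (val g *m w).
Proof.
by move=> [_ h] g w; rewrite h -mulmxA -repr_mxM ?inE // mulgV repr_mx1 mulmx1.
Qed.

(** n > 1 provides two independent orthogonal vectors, as isometry_perfect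
    requires. *)
Lemma sp_perfect (la : Sp -> algC) : (1 < n)%N -> la 1%g = 1 ->
  (forall g h, la (g * h)%g = la g * la h) -> forall g, la g = 1.
Proof.
move=> n1 la1 laM g; have n0 := ltnW n1.
pose i0 := Ordinal n0; pose i1 := Ordinal n1.
pose v i : 'cV[F]_(n + n) := col_mx (delta_mx i 0) 0.
have vE i j : v i (lshift n j) 0 = (j == i)%:R.
  by rewrite col_mxEu mxE eqxx andbT.
have nz (u : 'cV[F]_(n + n)) s : u s 0 != 0 -> u != 0.
  by apply: contraNneq => ->; rewrite mxE.
apply: (@isometry_perfect _ _ _ two_neq0 Jalt (v i0) (v i1)) => //.
- by apply: (nz _ (lshift n i0)); rewrite vE eqxx oner_eq0.
- by apply: (nz _ (lshift n i1)); rewrite vE eqxx oner_eq0.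
- by apply: (nz _ (lshift n i0)); rewrite mxE !vE eqxx addr0 oner_eq0.
- by apply: (nz _ (lshift n i0)); rewrite mxE [X in _ + X]mxE !vE eqxx oppr0 addr0 oner_eq0.
- rewrite /v /symplJ tr_col_mx mul_row_block mul_row_col.
  by rewrite trmx0 !mulmx0 !mul0mx !addr0 mul0mx.
Qed.

Section CharUnique.
Variables (k : nat) (B : 'M[F]_k).
Hypothesis Bsym : nondeg_sym B.
Hypothesis n1 : (1 < n)%N.

(** Once the systems are identified, om g and om' g satisfy the same
    commutation rule, hence differ by a scalar which is a character of the
    symplectic group. *)
Lemma osc_char_unique d d' (R : 'M[F]_(n + n, k) -> 'M[algC]_d)
    (R' : 'M[F]_(n + n, k) -> 'M[algC]_d')
    (om : mx_representation algC [set: Sp] d)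
    (om' : mx_representation algC [set: Sp] d') :
  osc_sys B R om -> osc_sys B R' om' -> cfRepr om = cfRepr om'.
Proof.
move=> [hR oR] [hR' oR'].
have [Y [Z [YZ ZY YR]]] := stone_von_neumann chi_nt two_neq0 Jalt Bsym hR hR'.
have d0 : d'%:R != 0 :> algC := hs_d_neq0 hR'.
pose M g := Y *m om g *m Z *m om' g^-1%g.
have omV g : om' g *m om' g^-1%g = 1%:M.
  by rewrite -repr_mxM ?inE // mulgV repr_mx1.
have omVl g : om' g^-1%g *m om' g = 1%:M.
  by rewrite -repr_mxM ?inE // mulVg repr_mx1.
have RZ w : R w *m Z = Z *m R' w.
  by rewrite -[LHS]mul1mx -ZY -!mulmxA (mulmxA Y) YR -!mulmxA YZ mulmx1.
have oV g w : om' g^-1%g *m R' w = R' (val g^-1%g *m w) *m om' g^-1%g by exact: oR'.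
pose la g := \tr (M g) / d'%:R.
have ME g : M g = (la g)%:M.
  have [w|a Ea] := hs_scalar hR' (X := M g).
    rewrite /M -[LHS]mulmxA oV !mulmxA -(mulmxA _ Z) -RZ !mulmxA.
    rewrite -(mulmxA Y) oR !mulmxA YR.
    by rewrite isometry_valV -!mulmxA mulKVmx ?isometry_unit.
  by rewrite /la Ea mxtrace_scalar -[a *+ _]mulr_natr mulfK.
have la1 g : la g = 1.
  apply: (sp_perfect n1).
    by rewrite /la /M invg1 !repr_mx1 !mulmx1 YZ mxtrace1 divff.
  move=> g1 g2; rewrite [LHS]/la.
  suff -> : M (g1 * g2)%g = la g2 *: M g1 by rewrite mxtraceZ -mulrA mulrC.
  have -> : M (g1 * g2)%g = Y *m om g1 *m Z *m M g2 *m om' g1^-1%g.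
    rewrite /M invMg !repr_mxM ?inE // !mulmxA; congr (_ *m _ *m _ *m _ *m _).
    by rewrite -[RHS]mulmxA ZY mulmx1.
  by rewrite ME mul_mx_scalar -scalemxAl.
apply/cfun_inP=> g Gg; rewrite !cfReprE //.
have E : Y *m om g *m Z = om' g.
  by rewrite -[RHS]mul1mx -(la1 g) -ME /M -[RHS]mulmxA omVl mulmx1.
by rewrite -E mxtrace_mulC mulmxA ZY mul1mx.
Qed.

End CharUnique.

Lemma heis_sys_congr k k' (B : 'M[F]_k) (P : 'M[F]_(k, k')) (Q : 'M[F]_(k', k)) d
    (R : 'M[F]_(n + n, k) -> 'M[algC]_d) : P *m Q = 1%:M -> Q *m P = 1%:M ->
  heis_sys chi J B R -> heis_sys chi J (P^T *m B *m P) (fun w => R (w *m P^T)).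
Proof.
move=> PQ QP [d0 R0 RM Rf]; split=> //.
- by rewrite mul0mx.
- move=> w w'; rewrite RM mulmxDl; congr (chi (_ * _) *: _).
  by rewrite /tform trmx_mul trmxK -!mulmxA mxtrace_mulC !mulmxA.
move=> X; have [c ->] := Rf X; exists (fun w => c (w *m P^T)).
rewrite (reindex (fun w : 'M_(n + n, k') => w *m P^T)) //=.
exists (fun w => w *m Q^T) => w _; rewrite -mulmxA -trmx_mul ?PQ ?QP.
  by rewrite trmx1 mulmx1.
by rewrite trmx1 mulmx1.
Qed.

Lemma osc_sys_congr k k' (B : 'M[F]_k) (P : 'M[F]_(k, k')) (Q : 'M[F]_(k', k)) d
    (R : 'M[F]_(n + n, k) -> 'M[algC]_d) om : P *m Q = 1%:M -> Q *m P = 1%:M ->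
  osc_sys B R om -> osc_sys (P^T *m B *m P) (fun w => R (w *m P^T)) om.
Proof.
move=> PQ QP [hR oR]; split; first exact: heis_sys_congr PQ QP hR.
by move=> g w; rewrite oR mulmxA.
Qed.

Lemma tform_block k1 k2 (B1 : 'M[F]_k1) (B2 : 'M[F]_k2) w w' :
  tform J (block_mx B1 0 0 B2) w w'
    = tform J B1 (lsubmx w) (lsubmx w') + tform J B2 (rsubmx w) (rsubmx w').
Proof.
rewrite /tform -{1}[w]hsubmxK -{1}[w']hsubmxK tr_row_mx mul_col_mx mul_col_row.
by rewrite mulmx_block !mulmx0 mxtrace_block addr0 add0r.
Qed.

(** Tensor products of oscillator representations correspond to orthogonal
    sums of the forms on V. *)
Lemma osc_sys_tens k1 k2 (B1 : 'M[F]_k1) (B2 : 'M[F]_k2) d1 d2 R1 R2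
    (om1 : mx_representation algC [set: Sp] d1)
    (om2 : mx_representation algC [set: Sp] d2) :
  osc_sys B1 R1 om1 -> osc_sys B2 R2 om2 ->
  osc_sys (block_mx B1 0 0 B2) (fun w => R1 (lsubmx w) *t R2 (rsubmx w))
    (tens_repr om1 om2).
Proof.
move=> [hR1 o1] [hR2 o2]; split; last first.
  move=> g w; rewrite /= !tensmx_mul o1 o2.
  have -> : val g *m w = row_mx (val g *m lsubmx w) (val g *m rsubmx w).
    by rewrite -mul_mx_row hsubmxK.
  by rewrite row_mxKl row_mxKr.
case: hR1 hR2 => [d10 R10 M1 f1] [d20 R20 M2 f2]; split.
- by rewrite muln_gt0 d10.
- by rewrite !linear0 R10 R20 tensmx11.
- move=> w w'; rewrite tensmx_mul M1 M2 !linearD /=.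
  rewrite tensmxZ -chiD // -mulrDr tform_block.
  by rewrite -[lsubmx w + _]linearD -[rsubmx w + _]linearD.
move=> X; rewrite [X]matrix_sum_delta; apply: rspan_sum => i _.
apply: rspan_sum => j _; apply: rspanZ.
case: (mxtens_indexP i) => i1 i2; case: (mxtens_indexP j) => j1 j2.
have -> : delta_mx (mxtens_index (i1, i2)) (mxtens_index (j1, j2))
    = delta_mx i1 j1 *t delta_mx i2 j2 :> 'M[algC]_(d1 * d2).
  apply/matrixP=> s t; case: (mxtens_indexP s) => s1 s2.
  case: (mxtens_indexP t) => t1 t2; rewrite tensmxE !mxE.
  rewrite !(can_eq (@mxtens_indexK _ _)) !xpair_eqE -natrM mulnb.
  by rewrite andbACA.
have [c1 ->] := f1 (delta_mx i1 j1); have [c2 ->] := f2 (delta_mx i2 j2).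
have tDl I r (P : pred I) (G : I -> 'M[algC]_d1) (Y : 'M_d2) :
    (\sum_(s <- r | P s) G s) *t Y = \sum_(s <- r | P s) G s *t Y.
  apply: (big_morph (fun Z => Z *t Y)); last exact: tens0mx.
  by move=> A A'; apply/matrixP=> s t; rewrite !mxE mulrDl.
have tDr I r (P : pred I) (G : I -> 'M[algC]_d2) (Y : 'M_d1) :
    Y *t (\sum_(s <- r | P s) G s) = \sum_(s <- r | P s) Y *t G s.
  apply: (big_morph (fun Z => Y *t Z)); last exact: tensmx0.
  by move=> A A'; apply/matrixP=> s t; rewrite !mxE mulrDr.
rewrite tDl; apply: rspan_sum => w1 _; rewrite tDr; apply: rspan_sum => w2 _.
rewrite tensmxZ; apply: rspanZ; have := rspan_id (fun w => R1 (lsubmx w) *t R2 (rsubmx w)) (row_mx w1 w2).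
by rewrite /= row_mxKl row_mxKr.
Qed.

Lemma osc_sys0 : exists d R (om : mx_representation algC [set: Sp] d),
  osc_sys (1%:M : 'M[F]_0) R om /\ cfRepr om = 1.
Proof.
have h : mx_repr [set: Sp] (fun=> 1%:M : 'M[algC]_1).
  by split=> // x y _ _; rewrite mulmx1.
exists 1%N, (fun=> 1%:M), (MxRepresentation h); split.
  split=> [|g w]; last by rewrite mulmx1.
  split=> //.
    move=> w w'; rewrite mulmx1 /tform [_ *m 1%:M](_ : _ = 0) ?mxtrace0.
      by rewrite mulr0 chi_0 // scale1r.
    by apply/matrixP=> [[]].
  move=> X; have := rspan_id (fun _ : 'M[F]_(n + n, 0) => 1%:M : 'M[algC]_1) 0.
  by move/(rspanZ (X 0 0)); rewrite scalemx1 -mx11_scalar.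
by apply/cfun_inP=> g Gg; rewrite cfReprE // cfun1E Gg mxtrace1.
Qed.

End OscillatorSystem.

(** * The Siegel unipotent group in the Schrodinger model *)

Section InvariantChar.
Variables (F : finFieldType) (n : nat) (la : 'M[F]_n -> algC).
Hypothesis two_neq0 : (2 : F) != 0.
Hypothesis n1 : (1 < n)%N.
Hypothesis la0 : la 0 = 1.
Hypothesis laD : forall S T, la (S + T) = la S * la T.
Hypothesis laT : forall S, la S^T = la S.
Hypothesis laJ : forall g S, g \in unitmx -> la (g *m S *m g^T) = la S.

(** Congruence by 1 + e E_ji with e = 1 and e = -1 relates the values on
    the diagonal units to those on the others; the two relations together
    force all squares of values to be 1, and every scalar is twice another
    one. *)
Lemma congr_invariant_char_trivial S : la S = 1.
Proof.
have la_n0 T : la T != 0.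
  apply/eqP=> h; have := laD T (- T); rewrite subrr la0 h mul0r => /eqP.
  by rewrite oner_eq0.
pose mu i c := la (c *: delta_mx i i); pose nu i j c := la (c *: delta_mx i j).
have nuC i j c : nu j i c = nu i j c by rewrite /nu -laT linearZ /= trmx_delta.
have elem i j c (e : F) : i != j -> e ^+ 2 = 1 ->
    mu j c * (nu i j (e * c) * nu i j (e * c)) = 1.
  move=> ij e1; pose g := 1%:M + e *: delta_mx j i : 'M[F]_n.
  have ug : g \in unitmx.
    have : g *m (1%:M - e *: delta_mx j i) = 1%:M.
      rewrite mulmxBr mulmx1 /g mulmxDl mul1mx -scalemxAl -scalemxAr.
      by rewrite mul_delta_mx_0 // !scaler0 addr0 addrK.
    by case/mulmx1_unit.
  have := laJ (c *: delta_mx i i) ug.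
  have -> : g *m (c *: delta_mx i i) *m g^T = c *: delta_mx i i +
      (c *: delta_mx j j + ((e * c) *: delta_mx i j + (e * c) *: delta_mx j i)).
    have -> : g^T = 1%:M + e *: delta_mx i j.
      by rewrite [LHS]linearD /= trmx1 [X in _ + X]linearZ /= trmx_delta.
    rewrite /g !mulmxDl !mul1mx !mulmxDr !mulmx1.
    do 10?[rewrite -scalemxAl | rewrite -scalemxAr].
    rewrite !mul_delta_mx !scalerA [X in _ = _ + (X *: _ + _)](_ : c = e ^+ 2 * c).
      by apply/matrixP=> s t; rewrite !mxE; ring.
    by rewrite e1 mul1r.
  rewrite !laD -/(mu _ _) -/(mu _ _) -!/(nu _ _ _) => /eqP.
  rewrite -{2}[mu i c]mulr1 (inj_eq (mulfI (la_n0 _))) => /eqP.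
  by rewrite nuC.
have mu1 j c : mu j c = 1.
  have [i ij] : exists i, i != j.
    have [/eqP j0|j0] := eqVneq (val j) 0%N.
      by exists (Ordinal n1); rewrite -val_eqE (eqP j0).
    by exists (Ordinal (ltnW n1)); rewrite -val_eqE eq_sym.
  have h1 a := elem i j a 1 ij (expr1n _ _).
  have h2 a := elem i j a (-1) ij (etrans (sqrrN 1) (expr1n _ _)).
  have sq a : mu j a * mu j a = 1.
    have E : nu i j a * nu i j (- a) = 1 by rewrite /nu -laD scaleNr subrr.
    have := congr2 *%R (h1 a) (h2 a); rewrite mul1r mulN1r mulr1 => <-.
    have -> : forall x y z : algC, x * (y * y) * (x * (z * z)) = x * x * (y * z) * (y * z).
      by move=> *; ring.
    by rewrite E !mulr1.
  rewrite -(half_add two_neq0 c) /mu scalerDl laD; exact: sq.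
have nu1 i j c : nu i j c = 1.
  have [->|ij] := eqVneq i j; first exact: mu1.
  have sq a : nu i j a * nu i j a = 1.
    by have := elem i j a 1 ij (expr1n _ _); rewrite mu1 !mul1r.
  rewrite -(half_add two_neq0 c) /nu scalerDl laD; exact: sq.
rewrite [S]matrix_sum_delta (big_morph la laD la0) big1 // => i _.
by rewrite (big_morph la laD la0) big1 // => j _; apply: nu1.
Qed.
End InvariantChar.

Section SiegelSpectrum.
Variables (F : finFieldType) (chi : 'CF([set: F])) (n : nat).
Hypothesis chi_nt : nontrivial_char chi.
Hypothesis two_neq0 : (2 : F) != 0.
Hypothesis n1 : (1 < n)%N.
Local Notation J := (symplJ F n).
Local Notation Sp := (form_isometry J).
Local Notation Jalt := (symplJ_alt F n).

(** Taking the symmetric part lets the Siegel unipotent elements be indexed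
    by all matrices, without symmetry proofs. *)
Definition symmetrize (T : 'M[F]_n) := 2^-1 *: (T + T^T).

Lemma symmetrize_tr T : (symmetrize T)^T = symmetrize T.
Proof. by rewrite /symmetrize linearZ /= linearD /= trmxK addrC. Qed.

Lemma symmetrizeJ g S : symmetrize (g *m S *m g^T) = g *m symmetrize S *m g^T.
Proof.
rewrite /symmetrize -scalemxAr -scalemxAl mulmxDr mulmxDl; congr (_ *: (_ + _)).
by rewrite !trmx_mul trmxK mulmxA.
Qed.

Lemma symmetrize_id T : T^T = T -> symmetrize T = T.
Proof.
by move=> h; rewrite /symmetrize h -mulr2n -scaler_nat scalerA mulVf ?scale1r.
Qed.

Lemma usiegel_subproof T :
  is_isometry J (block_mx 1%:M (symmetrize T) 0 1%:M).
Proof.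
apply: (isometry_of Jalt.2); rewrite /symplJ tr_block_mx symmetrize_tr !trmx1 trmx0.
rewrite !mulmx_block !(mul0mx, mulmx0, mul1mx, mulmx1, add0r, addr0).
by rewrite mulNmx mul1mx addNr.
Qed.
Definition usiegel T : Sp := Isometry (usiegel_subproof T).

Lemma levi_subproof (g : 'M[F]_n) : g \in unitmx ->
  is_isometry J (block_mx g 0 0 (invmx g)^T).
Proof.
move=> ug; apply: (isometry_of Jalt.2); rewrite /symplJ tr_block_mx !trmx0 trmxK.
rewrite !mulmx_block !(mul0mx, mulmx0, mul1mx, mulmx1, add0r, addr0).
rewrite mulmxN mulmx1 mulNmx mulVmx // -trmx_mul mulVmx // trmx1 //.
Qed.

Variables (k : nat) (B : 'M[F]_k).
Hypothesis Bsym : nondeg_sym B.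
Variables (d : nat) (R : 'M[F]_(n + n, k) -> 'M[algC]_d).
Variable om : mx_representation algC [set: Sp] d.
Hypothesis oscR : osc_sys chi B R om.
Let hR : heis_sys chi J B R. Proof. by case: oscR. Qed.
Let oR : forall (g : Sp) w, om g *m R w = R (val g *m w) *m om g.
Proof. by case: oscR. Qed.
Let Bs : B^T = B. Proof. by case: Bsym. Qed.
Let Bu : B \in unitmx. Proof. by case: Bsym. Qed.

Lemma tform_symplJ (a b a' b' : 'M[F]_(n, k)) :
  tform J B (col_mx a b) (col_mx a' b') = \tr (a^T *m b' *m B) - \tr (b^T *m a' *m B).
Proof.
rewrite /tform tr_col_mx mul_row_block mul_row_col !mulmx0 add0r addr0 mulmx1.
by rewrite mulmxN mulmx1 mulNmx mulmxDl linearD /= mulNmx linearN /= addrC.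
Qed.

Let Ra a := R (col_mx a 0 : 'M_(n + n, k)).
Let Rb b := R (col_mx 0 b : 'M_(n + n, k)).
Let N : algC := #|{: 'M[F]_(n, k)}|%:R.
Let N0 : N != 0.
Proof. by rewrite pnatr_eq0 -lt0n; apply/card_gt0P; exists 0. Qed.

(** The Schrodinger model: the projector onto the vectors on which the
    Lagrangian of the col_mx a 0 acts by the character chi (tr (a^T x B)).
    It is locked so that rewriting does not unfold it. *)
Definition schrodinger_proj (x : 'M[F]_(n, k)) : 'M[algC]_d :=
  locked (N^-1 *: \sum_a chi (- \tr (a^T *m x *m B)) *: Ra a).
Local Notation P := schrodinger_proj.

Let projE x : P x = N^-1 *: \sum_a chi (- \tr (a^T *m x *m B)) *: Ra a.
Proof. by rewrite /P -lock. Qed.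

Let RaM a a' : Ra a *m Ra a' = Ra (a + a').
Proof.
rewrite /Ra (hsM0 chi_nt hR) ?add_col_mx ?addr0 //.
by rewrite tform_symplJ trmx0 mulmx0 !mul0mx mxtrace0 subrr.
Qed.

Lemma Ra_proj a x : Ra a *m P x = chi (\tr (a^T *m x *m B)) *: P x.
Proof.
rewrite projE -scalemxAr mulmx_sumr [RHS]scalerA mulrC -scalerA; congr (_ *: _).
rewrite [in RHS](reindex_inj (addrI a)) /= scaler_sumr; apply: eq_bigr => a' _.
rewrite -scalemxAr RaM scalerA -chiD //; congr (chi _ *: _).
by rewrite [(a + a')^T]linearD /= !mulmxDl mxtraceD opprD addrA subrr add0r.
Qed.

Let sum_chi_tr (D : 'M[F]_(n, k)) :
  \sum_(a : 'M[F]_(n, k)) chi (\tr (a^T *m D)) = if D == 0 then N else 0.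
Proof.
rewrite (reindex (fun a : 'M[F]_(k, n) => a^T)) /=; last first.
  by exists (fun a => a^T) => a _; rewrite trmxK.
under eq_bigr do rewrite trmxK.
by rewrite sum_chi_mx // /N !card_mx mulnC.
Qed.

Let mulB_eq0 (D : 'M[F]_(n, k)) : (D *m B == 0) = (D == 0).
Proof.
apply/eqP/eqP => [h|->]; last by rewrite mul0mx.
by rewrite -(mulmxK Bu D) h mul0mx.
Qed.

Lemma proj_mul x y : P x *m P y = if x == y then P y else 0.
Proof.
rewrite projE -scalemxAl mulmx_suml.
under eq_bigr => a _.
  rewrite -scalemxAl Ra_proj scalerA -chiD // -mulmxA -mulmxA addrC -linearB /=.
  rewrite -mulmxBr -mulmxBl; over.
rewrite -scaler_suml sum_chi_tr mulB_eq0 subr_eq0 eq_sym.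
case: eqP => _; last by rewrite scale0r scaler0.
by rewrite scalerA mulVf // scale1r.
Qed.

Lemma proj_sum1 : \sum_x P x = 1%:M.
Proof.
under eq_bigr do rewrite projE; rewrite -scaler_sumr exchange_big /= (bigD1 0) //= [X in _ + X]big1 => [|b b0].
  rewrite addr0; under eq_bigr do rewrite trmx0 !mul0mx mxtrace0 oppr0 chi_0 // scale1r.
  rewrite sumr_const -[_ *+ _]scaler_nat scalerA mulVf // scale1r /Ra col_mx0.
  exact: hs0 hR.
rewrite -scaler_suml; under eq_bigr => x _.
  rewrite (_ : - \tr _ = \tr (x^T *m (- b *m B))); first over.
  rewrite -mxtrace_tr !trmx_mul Bs trmxK mxtrace_mulC mulNmx mulmxN.
  by rewrite [in RHS]linearN /= mulmxA.
by rewrite sum_chi_tr mulB_eq0 oppr_eq0 (negPf b0) scale0r.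
Qed.

Lemma proj_tr x : \tr (P x) = d%:R / N.
Proof.
rewrite projE mxtraceZ linear_sum (bigD1 0) //= big1 => [|a a0].
  rewrite trmx0 !mul0mx mxtrace0 oppr0 chi_0 // scale1r addr0 /Ra col_mx0.
  by rewrite (hs_tr0 hR) mulrC.
rewrite mxtraceZ /Ra (hs_tr chi_nt two_neq0 Jalt Bsym hR) ?mulr0 //.
by rewrite col_mx_eq0 (negPf a0).
Qed.

Lemma Rb_proj b x : Rb b *m P x = P (x + b) *m Rb b.
Proof.
rewrite !projE -scalemxAr -scalemxAl mulmx_sumr mulmx_suml; congr (_ *: _).
apply: eq_bigr => a _; rewrite -scalemxAr -scalemxAl.
rewrite /Rb (hs_comm chi_nt two_neq0 Jalt Bsym hR) scalerA -chiD //.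
congr (chi _ *: _); rewrite tform_symplJ trmx0 !mul0mx mxtrace0 sub0r -opprD.
congr (- _); rewrite mulmxDr mulmxDl mxtraceD; congr (_ + _).
by rewrite -mxtrace_tr !trmx_mul trmxK Bs mxtrace_mulC.
Qed.

Definition quad_tr T (x : 'M[F]_(n, k)) : F := 2^-1 * \tr (x^T *m symmetrize T *m x *m B).
Definition siegel_op T : 'M[algC]_d := \sum_x chi (quad_tr T x) *: P x.

Lemma siegel_op_proj T x : siegel_op T *m P x = chi (quad_tr T x) *: P x.
Proof.
rewrite /siegel_op mulmx_suml (bigD1 x) //= big1 => [|y yx].
  by rewrite addr0 -scalemxAl proj_mul eqxx.
by rewrite -scalemxAl proj_mul (negPf yx) scaler0.
Qed.

Lemma eq_on_proj (X Y : 'M[algC]_d) : (forall x, X *m P x = Y *m P x) -> X = Y.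
Proof.
move=> h; rewrite -[X]mulmx1 -[Y]mulmx1 -proj_sum1 !mulmx_sumr.
by apply: eq_bigr.
Qed.

Lemma siegel_opD S T : siegel_op (S + T) = siegel_op S *m siegel_op T.
Proof.
apply: eq_on_proj => x; rewrite -mulmxA !siegel_op_proj -scalemxAr siegel_op_proj.
rewrite [RHS]scalerA -chiD //; congr (chi _ *: _); rewrite /quad_tr -mulrDr.
rewrite -mxtraceD -!mulmxDl -mulmxDr; congr (_ * \tr (_ *m _ *m _ *m _)).
rewrite /symmetrize -scalerDr [(S + T)^T]linearD; congr (_ *: _).
by rewrite addrACA addrC.
Qed.

Lemma siegel_op0 : siegel_op 0 = 1%:M.
Proof.
rewrite -proj_sum1; apply: eq_bigr => x _; rewrite /quad_tr /symmetrize.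
by rewrite trmx0 addr0 scaler0 mulmx0 !mul0mx mxtrace0 mulr0 chi_0 // scale1r.
Qed.

Lemma quad_trD T x b : quad_tr T (x + b)
  = quad_tr T x + quad_tr T b + \tr (b^T *m symmetrize T *m x *m B).
Proof.
rewrite /quad_tr; set S := symmetrize T; have Ss : S^T = S := symmetrize_tr T.
have E : \tr (x^T *m S *m b *m B) = \tr (b^T *m S *m x *m B).
  by rewrite -mxtrace_tr !trmx_mul trmxK Bs Ss mxtrace_mulC !mulmxA.
rewrite [(x + b)^T]linearD /= !mulmxDl !mulmxDr !mulmxDl !mxtraceD E !mulrDr.
rewrite -[X in _ = _ + X](half_add two_neq0); ring.
Qed.

(** On the range of P x the operator siegel_op is the scalar chi (quad_tr T
    x), and R (col_mx 0 b) shifts x by b: the commutation rule is the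
    polarisation identity quad_trD. *)
Lemma siegel_opR T w : siegel_op T *m R w = R (val (usiegel T) *m w) *m siegel_op T.
Proof.
pose S := symmetrize T; have Ss : S^T = S := symmetrize_tr T.
have hA a : siegel_op T *m Ra a = Ra a *m siegel_op T.
  apply: eq_on_proj => x; rewrite -!mulmxA Ra_proj siegel_op_proj -!scalemxAr.
  by rewrite Ra_proj siegel_op_proj !scalerA mulrC.
have hB b : siegel_op T *m Rb b = R (col_mx (S *m b) b) *m siegel_op T.
  apply: eq_on_proj => x; rewrite -!mulmxA siegel_op_proj Rb_proj mulmxA.
  rewrite siegel_op_proj -scalemxAl -Rb_proj -scalemxAr.
  have -> : R (col_mx (S *m b) b) = chi (quad_tr T b) *: (Rb b *m Ra (S *m b)).
    rewrite /Rb /Ra (hsM hR) scalerA -chiD // add_col_mx add0r addr0.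
    rewrite tform_symplJ trmx0 mul0mx mul0mx mxtrace0 sub0r mulmxA.
    by rewrite /quad_tr mulrN subrr chi_0 // scale1r.
  rewrite -scalemxAl -mulmxA Ra_proj -scalemxAr !scalerA -!chiD //.
  by congr (chi _ *: _); rewrite quad_trD -/S trmx_mul Ss; ring.
have RaR a y b : Ra a *m R (col_mx y b) =
    chi (2^-1 * \tr (a^T *m b *m B)) *: R (col_mx (a + y) b).
  rewrite /Ra (hsM hR) tform_symplJ trmx0 !mul0mx mxtrace0 subr0.
  by rewrite add_col_mx add0r.
rewrite -[w]vsubmxK; set a := usubmx w; set b := dsubmx w.
rewrite /= mul_block_col !mul1mx mul0mx add0r -/S.
pose c := chi (2^-1 * \tr (a^T *m b *m B)).
have cI (X Y : 'M[algC]_d) : c *: X = c *: Y -> X = Y.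
  by move/(congr1 ( *:%R c^-1)); rewrite !scalerK // chi_neq0.
apply: cI; rewrite /c.
rewrite scalemxAr scalemxAl -RaR -[X in col_mx X b]addr0 -RaR mulmxA hA.
by rewrite -[LHS]mulmxA -[R (col_mx 0 b)]/(Rb b) hB mulmxA.
Qed.

Lemma usiegelD S T : usiegel (S + T) = (usiegel S * usiegel T)%g.
Proof.
apply: val_inj; rewrite isometry_valM /= mulmx_block.
rewrite !(mul0mx, mulmx0, mul1mx, mulmx1, add0r, addr0); congr block_mx.
rewrite /symmetrize -scalerDr [(S + T)^T]linearD; congr (_ *: _).
by rewrite addrACA addrC.
Qed.

Lemma usiegel0 : usiegel 0 = 1%g.
Proof.
apply: val_inj; rewrite isometry_val1 /= /symmetrize trmx0 addr0 scaler0.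
by rewrite -scalar_mx_block.
Qed.

(** Both sides satisfy the same commutation rule with R, hence differ by a
    character of the group of symmetric matrices. Conjugation by the Levi
    subgroup shows that this character is invariant under congruence, hence
    trivial. *)
Lemma om_usiegel T : om (usiegel T) = siegel_op T.
Proof.
have inv S : siegel_op S *m siegel_op (- S) = 1%:M.
  by rewrite -siegel_opD subrr siegel_op0.
have inv' S : siegel_op (- S) *m siegel_op S = 1%:M.
  by rewrite -siegel_opD addNr siegel_op0.
have d0 := hs_d_neq0 hR.
pose la S := \tr (siegel_op (- S) *m om (usiegel S)) / d%:R.
have laE S : om (usiegel S) = la S *: siegel_op S.
  have [w|a Ea] := hs_scalar hR (X := siegel_op (- S) *m om (usiegel S)).
    rewrite -mulmxA oR -[val _ *m w]/(val (usiegel S) *m w).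
    rewrite -[X in _ = R X *m _](_ : val (usiegel (- S)) *m (val (usiegel S) *m w) = _).
      by rewrite !mulmxA siegel_opR !mulmxA.
    rewrite mulmxA -isometry_valM -usiegelD addNr usiegel0 isometry_val1.
    by rewrite mul1mx.
  have aE : la S = a by rewrite /la Ea mxtrace_scalar -[a *+ _]mulr_natr mulfK.
  by rewrite aE -mul_mx_scalar -Ea mulmxA inv mul1mx.
suff la1 : la T = 1 by rewrite laE la1 scale1r.
have opn0 S : siegel_op S != 0.
  apply/eqP=> h; have := inv S; rewrite h mul0mx => /esym/eqP.
  by rewrite -mxrank_eq0 mxrank1 eqn0Ngt (hs_d hR).
have laI S a : om (usiegel S) = a *: siegel_op S -> la S = a.
  rewrite laE => /eqP; rewrite -subr_eq0 -scalerBl scaler_eq0 (negPf (opn0 S)).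
  by rewrite orbF subr_eq0 => /eqP.
apply: (congr_invariant_char_trivial two_neq0 n1).
- by apply: laI; rewrite usiegel0 repr_mx1 siegel_op0 scale1r.
- move=> S S'; apply: laI; rewrite usiegelD repr_mxM ?inE // !laE siegel_opD.
  by rewrite -scalemxAl -scalemxAr scalerA.
- move=> S; apply: laI; rewrite /siegel_op.
  have sT : symmetrize S^T = symmetrize S by rewrite /symmetrize trmxK addrC.
  have -> : usiegel S^T = usiegel S by apply: val_inj; rewrite /= sT.
  by rewrite laE; congr (_ *: _); apply: eq_bigr => x _; rewrite /quad_tr sT.
move=> g S ug; apply: laI.
pose h : Sp := Isometry (levi_subproof ug).
have hP x : om h *m P x = P ((invmx g)^T *m x) *m om h.
  rewrite !projE -scalemxAr -scalemxAl mulmx_sumr mulmx_suml; congr (_ *: _).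
  rewrite [RHS](reindex (fun a => g *m a)) /=; last first.
    by exists (fun a => invmx g *m a) => a _; rewrite ?mulKmx ?mulKVmx.
  apply: eq_bigr => a _; rewrite -scalemxAr -scalemxAl /Ra oR /=.
  rewrite mul_block_col !mulmx0 !mul0mx !addr0; congr (chi (- \tr (_ *m _)) *: _).
  by rewrite trmx_mul mulmxA -(mulmxA a^T) -trmx_mul mulVmx // trmx1 mulmx1.
have E1 : om h *m siegel_op S = siegel_op (g *m S *m g^T) *m om h.
  rewrite /siegel_op mulmx_suml mulmx_sumr.
  rewrite [RHS](reindex (fun x => (invmx g)^T *m x)) /=; last first.
    exists (fun x => g^T *m x) => x _; rewrite mulmxA -trmx_mul.
      by rewrite mulVmx // trmx1 mul1mx.
    by rewrite mulmxV // trmx1 mul1mx.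
  apply: eq_bigr => x _; rewrite -scalemxAr -scalemxAl hP; congr (chi _ *: _).
  rewrite /quad_tr; congr (_ * \tr (_ *m _)).
  rewrite symmetrizeJ trmx_mul trmxK !mulmxA -(mulmxA _ g^T) -trmx_mul mulVmx // trmx1 mulmx1.
  by rewrite -[x^T *m _ *m g]mulmxA mulVmx // mulmx1.
have hh : om h *m om h^-1%g = 1%:M by rewrite -repr_mxM ?inE // mulgV repr_mx1.
have -> : usiegel (g *m S *m g^T) = (h * usiegel S * h^-1)%g.
  have E : (usiegel (g *m S *m g^T) * h)%g = (h * usiegel S)%g.
    apply: val_inj; rewrite !isometry_valM /= !mulmx_block.
    rewrite !(mul0mx, mulmx0, mul1mx, mulmx1, add0r, addr0); congr block_mx.
    rewrite symmetrizeJ -[LHS]mulmxA -trmx_mul mulVmx //.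
    by rewrite trmx1 mulmx1.
  by rewrite -E mulgK.
rewrite !repr_mxM ?inE // laE -scalemxAr -scalemxAl E1; congr (_ *: _).
by rewrite -[LHS]mulmxA hh mulmx1.
Qed.

End SiegelSpectrum.

(** * The spectrum of the Siegel unipotent group and the U-rank *)

Section CharScale.
Variables (F : finFieldType) (chi : 'CF([set: F])).
Hypothesis chi_nt : nontrivial_char chi.

Lemma sum_chi_scale b : \sum_a chi (a * b) = if b == 0 then #|F|%:R else 0.
Proof.
have [->|b0] := eqVneq.
  by under eq_bigr do rewrite mulr0 chi_0 //; rewrite sumr_const.
have [c hc] := chi_scale_nontriv chi_nt b0; set S := \sum_a _; apply/eqP.
have : S = chi (c * b) * S.
  rewrite {1}/S (reindex_inj (addrI c)) mulr_sumr /=.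
  by apply: eq_bigr => a _; rewrite mulrDl chiD.
move/eqP; rewrite -subr_eq0 -{1}[S]mul1r -mulrBl mulf_eq0 subr_eq0 eq_sym.
by rewrite (negPf hc).
Qed.
End CharScale.

(** The Fourier coefficients S a of chi add up to the cardinal of F, so one
    of them is nonzero; translating the summation variable shows that chi
    is the corresponding character. *)
Lemma chi_scale_ex (F : finFieldType) (chi chi0 : 'CF([set: F])) :
  nontrivial_char chi -> nontrivial_char chi0 ->
  exists2 a, a != 0 & forall b, chi b = chi0 (a * b).
Proof.
move=> hc hc0; pose S a := \sum_b chi b * chi0 (- (a * b)).
have [a Sa] : exists a, S a != 0.
  have [/existsP[a h]|] := boolP [exists a, S a != 0]; first by exists a.
  rewrite negb_exists => /forallP h.
  have : \sum_a S a = #|F|%:R.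
    rewrite exchange_big (bigD1 0) //= [X in _ + X]big1 => [|b b0].
      rewrite addr0 chi_0 //; under eq_bigr do rewrite mulr0 oppr0 chi_0 // mulr1.
      by rewrite sumr_const.
    rewrite -mulr_sumr; under eq_bigr do rewrite -mulrN.
    by rewrite sum_chi_scale // oppr_eq0 (negPf b0) mulr0.
  rewrite big1 => [/esym/eqP|b _]; last by apply/eqP; have := h b; rewrite negbK.
  by rewrite pnatr_eq0 -leqn0 leqNgt -cardsT cardG_gt0.
have E b : chi b = chi0 (a * b).
  have : chi b * chi0 (- (a * b)) * S a = 1 * S a.
    rewrite mul1r [RHS](reindex_inj (addrI b)) mulr_sumr /=.
    apply: eq_bigr => c _; rewrite mulrDr opprD !chiD //; ring.
  move/(mulIf Sa) => h; rewrite -[LHS]mulr1 -(chiNK hc0 (a * b)) mulrA h mul1r //.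
exists a => //; apply: contraTneq isT => a0; have [b] := chi_nontriv hc.
by rewrite E a0 mul0r chi_0 ?eqxx.
Qed.

Section Spectrum.
Variables (F : finFieldType) (chi chi0 : 'CF([set: F])) (n : nat).
Hypotheses (chi_nt : nontrivial_char chi) (chi0_nt : nontrivial_char chi0).
Hypothesis two_neq0 : (2 : F) != 0.
Local Notation J := (symplJ F n).
Local Notation Sp := (form_isometry J).
Local Notation Jalt := (symplJ_alt F n).

Definition siegel_appears (phi : 'CF([set: Sp])) T :=
  [exists i in irr_constt ('Res[siegelU F n] phi), siegel_char chi0 T i].

(** The multiplicity of the character of matrix T in phi, times the order
    of the Siegel group. *)
Definition siegel_coef (phi : 'CF([set: Sp])) (T : 'M[F]_n) : algC :=
  \sum_(g in siegelU F n) phi g * (chi0 (\tr (T *m ursubmx (val g))))^*.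

Lemma siegelU_val (g : Sp) : g \in siegelU F n ->
  val g = block_mx 1%:M (ursubmx (val g)) 0 1%:M
  /\ (ursubmx (val g))^T = ursubmx (val g).
Proof.
rewrite inE => /existsP[S /andP[/eqP sS /eqP E]]; rewrite E.
by rewrite block_mxKur sS.
Qed.

Lemma usiegel_in T : usiegel T \in siegelU F n.
Proof.
rewrite inE; apply/existsP; exists (symmetrize T).
by rewrite symmetrize_tr eqxx /=.
Qed.

Lemma usiegel_ur (g : Sp) : g \in siegelU F n ->
  g = usiegel (ursubmx (val g)).
Proof.
by case/siegelU_val=> E1 E2; apply: val_inj; rewrite [LHS]E1 /= symmetrize_id.
Qed.

Lemma siegelU_urM (g h : Sp) : g \in siegelU F n -> h \in siegelU F n ->
  ursubmx (val (g * h)%g) = ursubmx (val g) + ursubmx (val h).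
Proof.
move=> /siegelU_val[E1 _] /siegelU_val[E2 _]; rewrite isometry_valM E1 E2.
by rewrite mulmx_block !block_mxKur mul1mx mulmx1 addrC.
Qed.

Lemma siegel_charE (T : 'M[F]_n) (i : Iirr (siegelU F n)) phi : siegel_char chi0 T i ->
  '['Res[siegelU F n] phi, 'chi_i] = #|siegelU F n|%:R^-1 * siegel_coef phi T.
Proof.
move=> /forall_inP h; rewrite cfdotE; congr (_ * _); apply: eq_bigr => g Ug.
by rewrite cfResE ?subsetT // (eqP (h g Ug)).
Qed.

Lemma cardU_neq0 : #|siegelU F n|%:R != 0 :> algC.
Proof. by rewrite pnatr_eq0 -lt0n cardG_gt0. Qed.

Lemma siegel_char_ex (T : 'M[F]_n) : exists i : Iirr (siegelU F n), siegel_char chi0 T i.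
Proof.
have h : mx_repr (siegelU F n)
    (fun g : Sp => (chi0 (\tr (T *m ursubmx (val g))))%:M : 'M[algC]_1).
  split=> [|x y Ux Uy].
    rewrite isometry_val1 (scalar_mx_block _ _ 1) block_mxKur mulmx0 mxtrace0.
    by rewrite chi_0.
  by rewrite siegelU_urM // mulmxDr mxtraceD chiD // scalar_mxM.
have : cfRepr (MxRepresentation h) \in irr (siegelU F n).
  apply/irr_reprP; exists (Representation (MxRepresentation h)) => //.
  exact/mx_abs_irrW/linear_mx_abs_irr.
case/irrP=> i Ei; exists i; apply/forall_inP=> g Ug.
by rewrite -Ei cfReprE //= mxtrace_scalar.
Qed.

Lemma siegel_appearsP phi T : reflect (siegel_coef phi T != 0) (siegel_appears phi T).
Proof.
apply: (iffP idP) => [/exists_inP[i hi hT]|h].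
  move: hi; rewrite irr_consttE (siegel_charE _ hT) mulf_eq0 invr_eq0.
  by rewrite (negPf cardU_neq0).
have [i hi] := siegel_char_ex T; apply/exists_inP; exists i => //.
by rewrite irr_consttE (siegel_charE _ hi) mulf_neq0 ?invr_eq0 ?cardU_neq0.
Qed.

Lemma siegel_coef_lin (I : finType) (c : I -> algC) (psi : I -> 'CF([set: Sp])) T :
  siegel_coef (\sum_i c i *: psi i) T = \sum_i c i * siegel_coef (psi i) T.
Proof.
rewrite /siegel_coef; under eq_bigr do rewrite sum_cfunE mulr_suml.
rewrite exchange_big /=; apply: eq_bigr => i _; rewrite mulr_sumr.
by apply: eq_bigr => g _; rewrite cfunE mulrA.
Qed.

Lemma siegel_appears_constt (phi : 'CF([set: Sp])) T : siegel_appears phi T ->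
  exists2 s, s \in irr_constt phi & siegel_appears 'chi_s T.
Proof.
move/siegel_appearsP; rewrite {1}[phi]cfun_sum_cfdot siegel_coef_lin => nz.
have [/existsP[s /andP[h1 h2]]|] :=
    boolP [exists s, ('[phi, 'chi_s] != 0) && (siegel_coef 'chi_s T != 0)].
  by exists s; [rewrite irr_consttE | apply/siegel_appearsP].
rewrite negb_exists => /forallP h; case/eqP: nz; apply: big1 => s _; apply/eqP.
by rewrite mulf_eq0; have := h s; rewrite negb_and !negbK.
Qed.

Lemma sum_siegelU (D : 'M[F]_n) : D^T = D ->
  \sum_(g in siegelU F n) chi0 (\tr (D *m ursubmx (val g)))
    = if D == 0 then #|siegelU F n|%:R else 0.
Proof.
move=> sD; case: eqP => [->|/eqP D0].
  under eq_bigr do rewrite mul0mx mxtrace0 chi_0 //.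
  by rewrite sumr_const.
have [i [j Dij]] := mx_neq0P D0.
have [a ha] := chi_scale_nontriv chi0_nt Dij.
pose u := usiegel (a *: delta_mx j i).
have Uu : u \in siegelU F n := usiegel_in _.
set S := \sum_(g in _) _; apply/eqP.
have : S = chi0 (a * D i j) * S.
  rewrite {1}/S (reindex_inj (mulgI u)) mulr_sumr.
  apply: eq_big => [g|g]; first by rewrite groupMl.
  rewrite groupMl // => Ug; rewrite siegelU_urM // mulmxDr mxtraceD chiD //.
  congr (chi0 _ * _); rewrite /= block_mxKur /symmetrize -scalemxAr mxtraceZ.
  rewrite mulmxDr mxtraceD -[\tr (D *m _^T)]mxtrace_tr trmx_mul trmxK sD.
  rewrite [\tr (_ *m D)]mxtrace_mulC mulrDr half_add //.
  by rewrite mxtrace_mulC -scalemxAl mxtraceZ mxtrace_mul_delta.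
move/eqP; rewrite -subr_eq0 -{1}[S]mul1r -mulrBl mulf_eq0 subr_eq0 eq_sym.
by rewrite (negPf ha).
Qed.

Lemma Urank_leP (phi : 'CF([set: Sp])) r :
  reflect (forall T, T^T = T -> siegel_appears phi T -> (\rank T <= r)%N)
    (Urank chi0 phi <= r)%N.
Proof.
apply: (iffP (bigmax_leqP _ _ _)) => [h T sT aT | h T /andP[/eqP sT aT]].
  by apply: h; rewrite sT eqxx.
exact: h.
Qed.

End Spectrum.

Section OscSpectrum.
Variables (F : finFieldType) (chi chi0 : 'CF([set: F])) (n : nat).
Hypotheses (chi_nt : nontrivial_char chi) (chi0_nt : nontrivial_char chi0).
Hypothesis two_neq0 : (2 : F) != 0.
Hypothesis n1 : (1 < n)%N.
Variable al : F.
Hypothesis chi_al : forall b, chi b = chi0 (al * b).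
Local Notation J := (symplJ F n).
Local Notation Sp := (form_isometry J).
Local Notation Jalt := (symplJ_alt F n).
Variables (k : nat) (B : 'M[F]_k).
Hypothesis Bsym : nondeg_sym B.
Variables (d : nat) (R : 'M[F]_(n + n, k) -> 'M[algC]_d).
Variable om : mx_representation algC [set: Sp] d.
Hypothesis oscR : osc_sys chi B R om.
Let hR : heis_sys chi J B R. Proof. by case: oscR. Qed.
Let Bs : B^T = B. Proof. by case: Bsym. Qed.
Local Notation P := (schrodinger_proj chi B R).

(** The matrix of the character by which the Siegel group acts on the range
    of P x; al enters because the rank is measured with chi0 and not with
    chi. *)
Definition moment (x : 'M[F]_(n, k)) : 'M[F]_n := (al / 2) *: (x *m B *m x^T).

Lemma moment_sym x : (moment x)^T = moment x.
Proof. by rewrite /moment [LHS]linearZ /= !trmx_mul trmxK Bs mulmxA. Qed.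

Lemma om_siegelU (g : Sp) : g \in siegelU F n ->
  om g = \sum_x chi0 (\tr (moment x *m ursubmx (val g))) *: P x.
Proof.
move=> Ug; rewrite {1}(usiegel_ur two_neq0 Ug) (om_usiegel chi_nt two_neq0 n1 Bsym oscR).
have [_ sg] := siegelU_val Ug.
apply: eq_bigr => x _; rewrite chi_al /quad_tr symmetrize_id //; congr (chi0 _ *: _).
rewrite /moment -scalemxAl mxtraceZ mulrA; congr (_ * _).
by rewrite -mulmxA mxtrace_mulC !mulmxA -mulmxA mxtrace_mulC !mulmxA.
Qed.

(** Fourier inversion on the Siegel group selects the projectors P x with
    moment T. *)
Lemma siegel_integral T (X : 'M[algC]_d) : T^T = T ->
  \sum_(g in siegelU F n) \tr (om g *m X) * (chi0 (\tr (T *m ursubmx (val g))))^*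
  = #|siegelU F n|%:R * \sum_(x | moment x == T) \tr (P x *m X).
Proof.
move=> sT; rewrite mulr_sumr.
transitivity (\sum_x \tr (P x *m X) * \sum_(g in siegelU F n)
    chi0 (\tr ((moment x - T) *m ursubmx (val g)))).
  under [RHS]eq_bigr do rewrite mulr_sumr.
  rewrite exchange_big /=; apply: eq_bigr => g Ug.
  rewrite (om_siegelU Ug) mulmx_suml raddf_sum mulr_suml /=; apply: eq_bigr => x _.
  rewrite -scalemxAl mxtraceZ /= -chiN // mulrAC mulrC -chiD //.
  by congr (_ * chi0 _); rewrite mulmxBl linearB.
rewrite [RHS]big_mkcond /=; apply: eq_bigr => x _.
rewrite sum_siegelU //; first by rewrite subr_eq0; case: eqP; rewrite ?mulr0 // mulrC.
by rewrite [LHS]linearB /= moment_sym sT.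
Qed.

Lemma appears_moment s T : s \in irr_constt (cfRepr om) -> T^T = T ->
  siegel_appears chi0 'chi_s T -> exists x, T = moment x.
Proof.
move=> hs sT /exists_inP[i hi hT].
have {}hi := constt_Res_trans (cfRepr_char om) hs hi.
have : siegel_appears chi0 (cfRepr om) T by apply/exists_inP; exists i.
move/(siegel_appearsP chi0_nt); rewrite /siegel_coef.
under eq_bigr => g Ug do rewrite cfReprE ?inE // -[om g]mulmx1.
rewrite siegel_integral // => nz.
have [/existsP[x /eqP h]|] := boolP [exists x, moment x == T]; first by exists x.
rewrite negb_exists => /forallP h; case/eqP: nz; rewrite big1 ?mulr0 // => x.
by rewrite (negPf (h x)).
Qed.

Lemma rank_moment x : (\rank (moment x) <= k)%N.
Proof.
rewrite /moment; apply: leq_trans (mxrankS (scalemx_sub _ (submx_refl _))) _.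
by rewrite -mulmxA (leq_trans (mxrankM_maxr _ _)) // (leq_trans (mxrankM_maxl _ _)) ?rank_leq_row.
Qed.

Lemma Urank_osc s : s \in irr_constt (cfRepr om) -> (Urank chi0 'chi_s <= k)%N.
Proof.
move=> hs; apply/Urank_leP => T sT aT; have [x ->] := appears_moment hs sT aT.
exact: rank_moment.
Qed.

Lemma Urank_max_moment s : (0 < k)%N -> s \in irr_constt (cfRepr om) ->
  Urank chi0 'chi_s = k -> exists x, siegel_appears chi0 'chi_s (moment x)
    /\ \rank (moment x) = k.
Proof.
move=> k0 hs Uk.
have [/existsP[x /andP[h1 /eqP h2]]|] := boolP [exists x,
   siegel_appears chi0 'chi_s (moment x) && (\rank (moment x) == k)].
  by exists x.
rewrite negb_exists => /forallP h.
have : (Urank chi0 'chi_s <= k.-1)%N.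
  apply/Urank_leP => T sT aT; have [x Tx] := appears_moment hs sT aT.
  rewrite Tx in aT *; have := h x; rewrite aT /= => ne; rewrite -ltnS prednK //.
  by rewrite ltn_neqAle ne rank_moment.
by rewrite Uk -ltnS prednK // ltnn.
Qed.

Section Dual.
Local Notation O := (form_isometry B).
Variable omO : mx_representation algC [set: O] d.
Hypothesis omO_R : forall (h : O) w, omO h *m R w = R (w *m (val h)^T) *m omO h.

Lemma omO_proj h x : omO h *m P x = P (x *m (val h)^T) *m omO h.
Proof.
have Uh := isometry_unit h.
rewrite /schrodinger_proj -!lock -scalemxAr -scalemxAl mulmx_sumr mulmx_suml; congr (_ *: _).
rewrite [RHS](reindex (fun a => a *m (val h)^T)) /=; last first.
  by exists (fun a => a *m invmx (val h)^T) => a _; rewrite ?mulmxK ?mulmxKV ?unitmx_tr.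
apply: eq_bigr => a _; rewrite -scalemxAr -scalemxAl omO_R.
rewrite mul_col_mx mul0mx; congr (chi (- _) *: _).
rewrite trmx_mul trmxK mxtrace_mulC.
rewrite -!mulmxA [in RHS]mxtrace_mulC -!mulmxA.
rewrite [in RHS](mulmxA _ B) isometryP.
by rewrite [in LHS]mxtrace_mulC -!mulmxA.
Qed.

Lemma rank_moment_full x : \rank (moment x) = k -> row_full x.
Proof.
move=> rx; rewrite /row_full eqn_leq rank_leq_col /= -{1}rx /moment.
apply: leq_trans (mxrankS (scalemx_sub _ (submx_refl _))) _.
by rewrite -mulmxA mxrankM_maxl.
Qed.

(** When the rank is k, x has a trivial stabiliser in the orthogonal group:
    for h <> 1 the range of P x is moved to that of another projector. *)
Lemma tr_proj_omO x (h : O) : \rank (moment x) = k ->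
  \tr (P x *m omO h) = if h == 1%g then d%:R / #|{: 'M[F]_(n, k)}|%:R else 0.
Proof.
move=> rx; case: eqP => [->|h1].
  by rewrite repr_mx1 mulmx1 (proj_tr chi_nt two_neq0 Bsym oscR).
have PP := proj_mul chi_nt Bsym oscR.
have PPx : P x *m P x = P x by rewrite PP eqxx.
rewrite -PPx mxtrace_mulC mulmxA omO_proj mxtrace_mulC mulmxA PP.
case: eqP => [E|_]; last by rewrite mul0mx mxtrace0.
case: h1; apply: val_inj; rewrite isometry_val1; apply: trmx_inj; rewrite trmx1.
case/row_fullP: (rank_moment_full rx) => Y Yx.
by rewrite -[LHS]mul1mx -Yx -mulmxA -E Yx.
Qed.

Lemma full_moment_ex : (0 < k)%N -> (k <= n)%N -> al != 0 -> exists x, \rank (moment x) = k.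
Proof.
move=> k0 kn al0; pose x : 'M[F]_(n, k) := pid_mx k; exists x.
have rx : \rank x = k by rewrite rank_pid_mx.
have fx : row_free x^T by rewrite /row_free mxrank_tr rx.
rewrite /moment mxrank_scale_nz ?mulf_neq0 ?invr_eq0 //.
rewrite (mxrankMfree _ fx) mxrankMfree // row_free_unit.
by case: Bsym.
Qed.

(** The orthogonal group permutes freely the points of rank k, so the sum
    of their ranges is a multiple of its regular representation, in which
    every tau occurs. Both sides of the computation integrate the trace of
    (g, h) against the conjugates of the character of moment x and of tau. *)
Lemma tau_full_moment (Om : Iirr [set: O] -> 'CF([set: Sp])) (tau : Iirr [set: O]) :
    (forall g h, \tr (om g *m omO h) = \sum_t Om t g * 'chi_t h) ->
    (0 < k)%N -> (k <= n)%N -> al != 0 ->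
  exists2 x, siegel_appears chi0 (Om tau) (moment x) & \rank (moment x) = k.
Proof.
move=> howe k0 kn al0; have [x rx] := full_moment_ex k0 kn al0; exists x => //.
apply/(siegel_appearsP chi0_nt).
pose S := \sum_(h : O) ('chi_tau h)^* * \sum_(g in siegelU F n)
   \tr (om g *m omO h) * (chi0 (\tr (moment x *m ursubmx (val g))))^*.
have E1 : S = #|[set: O]|%:R * siegel_coef chi0 (Om tau) (moment x).
  rewrite /S; under eq_bigr do rewrite mulr_sumr.
  rewrite exchange_big /= mulr_sumr; apply: eq_bigr => g Ug.
  transitivity (\sum_(h : O) (\sum_t Om t g * ('chi_t h * ('chi_tau h)^*)) *
      (chi0 (\tr (moment x *m ursubmx (val g))))^*).
    apply: eq_bigr => h _; rewrite howe mulrA; congr (_ * _).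
    by rewrite mulr_sumr; apply: eq_bigr => t _; rewrite mulrCA [_^* * _]mulrC.
  rewrite -mulr_suml mulrA; congr (_ * _); rewrite exchange_big /=.
  rewrite (bigD1 tau) //= [X in _ + X]big1 => [|t ne].
    rewrite addr0 -mulr_sumr mulrC; congr (_ * _).
    have := cfdot_irr tau tau; rewrite eqxx cfdotE => /(congr1 ( *%R #|[set: O]|%:R)).
    rewrite mulVKf ?mulr1; last by rewrite pnatr_eq0 -lt0n cardG_gt0.
    by move=> <-; apply: eq_bigl => h; rewrite inE.
  rewrite -mulr_sumr; have := cfdot_irr t tau; rewrite (negPf ne) cfdotE.
  move/(congr1 ( *%R #|[set: O]|%:R)).
  rewrite mulVKf ?mulr0; last by rewrite pnatr_eq0 -lt0n cardG_gt0.
  move=> E0; rewrite (_ : \sum_h _ = 0) ?mulr0 // -[RHS]E0.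
  by apply: eq_bigl => h; rewrite inE.
have E2 : S = ('chi_tau 1%g)^* * (#|siegelU F n|%:R *
     \sum_(y | moment y == moment x) (d%:R / #|{: 'M[F]_(n, k)}|%:R)).
  rewrite /S; under eq_bigr do rewrite siegel_integral ?moment_sym //.
  rewrite (bigD1 1%g) //= [X in _ + X]big1 => [|h h1].
    rewrite addr0; congr (_ * (_ * _)); apply: eq_bigr => y /eqP yx.
    by rewrite tr_proj_omO ?yx // eqxx.
  rewrite big1 ?mulr0 // => y /eqP yx.
  by rewrite tr_proj_omO ?yx // (negPf h1).
apply: contraTneq isT => E0; have : S != 0.
  rewrite E2 !mulf_neq0 ?cardU_neq0 ?conjC_eq0 ?irr1_neq0 //.
  rewrite sumr_const -[(_ / _) *+ _]mulr_natr !mulf_neq0 ?invr_eq0 ?(hs_d_neq0 hR) //.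
    by rewrite pnatr_eq0 -lt0n; apply/card_gt0P; exists 0.
  rewrite pnatr_eq0 -lt0n; apply/card_gt0P; exists x; exact: eqxx.
by rewrite E1 E0 mulr0 eqxx.
Qed.

End Dual.
End OscSpectrum.

(** * The commutant of the symplectic group in an oscillator representation *)

Section Commutant.
Variables (F : finFieldType) (chi : 'CF([set: F])) (n : nat).
Hypothesis chi_nt : nontrivial_char chi.
Hypothesis two_neq0 : (2 : F) != 0.
Local Notation J := (symplJ F n).
Local Notation Sp := (form_isometry J).
Local Notation Jalt := (symplJ_alt F n).
Local Notation m := (n + n)%N.
Variables (k : nat) (B : 'M[F]_k).
Hypothesis Bsym : nondeg_sym B.
Variables (d : nat) (R : 'M[F]_(n + n, k) -> 'M[algC]_d).
Variable om : mx_representation algC [set: Sp] d.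
Hypothesis oscR : osc_sys chi B R om.
Let hR : heis_sys chi J B R. Proof. by case: oscR. Qed.
Let Bs : B^T = B. Proof. by case: Bsym. Qed.
Local Notation O := (form_isometry B).
Variable omO : mx_representation algC [set: O] d.
Hypothesis omO_R : forall (h : O) w, omO h *m R w = R (w *m (val h)^T) *m omO h.

(** The subspace W (x) v, totally isotropic when v is isotropic. *)
Definition line_set (v : 'rV[F]_k) : {set 'M[F]_(n + n, k)} :=
  [set z *m v | z : 'cV[F]_(n + n)].

Variable P : 'M[algC]_d.
Hypothesis Pline : forall v : 'rV[F]_k, v != 0 -> v *m B *m v^T = 0 ->
  P *m iso_avg R (line_set v) = 0.

(** X belongs to the algebra generated by the orthogonal group, up to
    matrices killed by P on the left. *)
Definition in_orth_span X := rspan (fun h : O => P *m omO h) (P *m X).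
Local Notation Ls := in_orth_span.

Lemma LsZ a X : Ls X -> Ls (a *: X).
Proof. by move=> h; rewrite /Ls -scalemxAr; apply: rspanZ. Qed.
Lemma Ls_sum (K : Type) (r : seq K) (Q : pred K) (G : K -> 'M_d) :
  (forall i, Q i -> Ls (G i)) -> Ls (\sum_(i <- r | Q i) G i).
Proof. by move=> h; rewrite /Ls mulmx_sumr; apply: rspan_sum. Qed.
Lemma LsB X Y : Ls X -> Ls Y -> Ls (X - Y).
Proof.
by move=> hX hY; rewrite /Ls mulmxBr -scaleN1r; apply: rspanD => //; apply: rspanZ.
Qed.

Section Gauss.
Variables (j : nat) (M : 'M[F]_(j, k)) (al : 'M[F]_k).
Hypothesis fM : row_free M.

(** As al varies, the weights separate the Gram matrices w^T J w, so these
    sums, which commute with the symplectic group, span the same space as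
    the sums of R over the w with given Gram matrix and row space in M. *)
Definition gauss_op : 'M[algC]_d :=
  \sum_(w : 'M[F]_(n + n, k) | (w <= M)%MS) chi (\tr (al *m (w^T *m J *m w))) *: R w.
Local Notation T := gauss_op.
Let Gam : 'M[F]_k := 2^-1 *: B - (al - al^T).
Let G : 'M[F]_j := M *m Gam *m M^T.
Let s (z : 'cV[F]_(n + n)) (w : 'M[F]_(n + n, k)) X (v : 'rV[F]_k) : F :=
  \tr (z^T *m J *m w *m X *m v^T).

Let zJz (z : 'cV[F]_(n + n)) : z^T *m J *m z = 0.
Proof. exact: (alt_col two_neq0 Jalt). Qed.

Let tform_zv z v w : tform J B (z *m v) w = s z w B v.
Proof.
by rewrite /tform /s trmx_mul -!mulmxA mxtrace_mulC !mulmxA.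
Qed.

(** Translating w by z v multiplies the terms by characters linear in w:
    the Gram matrix and the cocycle of R combine into the single bilinear
    form Gam. *)
Lemma R_gauss (z : 'cV[F]_(n + n)) (v : 'rV[F]_k) : (v <= M)%MS ->
  R (z *m v) *m T = \sum_(w : 'M[F]_(n + n, k) | (w <= M)%MS)
    chi (\tr (al *m (w^T *m J *m w)) + s z w Gam v) *: R w.
Proof.
move=> vM; have zvM : (z *m v <= M)%MS by rewrite (submx_trans (submxMl _ _)).
rewrite /T mulmx_sumr [RHS](reindex_inj (addrI (z *m v))) /=.
apply: eq_big => [w|w wM].
  apply/idP/idP=> h; first exact: addmx_sub.
  by rewrite -(addKr (z *m v) w) addmx_sub // eqmx_opp.
rewrite -scalemxAr (hsM hR) scalerA -chiD //; congr (chi _ *: _).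
have E1 : s z (z *m v + w) Gam v = s z w Gam v.
  by rewrite /s mulmxDr mulmxA zJz mul0mx add0r.
have E2 : \tr (al *m (w^T *m J *m (z *m v))) = - s z w al^T v.
  rewrite -mxtrace_tr !trmx_mul (symplJ_alt F n).1 trmxK /s.
  rewrite mulNmx mulmxN mulNmx linearN /=; congr (- _).
  by rewrite -!mulmxA mxtrace_mulC !mulmxA.
have E3 : \tr (al *m ((z *m v)^T *m J *m w)) = s z w al v.
  by rewrite trmx_mul /s mxtrace_mulC -!mulmxA mxtrace_mulC !mulmxA.
rewrite E1 tform_zv [(z *m v + w)^T]linearD /= !mulmxDl !mulmxDr.
rewrite [(z *m v)^T *m J *m (z *m v)](_ : _ = 0); last first.
  by rewrite trmx_mul -!mulmxA (mulmxA J) (mulmxA z^T) [z^T *m _]mulmxA zJz mul0mx mulmx0.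
rewrite mulmx0 add0r !mxtraceD E2 E3.
have -> : s z w Gam v = 2^-1 * s z w B v - s z w al v + s z w al^T v.
  rewrite /s /Gam !mulmxBr !mulmxBl !linearB /= -scalemxAr -scalemxAl mxtraceZ.
  by rewrite opprB addrA addrAC.
ring.
Qed.

(** A radical vector v of the form G is isotropic for B, and R_gauss shows
    that R (z v) fixes the sum: its image consists of vectors fixed by W
    (x) v. *)
Lemma gauss_singular : G \notin unitmx -> P *m T = 0.
Proof.
rewrite -unitmx_tr -row_free_unit -kermx_eq0 => /mx_neq0P[i [i' K0]].
pose m0 := row i (kermx G^T); have m00 : m0 != 0.
  by apply: contraNneq K0 => E; have := congr1 (fun X : 'rV_j => X 0 i') E; rewrite !mxE => ->.
have Gm0 : G *m m0^T = 0.
  apply: trmx_inj; rewrite trmx_mul trmxK trmx0 /m0 -row_mul mulmx_ker.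
  by rewrite row0.
pose v := m0 *m M; have v0 : v != 0.
  by apply: contraNneq m00 => E; apply/eqP/(row_free_inj fM); rewrite -/v E mul0mx.
have wGv (w : 'M[F]_(n + n, k)) : (w <= M)%MS -> w *m Gam *m v^T = 0.
  case/submxP=> D ->; have -> : D *m M *m Gam *m v^T = D *m (G *m m0^T).
    by rewrite /v trmx_mul /G !mulmxA.
  by rewrite Gm0 mulmx0.
have RvT z : R (z *m v) *m T = T.
  rewrite R_gauss ?submxMl // /T; apply: eq_bigr => w wM.
  have -> : s z w Gam v = \tr (z^T *m J *m (w *m Gam *m v^T)) by rewrite /s !mulmxA.
  by rewrite wGv // mulmx0 mxtrace0 addr0.
have eT : iso_avg R (line_set v) *m T = T.
  rewrite /iso_avg -scalemxAl mulmx_suml.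
  rewrite (eq_bigr (fun=> T)); last by move=> x /imsetP[z _ ->]; exact: RvT.
  rewrite sumr_const -[T *+ _]scaler_nat scalerA mulVf ?scale1r //.
  rewrite pnatr_eq0 -lt0n; apply/card_gt0P; exists (0 *m v).
  by apply/imsetP; exists 0.
have vBv : v *m B *m v^T = 0.
  have : v *m Gam *m v^T = 0.
    have -> : v *m Gam *m v^T = m0 *m (G *m m0^T) by rewrite /v trmx_mul /G !mulmxA.
    by rewrite Gm0 mulmx0.
  rewrite /Gam !mulmxBr !mulmxBl -scalemxAr -scalemxAl.
  have tr11 (X : 'M[F]_1) : X^T = X by rewrite [X]mx11_scalar tr_scalar_mx.
  have q (y : 'rV_k) : y *m al^T *m y^T = y *m al *m y^T.
    by rewrite -(tr11 (y *m al *m _)) !trmx_mul trmxK mulmxA.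
  rewrite q.
  rewrite subrr subr0 => /eqP; rewrite scaler_eq0 invr_eq0 (negPf two_neq0).
  by move/eqP.
by rewrite -eT mulmxA Pline // mul0mx.
Qed.

Lemma commute_all X : (forall (z : 'cV[F]_(n + n)) (v : 'rV[F]_k),
    X *m R (z *m v) = R (z *m v) *m X) -> exists a, X = a%:M.
Proof.
move=> h; apply: (hs_scalar hR) => w.
have -> : w = \sum_i col i w *m (delta_mx 0 i : 'rV_k).
  apply/matrixP=> a b; rewrite summxE (bigD1 b) //= big1 => [|i ib].
    by rewrite mxE big_ord1 !mxE !eqxx mulr1 addr0.
  by rewrite mxE big_ord1 !mxE [b == i]eq_sym (negPf ib) andbF mulr0.
apply: (big_ind (fun w => X *m R w = R w *m X)) => // [|x y hx hy].
  by rewrite (hs0 hR) mulmx1 mul1mx.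
have E : R (x + y) = (chi (2^-1 * tform J B x y))^-1 *: (R x *m R y).
  by rewrite (hsM hR) scalerA mulVf ?scale1r // chi_neq0.
by rewrite E -scalemxAr -scalemxAl mulmxA hx -[R x *m X *m R y]mulmxA hy mulmxA.
Qed.

(** The Cayley transform attached to G on the row space of M: it is an
    isometry because G + G^T is the restriction of B. *)
Lemma cayley_subproof : G \in unitmx ->
  is_isometry B (1%:M - M^T *m invmx G *m M *m B).
Proof.
move=> uG; set K := M^T *m invmx G *m M.
have GG : G + G^T = M *m B *m M^T.
  rewrite /G !trmx_mul trmxK !mulmxA -mulmxDl -mulmxDr; congr (_ *m _ *m _).
  rewrite /Gam [(_ - _)^T]linearB /= [(_ *: B)^T]linearZ /= Bs [(al - _)^T]linearB /= trmxK.
  rewrite addrACA -scalerDl -[2^-1 + _]mulr2n -[_ *+ 2]mulr_natl divff // scale1r.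
  by rewrite -opprD addrA subrK subrr oppr0 addr0.
have KK : K^T *m B *m K = K + K^T.
  have -> : K^T *m B *m K = M^T *m (invmx G)^T *m (M *m B *m M^T) *m invmx G *m M.
    by rewrite /K !trmx_mul trmxK !mulmxA.
  rewrite -GG mulmxDr !mulmxDl addrC trmx_inv; congr (_ + _).
    by rewrite mulmxKV ?unitmx_tr.
  have trK (X : 'M_j) : (M^T *m X *m M)^T = M^T *m X^T *m M.
    by rewrite !trmx_mul trmxK mulmxA.
  by rewrite (mulmxK uG) /K trK trmx_inv.
apply: (isometry_of Bsym.2).
have -> : (1%:M - K *m B)^T = 1%:M - B *m K^T.
  by rewrite [LHS]linearB /= trmx1 trmx_mul Bs.
rewrite mulmxBl mul1mx mulmxBr mulmx1 mulmxBl.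
have -> : B *m K^T *m B *m (K *m B) = B *m (K^T *m B *m K) *m B.
  by rewrite !mulmxA.
rewrite KK mulmxDr mulmxDl !mulmxA.
move: (B *m K *m B) (B *m K^T *m B) => X Y.
by apply/matrixP=> a b; rewrite !mxE; ring.
Qed.

(** The sum commutes with the operators R w in the same way as omO h does,
    for h the Cayley transform, and such a matrix is unique up to a scalar. *)
Lemma gauss_regular (uG : G \in unitmx) :
  exists (h : O) a, T = a *: omO h.
Proof.
pose h : O := Isometry (cayley_subproof uG); exists h.
have key (z : 'cV[F]_(n + n)) (v : 'rV[F]_k) : T *m R (z *m v) = R (z *m v *m (val h)^T) *m T.
  (* Conjugation of T by R (z v) and left multiplication of T by R (z u)
     agree. *)
  pose u := v *m B *m M^T *m (invmx G)^T *m M.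
  have uM : (u <= M)%MS by apply: submxMl.
  have uE : u^T = M^T *m invmx G *m M *m B *m v^T.
    by rewrite /u !trmx_mul !trmxK Bs !mulmxA.
  have E1 : R (z *m v) *m T *m R (- (z *m v)) = R (z *m u) *m T.
    rewrite (R_gauss z uM) /T mulmx_sumr mulmx_suml; apply: eq_bigr => w wM.
    rewrite -scalemxAr -scalemxAl (hs_conj chi_nt two_neq0 Jalt Bsym hR) scalerA -chiD //.
    congr (chi (_ + _) *: _); rewrite tform_zv /s uE; congr (\tr _).
    case/submxP: wM => w0 ->.
    have -> : z^T *m J *m (w0 *m M) *m Gam *m (M^T *m invmx G *m M *m B *m v^T)
        = z^T *m J *m w0 *m (G *m invmx G) *m M *m B *m v^T by rewrite !mulmxA.
    by rewrite mulmxV // mulmx1 !mulmxA.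
  have {}E1 : R (z *m u) *m T *m R (z *m v) = R (z *m v) *m T.
    by rewrite -E1 -[LHS]mulmxA (hsVl chi_nt two_neq0 Jalt Bsym hR) mulmx1.
  have E2 : R (- (z *m u)) *m R (z *m v) = R (z *m v *m (val h)^T).
    rewrite (hsM0 chi_nt hR); last first.
      by rewrite tformNl tform_zv /s !mulmxA zJz !mul0mx mxtrace0 oppr0.
    congr R; rewrite /= [(1%:M - _)^T]linearB /= trmx1 mulmxBr mulmx1 addrC.
    by congr (_ - _); rewrite !trmx_mul trmxK Bs /u !mulmxA.
  rewrite -E2 -[RHS]mulmxA -E1 -!mulmxA [RHS]mulmxA.
  by rewrite (hsVl chi_nt two_neq0 Jalt Bsym hR) mul1mx.
have oV : omO h *m omO h^-1%g = 1%:M by rewrite -repr_mxM ?inE // mulgV repr_mx1.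
have oVl : omO h^-1%g *m omO h = 1%:M by rewrite -repr_mxM ?inE // mulVg repr_mx1.
have [z v|a Ea] := commute_all (X := omO h^-1%g *m T).
  rewrite -mulmxA key mulmxA omO_R mulmxA; congr (R _ *m _ *m _).
  by rewrite -[LHS]mulmxA -trmx_mul isometry_valV mulVmx ?isometry_unit // trmx1 mulmx1.
by exists a; rewrite -mul_mx_scalar -Ea mulmxA oV mul1mx.
Qed.

Lemma Ls_gauss : Ls T.
Proof.
have [uG|nG] := boolP (G \in unitmx); last first.
  by rewrite /Ls gauss_singular //; apply: rspan0.
have [h [a ->]] := gauss_regular uG; apply: LsZ; exact: rspan_id.
Qed.

End Gauss.

Let gram (w : 'M[F]_(n + n, k)) : 'M[F]_k := w^T *m J *m w.

(** Fourier inversion in al. *)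
Lemma Ls_sub_gram (U A : 'M[F]_k) :
  Ls (\sum_(w : 'M[F]_(n + n, k) | (w <= U)%MS && (gram w == A)) R w).
Proof.
pose N : algC := #|{: 'M[F]_k}|%:R.
have N0 : N != 0 by rewrite pnatr_eq0 -lt0n; apply/card_gt0P; exists 0.
suff -> : \sum_(w : 'M[F]_(n + n, k) | (w <= U)%MS && (gram w == A)) R w
    = N^-1 *: \sum_al chi (- \tr (al *m A)) *: gauss_op (row_base U) al.
  apply: LsZ; apply: Ls_sum => al _; apply: LsZ; apply: Ls_gauss.
  exact: row_base_free.
rewrite /gauss_op; under [X in _ = _ *: X]eq_bigr do rewrite scaler_sumr.
rewrite exchange_big /= scaler_sumr big_mkcondr /=; apply: eq_big => w.
  by rewrite eq_row_base.
move=> wU; under eq_bigr => al _.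
  rewrite scalerA -chiD // addrC -linearB -mulmxBr. over.
rewrite -scaler_suml sum_chi_mx // subr_eq0 scalerA /gram.
by case: eqP => _; rewrite ?mulr0 ?scale0r // mulVf // scale1r.
Qed.

(** Matrices with row space exactly U are obtained from those with row
    space contained in U by removing the smaller row spaces. *)
Lemma Ls_orbit (U A : 'M[F]_k) :
  Ls (\sum_(w : 'M[F]_(n + n, k) | (<<w>>%MS == U) && (gram w == A)) R w).
Proof.
have [r] := ubnP (\rank U); elim: r => // r IH in U *; rewrite ltnS => rU.
have [gU|gU] := eqVneq <<U>>%MS U; last first.
  rewrite big_pred0; first by rewrite /Ls mulmx0; apply: rspan0.
  by move=> w; apply: contraNF gU => /andP[/eqP <- _]; rewrite genmx_id.
have part : \sum_(w : 'M[F]_(n + n, k) | (w <= U)%MS && (gram w == A)) R w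
    = \sum_(V : 'M[F]_k | (V <= U)%MS)
        \sum_(w : 'M[F]_(n + n, k) | (<<w>>%MS == V) && (gram w == A)) R w.
  rewrite (partition_big (fun w : 'M[F]_(n + n, k) => <<w>>%MS) (fun V => (V <= U)%MS)) /=.
    apply: eq_bigr => V VU; apply: eq_bigl => w.
    rewrite andbC; case: eqP => //= EV; rewrite -genmxE EV VU //.
  by move=> w /andP[wU _]; rewrite genmxE.
have := Ls_sub_gram U A; rewrite part (bigD1 U) //= => h.
rewrite -[X in Ls X](addrK (\sum_(V : 'M[F]_k | (V <= U)%MS && (V != U))
   \sum_(w : 'M[F]_(n + n, k) | (<<w>>%MS == V) && (gram w == A)) R w)).
apply: LsB => //; apply: Ls_sum => V /andP[VU neV].
have [gV|gV] := eqVneq <<V>>%MS V; last first.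
  rewrite big_pred0; first by rewrite /Ls mulmx0; apply: rspan0.
  by move=> w; apply: contraNF gV => /andP[/eqP <- _]; rewrite genmx_id.
apply: IH; apply: leq_trans rU; rewrite ltn_neqAle mxrankS // andbT.
apply: contraNneq neV => rk; rewrite -gV -gU; apply/eqP/genmxP.
by rewrite VU /= -(mxrank_leqif_sup VU) rk.
Qed.

(** By Witt's theorem the row space and the Gram matrix determine the
    orbit. *)
Lemma Ls_orbit_avg w0 : Ls (\sum_(g : Sp) R (val g *m w0)).
Proof.
suff -> : \sum_(g : Sp) R (val g *m w0) = #|[set g : Sp | val g *m w0 == w0]|%:R *:
    \sum_(w : 'M[F]_(n + n, k) | (<<w>>%MS == <<w0>>%MS) && (gram w == gram w0)) R w.
  by apply: LsZ; apply: Ls_orbit.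
rewrite (partition_big (fun g : Sp => val g *m w0)
   (fun w => (<<w>>%MS == <<w0>>%MS) && (gram w == gram w0))) /=; last first.
  move=> g _; rewrite /gram trmx_mul; apply/andP; split.
    apply/eqP/eq_genmx/eqmxMfull; rewrite row_full_unit; exact: isometry_unit.
  have -> : w0^T *m (val g)^T *m J *m (val g *m w0)
      = w0^T *m ((val g)^T *m J *m val g) *m w0 by rewrite !mulmxA.
  by rewrite isometryP.
rewrite scaler_sumr; apply: eq_bigr => w /andP[/eqP Ew /eqP Gw].
have [g0 Eg0] := witt two_neq0 Jalt (esym Ew) (esym Gw).
under eq_bigr => g /eqP-> do [].
rewrite sumr_const -[R w *+ _]scaler_nat; congr (_%:R *: _).
rewrite -[RHS](card_imset _ (mulgI g0)); apply: eq_card => g.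
change ((val g *m w0 == w) = (g \in mulg g0 @: [set g : Sp | val g *m w0 == w0])).
apply/eqP/imsetP => [gw|[h]]; last rewrite inE => /eqP gw.
  exists (g0^-1 * g)%g; last by rewrite mulKVg.
  rewrite inE isometry_valM isometry_valV -mulmxA gw -Eg0 mulKmx //.
  exact: isometry_unit.
by move=> ->; rewrite isometry_valM -mulmxA gw Eg0.
Qed.

(** A matrix of the commutant is its own average over the group, hence a
    combination of orbit sums of R. *)
Lemma commutant_span X : (forall g, om g *m X = X *m om g) -> Ls X.
Proof.
move=> hX; have [c Ec] := hs_full hR X.
have N0 : #|{: Sp}|%:R != 0 :> algC.
  by rewrite pnatr_eq0 -lt0n; apply/card_gt0P; exists 1%g.
have -> : X = #|{: Sp}|%:R^-1 *: \sum_w c w *: \sum_(g : Sp) R (val g *m w).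
  under eq_bigr do rewrite scaler_sumr; rewrite exchange_big /=.
  rewrite (eq_bigr (fun=> X)) => [|g _].
    by rewrite sumr_const -[X *+ _]scaler_nat scalerA mulVf // scale1r.
  have -> : X = om g *m X *m om g^-1%g.
    by rewrite hX -mulmxA -repr_mxM ?inE // mulgV repr_mx1 mulmx1.
  rewrite Ec mulmx_sumr mulmx_suml; apply: eq_bigr => w _.
  by rewrite -scalemxAr -scalemxAl (osc_conj oscR).
by apply: LsZ; apply: Ls_sum => w _; apply: LsZ; apply: Ls_orbit_avg.
Qed.

End Commutant.

(** * Isotypic projectors and uniqueness of the large constituent *)

Lemma cfun_mulC (gT : finGroupType) (G : {group gT}) (phi : 'CF(G)) x y :
  x \in G -> phi (x * y)%g = phi (y * x)%g.
Proof. by move=> Gx; rewrite -(cfunJ phi (x * y)%g Gx) conjgE mulgA mulKg. Qed.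

Section Isotypic.
Variables (gT : finGroupType) (G : {group gT}) (d : nat).
Variable rG : mx_representation algC G d.

Definition isotypic_proj (i : Iirr G) : 'M[algC]_d :=
  ('chi_i 1%g / #|G|%:R) *: \sum_(x in G) 'chi_i x^-1%g *: rG x.

Lemma cardG_neq0 : #|G|%:R != 0 :> algC.
Proof. by rewrite pnatr_eq0 -lt0n cardG_gt0. Qed.

Lemma isotypic_comm i X : (forall x, x \in G -> rG x *m X = X *m rG x) ->
  isotypic_proj i *m X = X *m isotypic_proj i.
Proof.
move=> h; rewrite /isotypic_proj -scalemxAl -scalemxAr mulmx_suml mulmx_sumr.
by congr (_ *: _); apply: eq_bigr => x Gx; rewrite -scalemxAl -scalemxAr h.
Qed.

Lemma isotypic_commG i x : x \in G -> rG x *m isotypic_proj i = isotypic_proj i *m rG x.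
Proof.
move=> Gx; rewrite /isotypic_proj -scalemxAl -scalemxAr mulmx_suml mulmx_sumr.
congr (_ *: _); rewrite (reindex_inj (conjg_inj x)) /=; apply: eq_big => [y|y].
  by rewrite groupJr.
rewrite groupJr // => Gy; rewrite -scalemxAl -scalemxAr -!repr_mxM ?groupJ //.
by rewrite -conjVg cfunJ // -conjgC.
Qed.

Lemma isotypic_mul i j :
  isotypic_proj i *m isotypic_proj j = if i == j then isotypic_proj j else 0.
Proof.
have key z : z \in G -> \sum_(x in G) 'chi_i x^-1%g * 'chi_j (z^-1 * x)%g
    = #|G|%:R * ((j == i)%:R * ('chi_j z^-1%g / 'chi_j 1%g)).
  move=> Gz; rewrite -generalized_orthogonality_relation mulVKf ?cardG_neq0 //.
  by apply: eq_bigr => x Gx; rewrite mulrC cfun_mulC.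
have E : (\sum_(x in G) 'chi_i x^-1%g *: rG x) *m (\sum_(x in G) 'chi_j x^-1%g *: rG x)
    = \sum_(z in G) (#|G|%:R * ((j == i)%:R * ('chi_j z^-1%g / 'chi_j 1%g))) *: rG z.
  rewrite mulmx_suml.
  transitivity (\sum_(x in G) \sum_(z in G)
      ('chi_i x^-1%g * 'chi_j (z^-1 * x)%g) *: rG z).
    apply: eq_bigr => x Gx; rewrite mulmx_sumr (reindex_inj (mulgI x^-1%g)) /=.
    apply: eq_big => [z|z]; first by rewrite groupMl ?groupV.
    rewrite groupMl ?groupV // => Gz; rewrite -scalemxAl -scalemxAr scalerA invMg invgK.
    by rewrite -repr_mxM ?groupM ?groupV // mulKVg.
  rewrite exchange_big /=; apply: eq_bigr => z Gz.
  by rewrite -scaler_suml key.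
rewrite /isotypic_proj -scalemxAl -scalemxAr scalerA E eq_sym.
have [->|ne] := eqVneq i j; last first.
  by rewrite big1 ?scaler0 // => z _; rewrite mul0r mulr0 scale0r.
rewrite !scaler_sumr; apply: eq_bigr => z Gz; rewrite !scalerA mul1r; congr (_ *: _).
by field; rewrite cardG_neq0 irr1_neq0.
Qed.

Lemma isotypic_tr i (X : 'M[algC]_d) : \tr (isotypic_proj i *m X) =
  'chi_i 1%g / #|G|%:R * \sum_(x in G) \tr (rG x *m X) * ('chi_i x)^*.
Proof.
rewrite /isotypic_proj -scalemxAl mxtraceZ mulmx_suml raddf_sum /=; congr (_ * _).
by apply: eq_bigr => x Gx; rewrite -scalemxAl mxtraceZ irr_inv mulrC.
Qed.

(** The sum of the conjugates of y is central, so it acts by a scalar on an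
    irreducible representation. *)
Lemma class_avg_irr (i : Iirr G) y : y \in G -> exists c, forall z, z \in G ->
  \sum_(x in G) 'chi_i (x * y * x^-1 * z)%g = c * 'chi_i z.
Proof.
move=> Gy; rewrite -(irrRepr i).
have absr : mx_absolutely_irreducible 'Chi_i by exact/groupC/socle_irr.
move: ('Chi_i) absr => r absr; pose Z := \sum_(x in G) r (x * y * x^-1)%g.
have /is_scalar_mxP[c Ec] : is_scalar_mx Z.
  apply: (mx_abs_irr_cent_scalar absr).
  apply/centgmxP=> z Gz; rewrite /Z mulmx_suml mulmx_sumr.
  rewrite [LHS](reindex_inj (mulgI z)) /=; apply: eq_big => [x|x].
    by rewrite groupMl.
  rewrite groupMl // => Gx.
  rewrite -!repr_mxM ?groupM ?groupV ?groupM //; congr (r _).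
  by rewrite invMg !mulgA mulgKV.
exists c => z Gz; transitivity (\tr (Z *m r z)).
  rewrite /Z mulmx_suml raddf_sum; apply: eq_bigr => x Gx.
  by rewrite cfReprE ?groupM ?groupV // repr_mxM ?groupM ?groupV.
by rewrite Ec mul_scalar_mx mxtraceZ cfReprE.
Qed.

Lemma class_avg_isotypic i y : y \in G -> exists c,
  (\sum_(x in G) rG (x * y * x^-1)%g) *m isotypic_proj i = c *: isotypic_proj i.
Proof.
move=> Gy; have [c Ec] := class_avg_irr i Gy; exists c.
rewrite /isotypic_proj -scalemxAr [RHS]scalerA [c * _]mulrC -[RHS]scalerA.
congr (_ *: _).
rewrite mulmx_suml scaler_sumr.
transitivity (\sum_(x in G) \sum_(z in G) 'chi_i (x * y * x^-1 * z^-1)%g *: rG z).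
  apply: eq_bigr => x Gx; have Gt : (x * y * x^-1)%g \in G by rewrite !groupM ?groupV.
  rewrite mulmx_sumr [RHS](reindex_inj (mulgI (x * y * x^-1)%g)) /=.
  apply: eq_big => [z|z Gz]; first by rewrite groupMl.
  rewrite -scalemxAr -repr_mxM //; congr (_ *: _).
  by rewrite (cfun_mulC _ _ Gt) [((_ * z)^-1)%g]invMg mulgKV.
rewrite exchange_big /=; apply: eq_bigr => z Gz.
by rewrite -scaler_suml Ec ?groupV // scalerA.
Qed.

End Isotypic.

Lemma idem_tr0 d (X : 'M[algC]_d) : X *m X = X -> \tr X = 0 -> X = 0.
Proof.
move=> XX; case: (idem_split XX) => r [b [c [_ <- <-]]] /eqP.
rewrite pnatr_eq0 => /eqP r0; apply/matrixP=> i j; rewrite !mxE big1 // => u _.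
by have := ltn_ord u; rewrite {2}r0.
Qed.

Section Compress.
Variables (gT : finGroupType) (G : {group gT}) (d r : nat).
Variable rG : mx_representation algC G d.
Variables (b : 'M[algC]_(r, d)) (c : 'M[algC]_(d, r)) (e : 'M[algC]_d).
Hypotheses (bc : b *m c = 1%:M) (cb : c *m b = e).
Hypothesis comm : forall x, x \in G -> rG x *m e = e *m rG x.

Lemma compress_mx_repr : mx_repr G (fun x => b *m rG x *m c).
Proof.
have ee : b *m e = b by rewrite -cb mulmxA bc mul1mx.
split=> [|x y Gx Gy]; first by rewrite repr_mx1 mulmx1.
rewrite repr_mxM // !mulmxA -[b *m rG x *m c *m b]mulmxA cb.
by rewrite -(mulmxA b (rG x) e) comm // (mulmxA b e) ee.
Qed.
Definition compress_repr := MxRepresentation compress_mx_repr.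

Lemma compress_intertwine x X Y : x \in G -> rG x *m X = Y *m rG x ->
  compress_repr x *m (b *m X *m c) = b *m Y *m c *m compress_repr x.
Proof.
move=> Gx XY; have be : b *m e = b by rewrite -cb mulmxA bc mul1mx.
have ec : e *m c = c by rewrite -cb -mulmxA bc mulmx1.
have -> : compress_repr x *m (b *m X *m c) = b *m (rG x *m (c *m b)) *m (X *m c).
  by rewrite /= !mulmxA.
rewrite cb comm // (mulmxA b e) be -!mulmxA (mulmxA (rG x)) XY /= -!mulmxA.
by rewrite (mulmxA c b) cb (mulmxA e) -comm // -!mulmxA ec.
Qed.

(** The product of the two commuting projectors is a projector, whose trace
    is proportional to the multiplicity of chi_i in the range of e. *)
Lemma isotypic_kill i : i \notin irr_constt (cfRepr compress_repr) ->
  isotypic_proj rG i *m e = 0.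
Proof.
have ee : e *m e = e by rewrite -cb mulmxA -(mulmxA c) bc mulmx1.
rewrite irr_consttE negbK cfdotE mulf_eq0 invr_eq0 (negPf (cardG_neq0 G)) /= => /eqP h.
have Ee := isotypic_comm i comm.
apply: idem_tr0.
  by rewrite mulmxA -(mulmxA _ e) -Ee mulmxA isotypic_mul eqxx -mulmxA ee.
rewrite isotypic_tr (_ : \sum_(x in G) _ = 0) ?mulr0 // -[RHS]h.
by apply: eq_bigr => x Gx; rewrite cfReprE //= -cb mulmxA mxtrace_mulC mulmxA.
Qed.
End Compress.

Section Uniqueness.
Variables (F : finFieldType) (chi : 'CF([set: F])) (n : nat).
Hypothesis chi_nt : nontrivial_char chi.
Hypothesis two_neq0 : (2 : F) != 0.
Local Notation J := (symplJ F n).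
Local Notation Sp := (form_isometry J).
Variables (k : nat) (B : 'M[F]_k).
Hypothesis Bsym : nondeg_sym B.
Variables (d : nat) (R : 'M[F]_(n + n, k) -> 'M[algC]_d).
Variable om : mx_representation algC [set: Sp] d.
Hypothesis oscR : osc_sys chi B R om.
Local Notation O := (form_isometry B).
Variable omO : mx_representation algC [set: O] d.
Hypothesis omO_R : forall (h : O) w, omO h *m R w = R (w *m (val h)^T) *m omO h.
Hypothesis omC : forall g h, om g *m omO h = omO h *m om g.
Variable Om : Iirr [set: O] -> 'CF([set: Sp]).
Hypothesis Om_char : forall t, Om t \is a character.
Hypothesis howe : forall g h, \tr (om g *m omO h) = \sum_t Om t g * 'chi_t h.

Local Notation E s := (isotypic_proj om s).
Local Notation Q t := (isotypic_proj omO t).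

Lemma isotypic_pair_tr s t : \tr (E s *m Q t) = 'chi_s 1%g * 'chi_t 1%g * '[Om t, 'chi_s].
Proof.
rewrite isotypic_tr.
transitivity ('chi_s 1%g / #|[set: Sp]|%:R *
   \sum_(x in [set: Sp]) ('chi_t 1%g * Om t x) * ('chi_s x)^*).
  congr (_ * _); apply: eq_bigr => x _; congr (_ * _).
  rewrite mxtrace_mulC isotypic_tr.
  under eq_bigr => y _ do rewrite mxtrace_mulC howe mulr_suml.
  rewrite exchange_big (bigD1 t) //= [X in _ + X]big1 => [|u ut].
    under eq_bigr => y _ do rewrite -mulrA.
    rewrite -mulr_sumr addr0.
    have := cfdot_irr t t; rewrite eqxx cfdotE => E1.
    by rewrite -mulrA [X in _ * X]mulrCA E1 mulr1.
  under eq_bigr => y _ do rewrite -mulrA.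
  rewrite -mulr_sumr; have := cfdot_irr u t; rewrite (negPf ut) cfdotE => /eqP.
  by rewrite mulf_eq0 invr_eq0 (negPf (cardG_neq0 _)) => /eqP ->; rewrite mulr0.
rewrite cfdotE; under eq_bigr => x _ do rewrite -mulrA.
by rewrite -mulr_sumr; ring.
Qed.

(** Let P = E s + E s' with s <> s'. By commutant_span, E s is P times an
    element of the algebra of the orthogonal group; averaging it over
    conjugation makes it act by a scalar a on the t-isotypic part, so E s Q
    t = a (E s + E s') Q t. Multiplying by E s' gives a = 0, so E s Q t =
    0, although s occurs in Om t. *)
Lemma eta_unique s s' t : s \in irr_constt (Om t) -> s' \in irr_constt (Om t) ->
    (forall v : 'rV[F]_k, v != 0 -> v *m B *m v^T = 0 ->
       E s *m iso_avg R (line_set n v) = 0 /\ E s' *m iso_avg R (line_set n v) = 0) ->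
  s = s'.
Proof.
move=> hs hs' kill; apply/eqP; apply: contraT => ne.
pose P := E s + E s'.
have Pline (v : 'rV[F]_k) : v != 0 -> v *m B *m v^T = 0 ->
    P *m iso_avg R (line_set n v) = 0.
  by move=> v0 vv; case: (kill v v0 vv) => h1 h2; rewrite mulmxDl h1 h2 addr0.
have [c Ec] : in_orth_span omO P (E s).
  apply: (commutant_span chi_nt two_neq0 Bsym oscR omO_R Pline) => g.
  by rewrite isotypic_commG ?inE.
have PEs : P *m E s = E s.
  by rewrite mulmxDl !isotypic_mul eqxx eq_sym (negPf ne) addr0.
have PO h : omO h *m P = P *m omO h.
  rewrite mulmxDr mulmxDl; congr (_ + _); apply/esym; apply: isotypic_comm => g _; exact: omC.
have EO u h : omO h *m E u = E u *m omO h.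
  by apply/esym; apply: isotypic_comm => g _; exact: omC.
have avg : E s = #|[set: O]|%:R^-1 *: (P *m \sum_h c h *: \sum_(y in [set: O]) omO (y * h * y^-1)%g).
  have E1 y : E s = P *m \sum_h c h *: omO (y * h * y^-1)%g.
    have yy : omO y *m omO y^-1%g = 1%:M by rewrite -repr_mxM ?inE // mulgV repr_mx1.
    rewrite -[LHS]mulmx1 -yy mulmxA -EO -PEs Ec !mulmx_sumr mulmx_suml.
    apply: eq_bigr => h _; rewrite -!scalemxAr -scalemxAl; congr (_ *: _).
    by rewrite mulmxA PO -!mulmxA -!repr_mxM ?inE // mulgA.
  under eq_bigr do rewrite scaler_sumr.
  rewrite exchange_big /= mulmx_sumr (eq_bigr (fun=> E s)) => [|y _]; last by rewrite -E1.
  by rewrite sumr_const -[E s *+ _]scaler_nat scalerA mulVf ?scale1r // cardG_neq0.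
have [a Ea] : exists a, E s *m Q t = a *: (P *m Q t).
  have [f hf] := fin_all_exists (fun h => class_avg_isotypic omO t (in_setT h)).
  exists (#|[set: O]|%:R^-1 * \sum_h c h * f h).
  rewrite {1}avg -scalemxAl -mulmxA mulmx_suml -scalerA; congr (_ *: _).
  rewrite scaler_suml mulmx_sumr; apply: eq_bigr => h _.
  by rewrite -scalemxAl hf scalerA -scalemxAr.
have nz u : u \in irr_constt (Om t) -> E u *m Q t != 0.
  rewrite irr_consttE => hu; apply/eqP => E0; have := isotypic_pair_tr u t.
  rewrite E0 mxtrace0 => /esym/eqP; apply/negP.
  exact: mulf_neq0 (mulf_neq0 (irr1_neq0 u) (irr1_neq0 t)) hu.
have := congr1 (mulmx (E s')) Ea.
rewrite mulmxA isotypic_mul eq_sym (negPf ne) mul0mx -scalemxAr mulmxA.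
rewrite mulmxDr !isotypic_mul eq_sym (negPf ne) eqxx add0r => /esym/eqP.
rewrite scaler_eq0 (negPf (nz _ hs')) orbF => /eqP a0.
by move: (nz _ hs); rewrite Ea a0 scale0r eqxx.
Qed.

End Uniqueness.

(** * Symmetric forms over a finite field of odd characteristic *)

Section Forms.
Variable F : finFieldType.
Hypothesis two_neq0 : (2 : F) != 0.

Lemma congr_sym k l (B : 'M[F]_k) (X : 'M[F]_(k, l)) : B^T = B ->
  (X^T *m B *m X)^T = X^T *m B *m X.
Proof. by move=> Bs; rewrite !trmx_mul trmxK Bs mulmxA. Qed.

(** The orthogonal of a nondegenerate subspace, spanned by D, is a
    complement to it. The inverse Q of row_mx D C is given explicitly,
    since the matrix is square only up to the equation j + l = k. *)
Lemma split_form k j (B : 'M[F]_k) (D : 'M[F]_(k, j)) : nondeg_sym B ->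
    D^T *m B *m D \in unitmx ->
  exists l (C : 'M[F]_(k, l)) (Q : 'M[F]_(j + l, k)),
  [/\ (j + l)%N = k, row_mx D C *m Q = 1%:M, Q *m row_mx D C = 1%:M,
      nondeg_sym (C^T *m B *m C) &
      (row_mx D C)^T *m B *m row_mx D C = block_mx (D^T *m B *m D) 0 0 (C^T *m B *m C)].
Proof.
move=> [Bs Bu] uG; pose K := kermx (B *m D); pose C := (row_base K)^T.
exists (\rank K), C.
have CBD : C^T *m B *m D = 0.
  rewrite -mulmxA trmxK; apply/sub_kermxP; by rewrite eq_row_base.
have DBC : D^T *m B *m C = 0.
  by apply: trmx_inj; rewrite 2!trmx_mul [(D^T)^T]trmxK Bs mulmxA CBD trmx0.
have fC : row_free C^T by rewrite trmxK row_base_free.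
have rBD : \rank (B *m D) = j.
  apply/eqP; rewrite eqn_leq rank_leq_col /= -{1}(mxrank_unit uG) -mulmxA.
  exact: mxrankM_maxr.
have jk : (j <= k)%N by rewrite -{1}rBD rank_leq_row.
have jl : (j + \rank K)%N = k by rewrite mxrank_ker rBD subnKC.
have fP : row_free (row_mx D C)^T.
  rewrite tr_row_mx; apply: row_free_ker => y; rewrite -[y]hsubmxK mul_row_col.
  set a := lsubmx y; set b := rsubmx y => E.
  have a0 : a = 0.
    have : (a *m D^T + b *m C^T) *m (B *m D)
        = a *m (D^T *m B *m D) + b *m (C^T *m B *m D) by rewrite mulmxDl !mulmxA.
    rewrite E mul0mx CBD mulmx0 addr0 => /esym E1.
    by rewrite -[a](mulmxK uG) E1 mul0mx.
  move: E; rewrite a0 mul0mx add0r => E.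
  have -> : b = 0 by apply: (row_free_inj fC); rewrite E mul0mx.
  by rewrite row_mx0.
have PE : (row_mx D C)^T *m B *m row_mx D C = block_mx (D^T *m B *m D) 0 0 (C^T *m B *m C).
  by rewrite tr_row_mx mul_col_mx mul_col_row DBC CBD.
have uP : row_full (row_mx D C)^T by rewrite /row_full (eqP fP) jl.
have PQ : row_mx D C *m (pinvmx (row_mx D C)^T)^T = 1%:M.
  by apply: trmx_inj; rewrite trmx_mul trmxK mulVpmx // trmx1.
have QP : (pinvmx (row_mx D C)^T)^T *m row_mx D C = 1%:M.
  by apply: trmx_inj; rewrite trmx_mul trmxK mulmxVp // trmx1.
exists (pinvmx (row_mx D C)^T)^T; split => //; split; first exact: congr_sym.
set H := C^T *m B *m C in PE *; set Q := (pinvmx _)^T in PQ QP.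
have : block_mx (D^T *m B *m D) 0 0 H *m (Q *m invmx B *m Q^T) = 1%:M.
  rewrite -PE -!mulmxA (mulmxA (row_mx D C)) PQ mul1mx mulKVmx // -trmx_mul QP.
  by rewrite trmx1.
rewrite -[X in _ *m X]submxK mulmx_block scalar_mx_block => /eq_block_mx[_ _ _].
by rewrite mul0mx add0r => /mulmx1_unit[].
Qed.

Lemma anisotropic_ex k (B : 'M[F]_k.+1) : nondeg_sym B ->
  exists v : 'cV_k.+1, v^T *m B *m v != 0.
Proof.
move=> [Bs Bu]; have B0 : B != 0.
  by apply: contraTneq Bu => ->; rewrite unitmxE det0 ?unitr0 // expr0n.
have [i [j Bij]] := mx_neq0P B0.
pose b (x y : 'cV[F]_k.+1) := x^T *m B *m y.
pose x : 'cV[F]_k.+1 := delta_mx i 0; pose y : 'cV[F]_k.+1 := delta_mx j 0.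
have bxy : b x y != 0.
  apply: contraNneq Bij => /matrixP/(_ 0 0).
  by rewrite /b /x /y trmx_delta -rowE -colE !mxE => ->.
have byx : b y x = b x y.
  have tr11 (X : 'M[F]_1) : X^T = X by rewrite [X]mx11_scalar tr_scalar_mx.
  by rewrite /b -[LHS]tr11 2!trmx_mul trmxK Bs mulmxA.
have [hx|] := eqVneq (b x x) 0; last by exists x.
have [hy|] := eqVneq (b y y) 0; last by exists y.
exists (x + y); rewrite [(x + y)^T]linearD /= !mulmxDl !mulmxDr -!/(b _ _).
rewrite hx hy byx add0r addr0 -mulr2n -scaler_nat scaler_eq0 (negPf two_neq0).
exact: bxy.
Qed.

Definition squares : {set F} := [set x ^+ 2 | x : F].

(** Squaring is at most two to one, and one to one above 0. *)
Lemma card_squares : (#|F| < #|squares|.*2)%N.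
Proof.
have fib s : s \in squares -> (#|[set x : F | x ^+ 2 == s]| <= 2 - (s == 0%R))%N.
  case/imsetP=> y _ ->; have -> : [set x : F | x ^+ 2 == y ^+ 2] = [set y; - y].
    by apply/setP=> x; rewrite !inE eqf_sqr.
  have [->|y0] := eqVneq y 0.
    by rewrite expr0n eqxx oppr0 setUid cards1.
  by rewrite cards2 sqrf_eq0 (negPf y0); case: (_ != _).
have s0 : 0 \in squares by apply/imsetP; exists 0; rewrite ?expr0n.
have -> : #|F| = (\sum_(s in squares) #|[set x : F | (x ^+ 2 == s)%R]|)%N.
  rewrite -cardsT -sum1_card (partition_big (fun x : F => x ^+ 2) (mem squares)) /=.
    apply: eq_bigr => s _; rewrite -sum1_card; apply: eq_bigl => x.
    by rewrite !inE.
  by move=> x _; apply: imset_f.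
apply: (@leq_ltn_trans (\sum_(s in squares) (2 - (s == 0%R)))%N).
  exact: leq_sum.
rewrite (bigD1 0) //= eqxx.
rewrite (eq_bigr (fun=> 2)) => [|s /andP[_ /negPf->] //].
have -> : (\sum_(i in squares | i != 0%R) 2)%N = (#|squares :\ 0%R|.*2)%N.
  rewrite sum_nat_const -muln2; congr (_ * _)%N; apply: eq_card => s.
  by rewrite !inE andbC unfold_in.
by rewrite (cardsD1 0 squares) s0 doubleD.
Qed.

(** Two sets that each contain more than half of the elements meet. *)
Lemma conic_point a b : a != 0 -> b != 0 -> exists s t : F, a * s ^+ 2 + b * t ^+ 2 = 1.
Proof.
move=> a0 b0; pose S1 := [set a * s | s in squares]; pose S2 := [set 1 - b * s | s in squares].
have c1 : #|S1| = #|squares| by rewrite card_imset //; apply: mulfI.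
have c2 : #|S2| = #|squares|.
  rewrite card_imset // => x y /(congr1 (fun z => 1 - z)); rewrite !subKr.
  exact: mulfI.
have : S1 :&: S2 != set0.
  apply: contraTneq card_squares => I0; rewrite -leqNgt -addnn -{1}c1 -c2.
  by rewrite -cardsUI I0 cards0 addn0 -cardsT subset_leq_card // subsetT.
case/set0Pn=> x; rewrite inE => /andP[/imsetP[u /imsetP[s _ ->] ->]].
case/imsetP=> v /imsetP[t _ ->] E; exists s, t.
by rewrite E subrK.
Qed.

(** The squares and their multiples by u each make up more than half of the
    elements and share only 0, so together they exhaust the field. *)
Lemma square_dichotomy (u x : F) : u != 0 -> x != 0 ->
  (forall c, u != c ^+ 2) -> exists2 c, c != 0 & x = c ^+ 2 \/ x = u * c ^+ 2.
Proof.
move=> u0 x0 nu; pose S2 := [set u * s | s in squares].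
have c2 : #|S2| = #|squares| by rewrite card_imset //; apply: mulfI.
have I0 : squares :&: S2 \subset [set 0].
  apply/subsetP=> y; rewrite !inE => /andP[/imsetP[s _ Es] /imsetP[w /imsetP[t _ ->] Ey]].
  rewrite Ey; have [->|t0] := eqVneq t 0; first by rewrite expr0n mulr0.
  case/negP: (nu (s / t)); apply/eqP; rewrite expr_div_n -Es Ey mulfK //.
  by rewrite expf_neq0.
have UT : squares :|: S2 = [set: F].
  apply/eqP; rewrite eqEcard subsetT cardsT /=.
  have := cardsUI squares S2; rewrite c2 addnn => E.
  have := card_squares; rewrite -E; have := subset_leq_card I0; rewrite cards1.
  case: #|_ :&: _| => [|[|//]] _; first by rewrite addn0 => /ltnW.
  by rewrite addn1 ltnS.
have : x \in squares :|: S2 by rewrite UT inE.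
have ne c y : x = y * c ^+ 2 -> c != 0.
  by apply: contra_eq_neq => ->; rewrite expr0n mulr0.
rewrite inE => /orP[/imsetP[c _ Ex]|/imsetP[w /imsetP[c _ ->] Ex]].
  by exists c; [apply: (ne c 1); rewrite mul1r | left].
by exists c; [apply: (ne c u) | right].
Qed.

(** Two orthogonal vectors of nonzero value span a plane, where conic_point
    applies. *)
Lemma value_one k (B : 'M[F]_k.+2) : nondeg_sym B -> exists v : 'cV_k.+2, v^T *m B *m v = 1%:M.
Proof.
move=> nB; have [v1 h1] := anisotropic_ex nB.
have u1 : v1^T *m B *m v1 \in unitmx.
  rewrite [_ *m _]mx11_scalar unitmxE det_scalar1 unitfE.
  by apply: contraNneq h1 => E; rewrite [_ *m _]mx11_scalar E raddf0.
have [l [C [Q [lk PQ QP nC PE]]]] := split_form nB u1.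
case: l C Q lk PQ QP nC PE => [|l] C Q // lk PQ QP nC PE.
have [w hw] := anisotropic_ex nC.
set a := v1^T *m B *m v1 in h1 PE; set c := w^T *m _ *m w in hw.
have nz (X : 'M[F]_1) : X != 0 -> X 0 0 != 0.
  by apply: contraNneq => E; rewrite [X]mx11_scalar E raddf0.
have [s [t st]] := conic_point (nz _ h1) (nz _ hw).
pose x : 'cV[F]_(1 + l.+1) := col_mx s%:M (t *: w).
exists (row_mx v1 C *m x).
have -> : (row_mx v1 C *m x)^T *m B *m (row_mx v1 C *m x)
    = x^T *m ((row_mx v1 C)^T *m B *m row_mx v1 C) *m x.
  by rewrite trmx_mul !mulmxA.
rewrite PE /x tr_col_mx mul_row_block mul_row_col !mulmx0 addr0 add0r.
rewrite tr_scalar_mx [(t *: w)^T]linearZ /= -!scalemxAl -scalemxAr -/c scalerA.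
rewrite mul_scalar_mx mul_mx_scalar scalerA [a]mx11_scalar [c]mx11_scalar !scale_scalar_mx.
rewrite -raddfD /=; congr _%:M; rewrite -st !expr2; ring.
Qed.

Definition congruent k (B B' : 'M[F]_k) := exists2 P, P \in unitmx & P^T *m B *m P = B'.

(** Vectors of value 1 split off from both forms, which leaves the
    determinants of the complements in the same class modulo squares. *)
Lemma congruent_of_det k (B B' : 'M[F]_k) c : nondeg_sym B -> nondeg_sym B' -> c != 0 ->
  \det B' = \det B * c ^+ 2 -> congruent B B'.
Proof.
elim: k B B' c => [|k IH] B B' c nB nB' c0 E.
  by exists 1%:M; rewrite ?unitmx1 //; apply/matrixP=> [[]].
case: k => [|k] in IH B B' nB nB' E *.
  exists c%:M; first by rewrite unitmxE det_scalar1 unitfE.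
  rewrite tr_scalar_mx mul_scalar_mx mul_mx_scalar scalerA [B]mx11_scalar [B']mx11_scalar.
  rewrite scale_scalar_mx; congr _%:M; move: E.
  by rewrite [B]mx11_scalar [B']mx11_scalar !det_scalar1 !mxE /= !mulr1n => ->; rewrite mulrC.
have [v hv] := value_one nB; have [v' hv'] := value_one nB'.
have u1 : v^T *m B *m v \in unitmx by rewrite hv unitmx1.
have u1' : v'^T *m B' *m v' \in unitmx by rewrite hv' unitmx1.
have [l [C [Q [lk PQ QP nC PE]]]] := split_form nB u1.
have [l' [C' [Q' [lk' PQ' QP' nC' PE']]]] := split_form nB' u1'.
have {}lk : l = k.+1 by case: lk.
have {}lk' : l' = k.+1 by case: lk'.
subst l l'.
rewrite hv in PE; rewrite hv' in PE'.
set P := row_mx v C in PQ QP PE; set P' := row_mx v' C' in PQ' QP' PE'.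
have dE : \det (C^T *m B *m C) = \det B * (\det (P : 'M_k.+2)) ^+ 2.
  have := congr1 (fun X : 'M_(1 + k.+1) => \det X) PE.
  rewrite /= det_ublock det1 mul1r => <-; rewrite !det_mulmx det_tr; ring.
have dE' : \det (C'^T *m B' *m C') = \det B' * (\det (P' : 'M_k.+2)) ^+ 2.
  have := congr1 (fun X : 'M_(1 + k.+1) => \det X) PE'.
  rewrite /= det_ublock det1 mul1r => <-; rewrite !det_mulmx det_tr; ring.
have uP : (P : 'M_k.+2) \in unitmx by case: (mulmx1_unit PQ).
have uP' : (P' : 'M_k.+2) \in unitmx by case: (mulmx1_unit PQ').
have dP0 : \det (P : 'M_k.+2) != 0 by rewrite -unitfE -unitmxE.
have dP0' : \det (P' : 'M_k.+2) != 0 by rewrite -unitfE -unitmxE.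
have [||S uS SE] := IH _ _ (c * \det (P' : 'M_k.+2) / \det (P : 'M_k.+2)) nC nC'.
- by rewrite !mulf_neq0 ?invr_eq0.
- rewrite dE dE' E; field; exact: dP0.
pose T : 'M_(1 + k.+1) := block_mx 1%:M 0 0 S.
have uT : T \in unitmx by rewrite unitmxE /T det_ublock det1 mul1r -unitmxE.
have uQ' : (Q' : 'M_k.+2) \in unitmx by case: (mulmx1_unit QP').
exists (P *m T *m Q').
  by rewrite (unitmx_mul (P *m T : 'M_k.+2) Q') (unitmx_mul (P : 'M_k.+2) T) uP uT uQ'.
have -> : (P *m T *m Q')^T *m B *m (P *m T *m Q') = Q'^T *m (T^T *m (P^T *m B *m P) *m T) *m Q'.
  by rewrite !trmx_mul !mulmxA.
rewrite PE /T tr_block_mx !mulmx_block !trmx0 trmx1.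
rewrite !(mul0mx, mulmx0, mul1mx, mulmx1, add0r, addr0) SE -PE'.
rewrite !mulmxA -trmx_mul PQ' trmx1 mul1mx -mulmxA PQ' mulmx1 //.
Qed.

Lemma form_dichotomy k (Bp Bm B : 'M[F]_k) :
  nondeg_sym Bp -> nondeg_sym Bm -> nondeg_sym B -> ~ congruent Bp Bm ->
  congruent Bp B \/ congruent Bm B.
Proof.
move=> np nm nB npm; have nz (X : 'M[F]_k) : nondeg_sym X -> \det X != 0.
  by case=> _; rewrite unitmxE unitfE.
have [|||c c0 E] := @square_dichotomy (\det Bm / \det Bp) (\det B / \det Bp) _ _ .
- by rewrite mulf_neq0 ?invr_eq0 ?nz.
- by rewrite mulf_neq0 ?invr_eq0 ?nz.
- move=> c; apply/eqP=> E; case: npm; apply: (congruent_of_det np nm (c := c)).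
    apply: contraNneq (nz _ nm) => c0; rewrite -[\det Bm](divfK (nz _ np)) E c0.
    by rewrite expr0n mul0r.
  by rewrite -E mulrC divfK ?nz.
case: E => E; [left | right].
  by apply: (congruent_of_det np nB c0); rewrite -E mulrC divfK ?nz.
apply: (congruent_of_det nm nB c0).
by rewrite -[LHS](divfK (nz _ np)) E mulrAC divfK ?nz.
Qed.

End Forms.

(** * Products of oscillator characters, and isotropic lines *)

Section Products.
Variables (F : finFieldType) (chi : 'CF([set: F])) (n : nat).
Hypothesis chi_nt : nontrivial_char chi.
Hypothesis two_neq0 : (2 : F) != 0.
Local Notation J := (symplJ F n).
Local Notation Sp := (form_isometry J).
Local Notation Jalt := (symplJ_alt F n).

(** The oscillator representation for the character t |-> chi (a t), with a
    carried by the form on a line V so that chi stays fixed. *)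
Definition is_osc_char (a : F) (phi : 'CF([set: Sp])) :=
  a != 0 /\ exists d R (om : mx_representation algC [set: Sp] d),
    osc_sys chi (a%:M : 'M[F]_1) R om /\ phi = cfRepr om.

Definition is_osc_product k (phi : 'CF([set: Sp])) := exists s : seq ('CF([set: Sp])),
  [/\ size s = k, forall psi, psi \in s -> exists a, is_osc_char a psi
    & phi = \prod_(psi <- s) psi].

Lemma nondeg_sym_block k1 k2 (B1 : 'M[F]_k1) (B2 : 'M[F]_k2) :
  nondeg_sym B1 -> nondeg_sym B2 -> nondeg_sym (block_mx B1 0 0 B2).
Proof.
move=> [s1 u1] [s2 u2]; split; first by rewrite tr_block_mx !trmx0 s1 s2.
by rewrite unitmxE det_ublock unitrM -!unitmxE u1 u2.
Qed.

Lemma nondeg_sym11 (a : F) : a != 0 -> nondeg_sym (a%:M : 'M_1).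
Proof. by move=> a0; split; rewrite ?tr_scalar_mx // unitmxE det_scalar1 unitfE. Qed.

Lemma osc_product_sys (s : seq ('CF([set: Sp]))) :
    (forall psi, psi \in s -> exists a, is_osc_char a psi) ->
  exists (B : 'M[F]_(size s)) d R (om : mx_representation algC [set: Sp] d),
    [/\ nondeg_sym B, osc_sys chi B R om & cfRepr om = \prod_(psi <- s) psi].
Proof.
elim: s => [|psi s IH] h.
  have [d [R [om [o1 o2]]]] := osc_sys0 n chi_nt.
  exists 1%:M, d, R, om; split => //; last by rewrite big_nil.
  by split; rewrite ?trmx1 ?unitmx1.
have [|B [d [R [om [nB oB cB]]]]] := IH; first by move=> x xs; apply: h; rewrite inE xs orbT.
have [a [a0 [d1 [R1 [om1 [o1 c1]]]]]] := h psi (mem_head _ _).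
exists (block_mx (a%:M : 'M_1) 0 0 B).
exists (d1 * d)%N, (fun w => R1 (lsubmx w) *t R (rsubmx w)), (tens_repr om1 om); split.
- by apply: (@nondeg_sym_block 1 (size s)) => //; apply: nondeg_sym11.
- exact: (osc_sys_tens chi_nt o1 oB).
by rewrite cfRepr_tens big_cons c1 cB.
Qed.

(** In an orthogonal basis of V the form is a sum of lines, whose scalars
    are values of B. *)
Lemma osc_product_ex k (B : 'M[F]_k) : nondeg_sym B ->
    (forall v : 'cV_k, (v^T *m B *m v) 0 0 != 0 ->
       exists phi, is_osc_char ((v^T *m B *m v) 0 0) phi) ->
  exists d R (om : mx_representation algC [set: Sp] d),
    osc_sys chi B R om /\ is_osc_product k (cfRepr om).
Proof.
elim: k B => [|k IH] B nB av.
  have [d [R [om [o1 o2]]]] := osc_sys0 n chi_nt.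
  exists d, R, om; split; first by rewrite [B](_ : _ = 1%:M) //; apply/matrixP=> [[]].
  by exists [::]; split => //; rewrite big_nil.
have [v hv] := anisotropic_ex two_neq0 nB.
set a := v^T *m B *m v in hv.
have a0 : a 0 0 != 0 by apply: contraNneq hv => E; rewrite [a]mx11_scalar E raddf0.
have ua : a \in unitmx by rewrite [a]mx11_scalar unitmxE det_scalar1 unitfE.
have [l [C [Q [lk PQ QP nC PE]]]] := split_form nB ua.
have {}lk : l = k by case: lk.
subst l; rewrite -/a in PE.
have [|d [R [om [o [s [sk hs cs]]]]]] := IH _ nC.
  move=> w; have -> : w^T *m (C^T *m B *m C) *m w = (C *m w)^T *m B *m (C *m w).
    by rewrite trmx_mul !mulmxA.
  exact: av.
have [phi hphi] := av _ a0; case: (hphi) => _ [d1 [R1 [om1 [o1 c1]]]].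
have := osc_sys_tens chi_nt o1 o; rewrite -mx11_scalar -PE => /(osc_sys_congr QP PQ).
have -> : Q^T *m ((row_mx v C)^T *m B *m row_mx v C) *m Q = B.
  by rewrite !mulmxA -trmx_mul PQ trmx1 mul1mx -mulmxA PQ mulmx1.
move=> o2; eexists; eexists; eexists; split; first exact: o2.
exists (phi :: s); split; first by rewrite /= sk.
  move=> psi; rewrite inE => /predU1P[->|]; last exact: hs.
  by exists (a 0 0).
by rewrite big_cons cfRepr_tens -c1 cs.
Qed.

Hypothesis n1 : (1 < n)%N.

Lemma osc_product_of_sys k (B : 'M[F]_k) d R (om : mx_representation algC [set: Sp] d) :
    nondeg_sym B ->
    (forall v : 'cV_k, (v^T *m B *m v) 0 0 != 0 ->
       exists phi, is_osc_char ((v^T *m B *m v) 0 0) phi) ->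
  osc_sys chi B R om -> is_osc_product k (cfRepr om).
Proof.
move=> nB av o; have [d' [R' [om' [o' h]]]] := osc_product_ex nB av.
by rewrite (osc_char_unique chi_nt two_neq0 nB n1 o o').
Qed.

Section Line.
Variables (k : nat) (B : 'M[F]_k).
Hypothesis nB : nondeg_sym B.
Variables (d : nat) (R : 'M[F]_(n + n, k) -> 'M[algC]_d).
Variable om : mx_representation algC [set: Sp] d.
Hypothesis oscR : osc_sys chi B R om.
Let hR : heis_sys chi J B R. Proof. by case: oscR. Qed.
Let Bs : B^T = B. Proof. by case: nB. Qed.
Variable v : 'rV[F]_k.
Hypotheses (v0 : v != 0) (vBv : v *m B *m v^T = 0).
Hypothesis av : forall v : 'cV_k, (v^T *m B *m v) 0 0 != 0 ->
       exists phi, is_osc_char ((v^T *m B *m v) 0 0) phi.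

Lemma line_0 : 0 \in line_set n v.
Proof. by apply/imsetP; exists 0; rewrite ?mul0mx. Qed.
Lemma line_D x y : x \in line_set n v -> y \in line_set n v -> x + y \in line_set n v.
Proof.
move=> /imsetP[z _ ->] /imsetP[z' _ ->]; apply/imsetP; exists (z + z') => //.
by rewrite mulmxDl.
Qed.
Lemma line_Z a x : x \in line_set n v -> a *: x \in line_set n v.
Proof.
by move=> /imsetP[z _ ->]; apply/imsetP; exists (a *: z); rewrite ?scalemxAl.
Qed.
Lemma line_tform z x : tform J B x (z *m v) = \tr (x^T *m J *m z *m (v *m B)).
Proof. by rewrite /tform !mulmxA. Qed.
Lemma line_iso x y : x \in line_set n v -> y \in line_set n v -> tform J B x y = 0.
Proof.
move=> /imsetP[z _ ->] /imsetP[z' _ ->]; rewrite line_tform trmx_mul.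
by rewrite mxtrace_mulC !mulmxA vBv !mul0mx mxtrace0.
Qed.

Lemma line_om (g : Sp) : om g *m iso_avg R (line_set n v) = iso_avg R (line_set n v) *m om g.
Proof.
rewrite /iso_avg -scalemxAl -scalemxAr mulmx_suml mulmx_sumr; congr (_ *: _).
have inj : injective (mulmx (val g) : 'M_(n + n, k) -> 'M_(n + n, k)).
  exact: (can_inj (mulKmx (isometry_unit g))).
rewrite [RHS](reindex_inj inj) /=; apply: eq_big => [x|x _]; last by case: oscR => _ ->.
apply/imsetP/imsetP=> [[z _ ->]|[z _ E]].
  by exists (val g *m z); rewrite ?mulmxA.
exists (invmx (val g) *m z); rewrite // -mulmxA -E mulKmx ?isometry_unit //.
Qed.

Lemma hyperbolic_ex : exists u : 'rV[F]_k, v *m B *m u^T = 1%:M.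
Proof.
have [_ Bu] := nB; have : v *m B != 0.
  by apply: contraNneq v0 => E; rewrite -(mulmxK Bu v) E mul0mx.
case/mx_neq0P=> i [j]; rewrite [i]ord1 => vBj.
exists (((v *m B) 0 j)^-1 *: delta_mx 0 j); rewrite [(_ *: _)^T]linearZ /= trmx_delta.
rewrite -scalemxAr -colE (_ : col j (v *m B) = ((v *m B) 0 j)%:M).
  by rewrite scale_scalar_mx mulVf.
by rewrite [LHS]mx11_scalar mxE.
Qed.

(** The vectors fixed by W (x) v carry a system for v^perp / v, realised on
    the orthogonal complement C of a hyperbolic plane containing v. *)
Lemma line_reduction : exists l r (b : 'M_(r, d)) (c : 'M_(d, r)) (C : 'M[F]_(k, l)),
  [/\ (l < k)%N, b *m c = 1%:M, c *m b = iso_avg R (line_set n v),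
      nondeg_sym (C^T *m B *m C)
    & heis_sys chi J (C^T *m B *m C) (fun x => b *m R (x *m C^T) *m c)].
Proof.
have [u vu] := hyperbolic_ex.
have uv : u *m B *m v^T = 1%:M.
  by apply: trmx_inj; rewrite !trmx_mul trmxK Bs trmx1 mulmxA.
pose D := row_mx v^T u^T.
have DE : D^T *m B *m D = block_mx 0 1%:M 1%:M (u *m B *m u^T).
  by rewrite tr_row_mx mul_col_mx mul_col_row !trmxK vBv vu uv.
have uD : D^T *m B *m D \in unitmx.
  rewrite DE; set q := u *m B *m u^T.
  have : block_mx 0 1%:M 1%:M q *m block_mx (- q) 1%:M 1%:M 0 = 1%:M.
    rewrite mulmx_block !(mul0mx, mulmx0, mul1mx, mulmx1, add0r, addr0).
    by rewrite addNr scalar_mx_block.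
  by case/mulmx1_unit.
have [l [C [Q [lk PQ QP nC PE]]]] := split_form nB uD.
have DBC : D^T *m B *m C = 0.
  by move: PE; rewrite tr_row_mx mul_col_mx mul_col_row => /eq_block_mx[].
have vBC : v *m B *m C = 0.
  move: DBC; rewrite tr_row_mx trmxK !mul_col_mx -[0]vsubmxK => /eq_col_mx[-> _].
  by apply/matrixP=> i j; rewrite !mxE.
have ee := iso_avg_idem chi_nt hR line_0 line_D line_Z line_iso.
have [r [b [c [bc cb _]]]] := idem_split ee.
exists l, r, b, c, C; split => //; first by rewrite -lk.
apply: (compress_sys chi_nt two_neq0 Jalt nB hR line_0 line_D line_Z line_iso) bc cb.
- by move=> x y; rewrite mulmxDl.
- move=> x y; rewrite /tform trmx_mul trmxK -!mulmxA mxtrace_mulC !mulmxA //.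
- move=> x y /imsetP[z _ ->]; rewrite line_tform trmx_mul trmxK.
  by rewrite mxtrace_mulC !mulmxA vBC !mul0mx mxtrace0.
move=> x hx; pose y := x *m Q^T.
have xE : x = y *m (row_mx D C)^T by rewrite -mulmxA -trmx_mul PQ trmx1 mulmx1.
pose y1 := lsubmx y; pose x' := rsubmx y.
have {}xE : x = lsubmx y1 *m v + rsubmx y1 *m u + x' *m C^T.
  rewrite xE -[y]hsubmxK tr_row_mx mul_row_col -/y1 -/x' -{1}[y1]hsubmxK.
  by rewrite tr_row_mx !trmxK mul_row_col.
set y2 := rsubmx y1 in xE.
suff y20 : y2 = 0.
  exists x'; rewrite xE y20 mul0mx addr0 addrK; apply/imsetP.
  by exists (lsubmx y1).
have [_ Ju] := Jalt.
have E (z : 'cV[F]_(n + n)) : y2^T *m J *m z = 0.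
  have := hx (z *m v) (imset_f _ _); rewrite line_tform xE.
  have tl q (a : 'M_(n + n, q)) (X : 'M_(q, k)) :
      \tr ((a *m X)^T *m J *m z *m (v *m B)) = \tr (v *m B *m X^T *m a^T *m J *m z).
    by rewrite trmx_mul mxtrace_mulC !mulmxA.
  rewrite [(_ + _ + _)^T]linearD /= [(_ + _)^T]linearD /= !mulmxDl !mxtraceD.
  rewrite !tl trmxK vBv vBC vu !mul0mx mul1mx mxtrace0 add0r addr0 => h.
  by apply/matrixP=> i j; rewrite !ord1 -[LHS]trace_mx11 h ?inE ?mxE.
have y2J : y2^T *m J = 0.
  apply/matrixP=> i j; have /matrixP/(_ i 0) := E (delta_mx j 0).
  by rewrite -colE [LHS]mxE => ->; rewrite !mxE.
by apply: trmx_inj; rewrite -[LHS](mulmxK Ju) y2J mul0mx trmx0.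
Qed.

(** By line_reduction the symplectic group acts on the range of that
    projector through an oscillator representation of a smaller form, a
    product of fewer than k oscillator characters. *)
Lemma line_kill s :
    (forall l phi, (l < k)%N -> is_osc_product l phi -> s \notin irr_constt phi) ->
  isotypic_proj om s *m iso_avg R (line_set n v) = 0.
Proof.
move=> h; have [l [r [b [c [C [lk bc cb nC hC]]]]]] := line_reduction.
have comm x : x \in [set: Sp] -> om x *m iso_avg R (line_set n v)
    = iso_avg R (line_set n v) *m om x by move=> _; apply: line_om.
apply: (@isotypic_kill _ [set: Sp]%G _ _ om b c _ bc cb comm); apply: (h l) => //.
apply: (osc_product_of_sys nC) => [w|].
  have -> : w^T *m (C^T *m B *m C) *m w = (C *m w)^T *m B *m (C *m w).
    by rewrite trmx_mul !mulmxA.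
  exact: av.
split; first exact: hC.
move=> g w; apply: compress_intertwine; rewrite ?inE //.
by case: oscR => _ ->; rewrite mulmxA.
Qed.

End Line.

End Products.

(** * Representations of the Heisenberg group as systems of operators *)

Section HeisRep.
Variables (F : finFieldType) (N : nat) (A : 'M[F]_N) (chi : 'CF([set: F])).
Hypothesis chi_nt : nontrivial_char chi.
Variables (d : nat) (rho : mx_representation algC [set: heis A] d).
Hypothesis hrho : is_heis_rep chi rho.

Lemma bform0l (u : 'cV[F]_N) : bform A 0 u = 0.
Proof. by rewrite /bform trmx0 !mul0mx mxE. Qed.

Lemma heis_mulE (u u' : 'cV[F]_N) t t' :
  (Heis A u t * Heis A u' t')%g = Heis A (u + u') (t + t' + 2^-1 * bform A u u').
Proof. by []. Qed.

Lemma heis_repE u t : rho (Heis A u t) = chi t *: rho (Heis A u 0).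
Proof.
have -> : Heis A u t = (Heis A 0 t * Heis A u 0)%g.
  by rewrite heis_mulE add0r addr0 bform0l mulr0 addr0.
by rewrite repr_mxM ?inE // hrho.2 mul_scalar_mx.
Qed.

Lemma heis_repM u u' : rho (Heis A u 0) *m rho (Heis A u' 0)
  = chi (2^-1 * bform A u u') *: rho (Heis A (u + u') 0).
Proof. by rewrite -repr_mxM ?inE // heis_mulE addr0 add0r [LHS]heis_repE. Qed.

(** Burnside's theorem provides the spanning condition. *)
Lemma heis_rep_sys m k (J : 'M[F]_m) (B : 'M[F]_k) (v : 'M[F]_(m, k) -> 'cV[F]_N) v' :
  v 0 = 0 -> (forall x y, v (x + y) = v x + v y) -> cancel v' v ->
  (forall x y, bform A (v x) (v y) = tform J B x y) ->
  heis_sys chi J B (fun w => rho (Heis A (v w) 0)).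
Proof.
move=> v0 vD vK vf; have abs : mx_absolutely_irreducible rho.
  by apply: groupC hrho.1.
case/mx_abs_irrP: (abs) => d0 [a_ aE]; split=> //.
- by rewrite v0; apply: repr_mx1.
- by move=> w w'; rewrite heis_repM vf vD.
move=> X; rewrite (aE X); apply: rspan_sum => -[u t] _; apply: rspanZ.
rewrite heis_repE; apply: rspanZ; rewrite -[u]vK.
exact: (rspan_id (fun w => rho (Heis A (v w) 0)) (v' u)).
Qed.

End HeisRep.

Section Vec.
Variables (F : finFieldType) (m k : nat).

Definition vec (w : 'M[F]_(m, k)) : 'cV[F]_(m * k) :=
  \col_i w (mxtens_unindex i).1 (mxtens_unindex i).2.
Definition unvec (u : 'cV[F]_(m * k)) : 'M[F]_(m, k) :=
  \matrix_(i, j) u (mxtens_index (i, j)) 0.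

Lemma unvecK : cancel unvec vec.
Proof.
move=> u; apply/colP=> i; rewrite !mxE -[in RHS](mxtens_unindexK i).
by case: (mxtens_unindex i).
Qed.

Lemma vecE w i j : vec w (mxtens_index (i, j)) 0 = w i j.
Proof. by rewrite mxE mxtens_indexK. Qed.

Lemma vecD x y : vec (x + y) = vec x + vec y.
Proof. by apply/colP=> i; rewrite !mxE. Qed.

Lemma vec0 : vec 0 = 0.
Proof. by apply/colP=> i; rewrite !mxE. Qed.

Lemma sum_mxtens (G : 'I_(m * k) -> F) :
  \sum_l G l = \sum_i \sum_j G (mxtens_index (i, j)).
Proof.
rewrite pair_big /= (reindex (fun p : 'I_m * 'I_k => mxtens_index p)) /=.
  by apply: eq_bigr => -[i j].
by exists (@mxtens_unindex m k) => x _; rewrite ?mxtens_indexK ?mxtens_unindexK.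
Qed.

Lemma tens_vec (g : 'M[F]_m) (h : 'M[F]_k) w : tensmx g h *m vec w = vec (g *m w *m h^T).
Proof.
apply/colP=> l; case: (mxtens_indexP l) => i j; rewrite vecE mxE sum_mxtens.
rewrite mxE exchange_big /=; apply: eq_bigr => j' _; rewrite mxE mulr_suml.
by apply: eq_bigr => i' _; rewrite tensmxE vecE !mxE mulrAC.
Qed.

Lemma bform_tens (J : 'M[F]_m) (B : 'M[F]_k) w w' : B^T = B ->
  bform (tensmx J B) (vec w) (vec w') = tform J B w w'.
Proof.
move=> Bs; rewrite /bform -mulmxA tens_vec mxE sum_mxtens Bs /tform -!mulmxA.
rewrite /mxtrace exchange_big; apply: eq_bigr => j _; rewrite mxE.
by apply: eq_bigr => i _; rewrite vecE [(vec w)^T _ _]mxE vecE [w^T _ _]mxE.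
Qed.
End Vec.

Section Components.
Variables (F : finFieldType) (chi : 'CF([set: F])) (n : nat).
Hypothesis chi_nt : nontrivial_char chi.
Hypothesis two_neq0 : (2 : F) != 0.
Local Notation J := (symplJ F n).
Local Notation Sp := (form_isometry J).
Local Notation Jalt := (symplJ_alt F n).

Lemma tform_scalar m (K : 'M[F]_m) (a : F) (w w' : 'cV[F]_m) :
  tform K a%:M w w' = a * (w^T *m K *m w') 0 0.
Proof. by rewrite /tform mul_mx_scalar mxtraceZ trace_mx11. Qed.

Lemma chi_scaled (a : F) : a != 0 ->
  exists2 chi1 : 'CF([set: F]), nontrivial_char chi1 & forall b, chi1 b = chi (a * b).
Proof.
move=> a0.
have h : mx_repr [set: F] (fun b : F => (chi (a * b))%:M : 'M[algC]_1).
  split=> [|x y _ _]; first by rewrite (mulr0 a) chi_0.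
  by rewrite -scalar_mxM -chiD // -mulrDr.
exists (cfRepr (MxRepresentation h)).
  split; first by rewrite qualifE /= cfRepr_char cfRepr1 eqxx.
  have [b hb] := chi_nontriv chi_nt.
  apply: contraNneq hb => /cfunP/(_ (b / a)).
  by rewrite cfReprE ?inE //= mxtrace_scalar mulr1n mulrC divfK // cfun1E inE => ->.
by move=> b; rewrite cfReprE ?inE //= mxtrace_scalar.
Qed.

Lemma oscillator_component_char (i : Iirr [set: Sp]) : oscillator_component i ->
  exists a phi, is_osc_char chi a phi /\ i \in irr_constt phi.
Proof.
move=> [chi1 [d [rho [om [nt1 [hr ho] hi]]]]].
have [a a0 ha] := chi_scale_ex nt1 chi_nt.
exists a, (cfRepr om); split => //; split => //.
exists d, (fun w => rho (Heis J w 0)), om; split => //; split; last first.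
  by move=> g w; rewrite -ho -[RHS]mulmxA -repr_mxM ?inE // mulVg repr_mx1 mulmx1.
have bt (x y : 'cV[F]_(n + n)) : bform J (id x) (id y) = tform J (1%:M : 'M_1) x y.
  by rewrite tform_scalar mul1r.
have [d0 R0 RM Rf] :=
  heis_rep_sys hr (v := id) (v' := id) erefl (fun _ _ => erefl) (fun=> erefl) bt.
split => // w w'; rewrite RM ha !tform_scalar mul1r.
by congr (chi _ *: _); ring.
Qed.

Lemma osc_char_component a phi (i : Iirr [set: Sp]) : is_osc_char chi a phi -> i \in irr_constt phi ->
  oscillator_component i.
Proof.
move=> [a0 [d [R [om [[hR oR] ->]]]]] hi; have [chi1 nt1 hchi1] := chi_scaled a0.
have [d0 R0 RM Rf] := hR.
have h : mx_repr [set: heis J] (fun x : heis J => let: Heis w t := x in chi1 t *: R w).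
  split=> [|[w t] [w' t'] _ _].
    by rewrite -[LHS]/(chi1 0 *: R 0) chi_0 // scale1r R0.
  rewrite heis_mulE -scalemxAl -scalemxAr RM !scalerA.
  rewrite !hchi1 -!chiD // !mulrDr; congr (chi (_ + _) *: _).
  by rewrite tform_scalar /bform; ring.
exists chi1, d, (MxRepresentation h), om; split => //; split; last first.
  move=> g w t; rewrite /= -scalemxAr oR -scalemxAl -mulmxA -repr_mxM ?inE //.
  by rewrite mulgV repr_mx1 mulmx1.
split; last by move=> t /=; rewrite R0 scalemx1.
apply: mx_abs_irrW; rewrite /mx_absolutely_irreducible d0 /= -sub1mx.
apply/row_subP=> l; rewrite -[row _ _]vec_mxK; apply/envelop_mxP.
have [a' ->] : rspan (MxRepresentation h) (vec_mx (row l 1%:M)).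
  have [c ->] := Rf (vec_mx (row l 1%:M)); apply: rspan_sum => w _; apply: rspanZ.
  by have := rspan_id (MxRepresentation h) (Heis J w 0); rewrite /= chi_0 // scale1r.
by exists a'; apply: eq_bigl => x; rewrite inE.
Qed.

End Components.

(** * The dual pair, and oscillator representations of the smaller group *)

Lemma pull_repr_subproof (gT hT : finGroupType) d (f : gT -> hT)
    (rH : mx_representation algC [set: hT] d) :
  f 1%g = 1%g -> (forall x y, f (x * y)%g = (f x * f y)%g) ->
  mx_repr [set: gT] (fun x => rH (f x)).
Proof.
move=> f1 fM; split=> [|x y _ _]; first by rewrite f1 repr_mx1.
by rewrite fM repr_mxM ?inE.
Qed.
Definition pull_repr (gT hT : finGroupType) d (f : gT -> hT)
    (rH : mx_representation algC [set: hT] d) f1 fM :=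
  MxRepresentation (@pull_repr_subproof gT hT d f rH f1 fM).

Section DualPair.
Variables (F : finFieldType) (chi : 'CF([set: F])) (n : nat).
Hypothesis chi_nt : nontrivial_char chi.
Hypothesis two_neq0 : (2 : F) != 0.
Local Notation J := (symplJ F n).
Local Notation Sp := (form_isometry J).
Local Notation Jalt := (symplJ_alt F n).
Variables (k : nat) (B : 'M[F]_k).
Hypothesis nB : nondeg_sym B.
Local Notation O := (form_isometry B).
Let Bs : B^T = B. Proof. by case: nB. Qed.
Variables (d : nat).
Variable rho : mx_representation algC [set: heis (tensmx J B)] d.
Variable om : mx_representation algC [set: form_isometry (tensmx J B)] d.
Hypothesis osc : is_oscillator chi rho om.

Definition pair_op (w : 'M[F]_(n + n, k)) : 'M[algC]_d := rho (Heis (tensmx J B) (vec w) 0).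

Lemma pair_sys : heis_sys chi J B pair_op.
Proof.
case: osc => hr _; apply: (heis_rep_sys hr (v' := @unvec F _ _)).
- exact: vec0.
- exact: vecD.
- exact: unvecK.
by move=> x y; apply: bform_tens.
Qed.

Lemma pair_cov (u : form_isometry (tensmx J B)) w w' : val u *m vec w = vec w' ->
  om u *m pair_op w = pair_op w' *m om u.
Proof.
move=> E; case: osc => _ h; rewrite /pair_op -E -h -[RHS]mulmxA -repr_mxM ?inE //.
by rewrite mulVg repr_mx1 mulmx1.
Qed.

Definition left_iso (g : Sp) : form_isometry (tensmx J B) := tens_isometry g 1%g.
Definition right_iso (h : O) : form_isometry (tensmx J B) := tens_isometry 1%g h.

Lemma left_iso1 : left_iso 1%g = 1%g.
Proof. by apply: val_inj; rewrite /= tensmx11. Qed.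
Lemma left_isoM x y : left_iso (x * y)%g = (left_iso x * left_iso y)%g.
Proof. by apply: val_inj; rewrite /= tensmx_mul mul1mx. Qed.
Lemma right_iso1 : right_iso 1%g = 1%g.
Proof. by apply: val_inj; rewrite /= tensmx11. Qed.
Lemma right_isoM x y : right_iso (x * y)%g = (right_iso x * right_iso y)%g.
Proof. by apply: val_inj; rewrite /= tensmx_mul mul1mx. Qed.

Definition omSp := pull_repr om left_iso1 left_isoM.
Definition omO := pull_repr om right_iso1 right_isoM.

Lemma pair_osc : osc_sys chi B pair_op omSp.
Proof.
split; first exact: pair_sys.
by move=> g w; apply: pair_cov; rewrite /= tens_vec trmx1 mulmx1.
Qed.

Lemma omO_pair (h : O) w : omO h *m pair_op w = pair_op (w *m (val h)^T) *m omO h.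
Proof. by apply: pair_cov; rewrite /= tens_vec mul1mx. Qed.

Lemma omSp_omO g h : omSp g *m omO h = om (tens_isometry g h).
Proof.
rewrite /= -repr_mxM ?inE //; congr (om _); apply: val_inj.
by rewrite /= tensmx_mul mulmx1 mul1mx.
Qed.

Lemma omO_omSp g h : omO h *m omSp g = om (tens_isometry g h).
Proof.
rewrite /= -repr_mxM ?inE //; congr (om _); apply: val_inj.
by rewrite /= tensmx_mul mulmx1 mul1mx.
Qed.

Lemma pair_comm g h : omSp g *m omO h = omO h *m omSp g.
Proof. by rewrite omSp_omO omO_omSp. Qed.

Section Extract.
Variables (v : 'cV[F]_k) (a : F).
Hypotheses (a0 : a != 0) (vBvE : v^T *m B *m v = a%:M).

Let E : 'M[F]_k := a^-1 *: (v *m v^T *m B).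

Let Ev : E *m v = v.
Proof.
rewrite /E -scalemxAl -!mulmxA (mulmxA v^T) vBvE mul_mx_scalar scalerA.
by rewrite mulVf // scale1r.
Qed.

Let EE : E *m E = E.
Proof. by rewrite {2}/E -scalemxAr !mulmxA Ev. Qed.

Let BEs : E^T *m B = B *m E.
Proof.
by rewrite /E [(_ *: _)^T]linearZ /= -scalemxAl -scalemxAr !trmx_mul trmxK Bs !mulmxA.
Qed.

(** E is the orthogonal projection of V onto the line of v: the matrix acts
    as g on W (x) v and trivially on its orthogonal. *)
Lemma axis_subproof (g : Sp) :
  is_isometry (tensmx J B) (1%:M + tensmx (val g - 1%:M) E).
Proof.
have uJB : tensmx J B \in unitmx.
  have : tensmx J B *m tensmx (invmx J) (invmx B) = 1%:M.
    by rewrite tensmx_mul !mulmxV ?Jalt.2 ?nB.2 // tensmx11.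
  by case/mulmx1_unit.
apply: isometry_of => //; set b := val g - 1%:M.
have gb : val g = b + 1%:M by rewrite /b subrK.
clearbody b.
have key : b^T *m J + J *m b + b^T *m J *m b = 0.
  have := isometryP g; rewrite gb [(b + _)^T]linearD /= trmx1.
  rewrite !mulmxDl !mulmxDr !mul1mx !mulmx1 => /eqP; rewrite -subr_eq0.
  by rewrite !addrA addrK => /eqP E0; rewrite addrC addrA E0.
have tDl (X Y : 'M[F]_(n + n)) (Z : 'M[F]_k) : tensmx (X + Y) Z = tensmx X Z + tensmx Y Z.
  by apply/matrixP=> s t; rewrite !mxE mulrDl.
rewrite [(1%:M + _)^T]linearD /= trmx1 trmx_tens mulmxDl mul1mx !mulmxDr !mulmx1.
rewrite !mulmxDl !tensmx_mul BEs -[B *m E *m E]mulmxA EE -!addrA.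
rewrite -[RHS]addr0; congr (_ + _).
by rewrite !addrA -!tDl key tens0mx.
Qed.

Definition axis_iso (g : Sp) : form_isometry (tensmx J B) := Isometry (axis_subproof g).

Lemma axis_iso1 : axis_iso 1%g = 1%g.
Proof. by apply: val_inj; rewrite /= subrr tens0mx addr0. Qed.
Lemma axis_isoM x y : axis_iso (x * y)%g = (axis_iso x * axis_iso y)%g.
Proof.
apply: val_inj; rewrite isometry_valM /= -!/(val _).
rewrite mulmxDl mul1mx mulmxDr mulmx1 tensmx_mul EE -addrA; congr (_ + _).
rewrite -[LHS]/(tensmx (val x *m val y - 1%:M) E).
have tDl (X Y : 'M[F]_(n + n)) (Z : 'M[F]_k) : tensmx (X + Y) Z = tensmx X Z + tensmx Y Z.
  by apply/matrixP=> s t; rewrite !mxE mulrDl.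
rewrite -!tDl; congr (tensmx _ _); rewrite mulmxBl mulmxBr mulmx1 mul1mx.
rewrite -[LHS]/(isometry_val x *m isometry_val y - 1%:M).
move: (isometry_val x *m isometry_val y) (isometry_val x) (isometry_val y) => X Y Z.
by apply/matrixP=> s t; rewrite !mxE; ring.
Qed.

Definition omAxis := pull_repr om axis_iso1 axis_isoM.

Lemma axis_cov g w : omAxis g *m pair_op w
  = pair_op (w + (val g - 1%:M) *m w *m E^T) *m omAxis g.
Proof. by apply: pair_cov; rewrite /= mulmxDl mul1mx tens_vec vecD. Qed.

(** W (x) V is the orthogonal sum of W (x) v and of W (x) v^perp. The
    vectors fixed by a Lagrangian N of the second summand carry a system
    for the first, on which the symplectic group acts through axis_iso. *)
Lemma osc_char_of_anisotropic : exists phi : 'CF([set: Sp]), is_osc_char chi a phi.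
Proof.
have uD : v^T *m B *m v \in unitmx by rewrite vBvE unitmxE det_scalar1 unitfE.
have [l [C [Q [lk PQ QP nC PE]]]] := split_form nB uD.
have vBC : v^T *m B *m C = 0.
  by move: PE; rewrite tr_row_mx mul_col_mx mul_col_row => /eq_block_mx[].
have CBv : C^T *m B *m v = 0.
  by move: PE; rewrite tr_row_mx mul_col_mx mul_col_row => /eq_block_mx[].
pose up (z : 'M[F]_(n, l)) : 'M[F]_(n + n, k) := col_mx z 0 *m C^T.
pose N : {set 'M[F]_(n + n, k)} := [set up z | z : 'M[F]_(n, l)].
have upD z z' : up z + up z' = up (z + z').
  by rewrite /up -mulmxDl add_col_mx addr0.
have N0 : 0 \in N by apply/imsetP; exists 0; rewrite // /up col_mx0 mul0mx.
have ND x y : x \in N -> y \in N -> x + y \in N.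
  by move=> /imsetP[z _ ->] /imsetP[z' _ ->]; rewrite upD; apply: imset_f.
have NZ c x : x \in N -> c *: x \in N.
  move=> /imsetP[z _ ->]; apply/imsetP; exists (c *: z) => //.
  by rewrite /up scalemxAl scale_col_mx scaler0.
have tCC x y : tform J B (x *m C^T) (y *m C^T) = tform J (C^T *m B *m C) x y.
  by rewrite /tform trmx_mul trmxK -!mulmxA mxtrace_mulC !mulmxA.
have tvC (x : 'cV_(n + n)) y : tform J B (x *m v^T) (y *m C^T) = 0.
  rewrite /tform trmx_mul trmxK -!mulmxA mxtrace_mulC -!mulmxA (mulmxA C^T) CBv.
  by rewrite !mulmx0 mxtrace0.
have Niso x y : x \in N -> y \in N -> tform J B x y = 0.
  move=> /imsetP[z _ ->] /imsetP[z' _ ->]; rewrite tCC tform_symplJ.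
  by rewrite trmx0 mulmx0 !mul0mx mxtrace0 subrr.
have hR := pair_sys.
have ee := iso_avg_idem chi_nt hR N0 ND NZ Niso.
have [r [b [c [bc cb _]]]] := idem_split ee.
pose i (y : 'cV[F]_(n + n)) : 'M[F]_(n + n, k) := y *m v^T.
have iD x y : i (x + y) = i x + i y by rewrite /i mulmxDl.
have if_ x y : tform J B (i x) (i y) = tform J (a%:M : 'M_1) x y.
  by rewrite /i -vBvE /tform trmx_mul trmxK -!mulmxA mxtrace_mulC !mulmxA.
have iN x y : y \in N -> tform J B (i x) y = 0.
  by case/imsetP=> z _ ->; apply: tvC.
have iperp x : (forall y, y \in N -> tform J B x y = 0) -> exists x', x - i x' \in N.
  move=> hx; pose y := x *m Q^T.
  have xE : x = lsubmx y *m v^T + rsubmx y *m C^T.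
    by rewrite -mul_row_col hsubmxK -tr_row_mx -mulmxA -trmx_mul PQ trmx1 mulmx1.
  exists (lsubmx y); set x' := rsubmx y in xE.
  have b0 : dsubmx x' = 0.
    have [_ uC] := nC; set H := C^T *m B *m C in uC.
    suff : H *m (dsubmx x')^T = 0.
      move=> E0; apply: trmx_inj; rewrite -[LHS](mulKmx uC) E0 mulmx0 trmx0 //.
    apply/matrixP=> s t; rewrite [RHS]mxE.
    have := hx (up (delta_mx t s)) (imset_f _ isT).
    rewrite {1}xE tformDl tvC add0r tCC -/H -{1}[x']vsubmxK tform_symplJ mulmx0 mul0mx.
    rewrite mxtrace0 sub0r => /eqP; rewrite oppr_eq0 => /eqP <-.
    by rewrite -[X in _ = \tr X]mulmxA mxtrace_mulC -[X in _ = \tr X]mulmxA mxtrace_mul_delta.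
  apply/imsetP; exists (usubmx x') => //.
  by rewrite {1}xE /i addrC addKr -{1}[x']vsubmxK b0.
have sys := compress_sys chi_nt two_neq0 Jalt nB hR N0 ND NZ Niso iD if_ iN iperp bc cb.
have comm x : x \in [set: Sp] ->
    omAxis x *m iso_avg pair_op N = iso_avg pair_op N *m omAxis x.
  move=> _; rewrite /iso_avg -scalemxAl -scalemxAr mulmx_suml mulmx_sumr.
  congr (_ *: _); apply: eq_bigr => y /imsetP[z _ ->]; rewrite axis_cov.
  rewrite [up z as X in _ *m X *m E^T]/up -(mulmxA _ (col_mx z 0 *m C^T)).
  rewrite -[col_mx z 0 *m C^T *m E^T]mulmxA -trmx_mul (_ : E *m C = 0) ?trmx0 ?mulmx0 ?addr0 //.
  by rewrite /E -scalemxAl -!mulmxA (mulmxA v^T) vBC mulmx0 scaler0.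
exists (cfRepr (@compress_repr _ [set: Sp]%G _ _ omAxis b c _ bc cb comm)); split => //.
exists r, (fun x => b *m pair_op (i x) *m c), (@compress_repr _ [set: Sp]%G _ _ omAxis b c _ bc cb comm).
split => //; split => // g w.
apply: compress_intertwine; rewrite ?inE // axis_cov; congr (pair_op _ *m _).
rewrite /i -[_ *m E^T]mulmxA -[w *m v^T *m E^T]mulmxA -trmx_mul Ev mulmxA.
by rewrite -mulmxDl mulmxBl mul1mx addrC subrK.
Qed.
End Extract.
End DualPair.

(** * Tensor rank and the eta correspondence *)

Section Constt.
Variables (gT : finGroupType) (G : {group gT}).

Lemma irr_constt_charD (phi psi : 'CF(G)) s : phi \is a character -> psi \is a character ->
  s \in irr_constt phi -> s \in irr_constt (phi + psi).
Proof.
move=> cphi cpsi; rewrite !irr_consttE cfdotDl => h.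
by rewrite paddr_eq0 ?(negPf h) // natr_ge0 // Cnat_cfdot_char_irr.
Qed.

Lemma irr_constt_sum_mul (phi psi : 'CF(G)) s : s \in irr_constt (phi * psi) ->
  exists i j, [/\ i \in irr_constt phi, j \in irr_constt psi
    & s \in irr_constt ('chi_i * 'chi_j)].
Proof.
rewrite irr_consttE {1}[phi]cfun_sum_constt {1}[psi]cfun_sum_constt.
rewrite mulr_suml cfdot_suml => h.
have [/existsP[i /existsP[j /and3P[h1 h2 h3]]]|] := boolP [exists i, [exists j,
   [&& i \in irr_constt phi, j \in irr_constt psi & s \in irr_constt ('chi_i * 'chi_j)]]].
  by exists i, j.
rewrite negb_exists => /forallP hn; case/eqP: h; apply: big1 => i hi.
rewrite mulr_sumr cfdot_suml big1 // => j hj.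
rewrite -scalerAl -scalerAr scalerA cfdotZl.
have := hn i; rewrite negb_exists => /forallP/(_ j).
by rewrite hi hj /= irr_consttE negbK => /eqP ->; rewrite mulr0.
Qed.
End Constt.

Section TensorRank.
Variables (F : finFieldType) (chi : 'CF([set: F])) (n : nat).
Hypothesis chi_nt : nontrivial_char chi.
Local Notation J := (symplJ F n).
Local Notation Sp := (form_isometry J).

Lemma osc_char_char a (phi : 'CF([set: Sp])) : is_osc_char chi a phi -> phi \is a character.
Proof. by case=> _ [d [R [om [_ ->]]]]; apply: cfRepr_char. Qed.

(** Replacing each factor by an oscillator character that contains it only
    enlarges the product. *)
Lemma tensor_rank_osc (s : Iirr [set: Sp]) j : tensor_rank_le s j ->
  exists l phi, [/\ (l <= j)%N, is_osc_product chi l phi & s \in irr_constt phi].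
Proof.
case=> t [tj ht hs]; suff [u [su hu [psi cpsi E]]] : exists u : seq ('CF([set: Sp])),
    [/\ size u = size t, forall psi, psi \in u -> exists a, is_osc_char chi a psi
     & exists2 psi, psi \is a character & \prod_(phi <- u) phi = \prod_(i <- t) 'chi_i + psi].
  exists (size u), (\prod_(phi <- u) phi); split; first by rewrite su.
    by exists u.
  rewrite E; apply: irr_constt_charD => //.
  by apply: rpred_prod => i _; apply: irr_char.
elim: t ht {tj hs} => [|i t IH] ht.
  by exists [::]; split => //; exists 0; rewrite ?rpred0 // !big_nil addr0.
have [|u [su hu [psi cpsi E]]] := IH; first by move=> x xt; apply: ht; rewrite inE xt orbT.
have [a [phi [hphi hi]]] := oscillator_component_char chi_nt (ht i (mem_head _ _)).
exists (phi :: u); split; first by rewrite /= su.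
  by move=> x; rewrite inE => /predU1P[->|/hu//]; exists a.
have cphi := osc_char_char hphi.
case/(constt_charP _ cphi): hi => phi' cphi' Ephi.
have cu : \prod_(phi <- u) phi \is a character.
  by rewrite big_seq; apply: rpred_prod => x /hu[b]; apply: osc_char_char.
exists ('chi_i * psi + phi' * \prod_(phi <- u) phi).
  by rewrite rpredD // rpredM // irr_char.
by rewrite !big_cons {1}Ephi mulrDl {1}E mulrDr addrA.
Qed.

Lemma osc_tensor_rank (s : Iirr [set: Sp]) l j phi : (l <= j)%N ->
  is_osc_product chi l phi -> s \in irr_constt phi -> tensor_rank_le s j.
Proof.
move=> lj [u [su hu ->]] hs.
suff [t [st ht hts]] : exists t : seq (Iirr [set: Sp]), [/\ size t = size u,
    forall i, i \in t -> oscillator_component i & s \in irr_constt (\prod_(i <- t) 'chi_i)].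
  by exists t; rewrite st su.
elim: u s hu hs {su} => [|phi' u IH] s hu hs.
  by rewrite big_nil in hs; exists [::]; split => //; rewrite big_nil.
rewrite big_cons in hs; have [i [j' [hi hj hij]]] := irr_constt_sum_mul hs.
have [|t [st ht hts]] := IH _ _ hj; first by move=> x xu; apply: hu; rewrite inE xu orbT.
exists (i :: t); split; first by rewrite /= st.
  move=> x; rewrite inE => /predU1P[->|/ht//].
  have [a ha] := hu phi' (mem_head _ _); exact: (osc_char_component chi_nt ha).
have ct : \prod_(i <- t) 'chi_i \is a character.
  by apply: rpred_prod => x _; apply: irr_char.
case/(constt_charP _ ct): hts => psi cpsi E.
rewrite big_cons E mulrDr; apply: irr_constt_charD => //; by rewrite rpredM ?irr_char.
Qed.
End TensorRank.

Section OneForm.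
Variables (F : finFieldType) (chi chi0 : 'CF([set: F])) (n k : nat).
Hypotheses (chi_nt : nontrivial_char chi) (chi0_nt : nontrivial_char chi0).
Hypothesis two_neq0 : (2 : F) != 0.
Variable al : F.
Hypothesis al0 : al != 0.
Hypothesis chi_al : forall b, chi b = chi0 (al * b).
Hypotheses (k0 : (0 < k)%N) (kn : (k < n)%N).
Local Notation J := (symplJ F n).
Local Notation Sp := (form_isometry J).
Variable B : 'M[F]_k.
Hypothesis nB : nondeg_sym B.
Local Notation O := (form_isometry B).
Variables (d : nat) (rho : mx_representation algC [set: heis (tensmx J B)] d).
Variable om : mx_representation algC [set: form_isometry (tensmx J B)] d.
Hypothesis osc : is_oscillator chi rho om.
Variable Om : Iirr [set: O] -> 'CF([set: Sp]).
Hypothesis howe : howe_decomposition om Om.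
Local Notation omS := (omSp om).
Local Notation oscS := (pair_osc nB osc).

Lemma n_gt1 : (1 < n)%N. Proof. exact: leq_ltn_trans k0 kn. Qed.

Lemma howe_tr g h : \tr (omSp om g *m omO om h) = \sum_t Om t g * 'chi_t h.
Proof. by rewrite omSp_omO; case: howe => _ <-; rewrite cfReprE ?inE. Qed.

Lemma cfRepr_omSp : cfRepr omS = \sum_t 'chi_t 1%g *: Om t.
Proof.
apply/cfun_inP=> g Gg; rewrite cfReprE // sum_cfunE.
have := howe_tr g 1%g; rewrite repr_mx1 mulmx1 => ->.
by apply: eq_bigr => t _; rewrite cfunE mulrC.
Qed.

Lemma constt_Om t s : s \in irr_constt (Om t) -> s \in irr_constt (cfRepr omS).
Proof.
have [cO _] := howe; move=> hs; rewrite cfRepr_omSp (bigD1 t) //=.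
have cZ u : 'chi_u 1%g *: Om u \is a character.
  have /natrP[m ->] := Cnat_irr1 u.
  by rewrite scaler_nat rpredMn ?cO.
apply: irr_constt_charD => //; first by apply: rpred_sum => u _.
by rewrite irr_consttE cfdotZl mulf_neq0 ?irr1_neq0.
Qed.

Lemma constt_om s : s \in irr_constt (cfRepr omS) -> exists t, s \in irr_constt (Om t).
Proof.
rewrite cfRepr_omSp irr_consttE cfdot_suml => h.
have [/existsP[t ht]|] := boolP [exists t, s \in irr_constt (Om t)]; first by exists t.
rewrite negb_exists => /forallP hn; case/eqP: h; apply: big1 => t _.
by have := hn t; rewrite irr_consttE negbK cfdotZl => /eqP ->; rewrite mulr0.
Qed.

Lemma osc_char_avail (v : 'cV_k) : (v^T *m B *m v) 0 0 != 0 ->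
  exists phi : 'CF([set: Sp]), is_osc_char chi ((v^T *m B *m v) 0 0) phi.
Proof. move=> h; exact: (osc_char_of_anisotropic chi_nt two_neq0 nB osc h (mx11_scalar _)). Qed.

Lemma Urank_le_k s : s \in irr_constt (cfRepr omS) -> (Urank chi0 'chi_s <= k)%N.
Proof. exact: (Urank_osc chi_nt chi0_nt two_neq0 n_gt1 chi_al nB oscS). Qed.

(** A character of rank k occurs in Om t by tau_full_moment; a constituent
    where it occurs has U-rank k, so the choice defining eta succeeds. *)
Lemma eta_spec t : eta chi0 Om t \in irr_constt (Om t) /\ Urank chi0 'chi_(eta chi0 Om t) = k.
Proof.
have [x ax rx] := tau_full_moment chi_nt chi0_nt two_neq0 n_gt1 chi_al nB oscS
  (omO_pair osc) t howe_tr k0 (ltnW kn) al0.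
have [s hs as_] := siegel_appears_constt chi0_nt ax.
rewrite /eta; case: pickP => [s' /andP[h1 /eqP h2] //|/(_ s)].
rewrite hs /= => /negP; case; rewrite eqn_leq (Urank_le_k (constt_Om hs)) /=.
rewrite -{1}rx; have /Urank_leP := leqnn (Urank chi0 'chi_s); apply => //.
exact: moment_sym.
Qed.

(** The representation itself is a product of k oscillator characters,
    while a product of l of them has U-rank at most l. *)
Lemma tensor_rank_of_Urank s : s \in irr_constt (cfRepr omS) -> Urank chi0 'chi_s = k ->
  has_tensor_rank s k.
Proof.
move=> hs Uk; split.
  apply: (osc_tensor_rank chi_nt (leqnn k) _ hs).
  exact: (osc_product_of_sys chi_nt two_neq0 n_gt1 nB osc_char_avail oscS).
move=> j /(tensor_rank_osc chi_nt)[l [phi [lj [u [su hu phiE]] hl]]].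
apply: leq_trans lj; rewrite -Uk -su; move: hl; rewrite phiE.
have [B' [d' [R' [om' [nB' o' <-]]]]] := osc_product_sys chi_nt hu.
exact: (Urank_osc chi_nt chi0_nt two_neq0 n_gt1 chi_al nB' o').
Qed.

Lemma eta_tensor_rank t : has_tensor_rank (eta chi0 Om t) k.
Proof.
by have [h1 h2] := eta_spec t; apply: tensor_rank_of_Urank => //; apply: constt_Om h1.
Qed.

(** s lies in some Om t, as eta t does. Neither occurs in a product of
    fewer than k oscillator characters, so line_kill gives the hypothesis
    of eta_unique. *)
Lemma eta_exhausts s : s \in irr_constt (cfRepr omS) -> has_tensor_rank s k ->
  exists t, s = eta chi0 Om t.
Proof.
move=> hs hk; have [t ht] := constt_om hs; exists t.
have [ht' _] := eta_spec t; have hk' := eta_tensor_rank t.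
have kill u (v : 'rV[F]_k) : has_tensor_rank u k -> v != 0 -> v *m B *m v^T = 0 ->
    isotypic_proj omS u *m iso_avg (pair_op rho) (line_set n v) = 0.
  case=> _ hu v0 vv; apply: (line_kill chi_nt two_neq0 n_gt1 nB oscS v0 vv osc_char_avail).
  move=> l phi lk pl; apply/negP => /(osc_tensor_rank chi_nt (leqnn l) pl)/hu.
  by rewrite leqNgt lk.
apply: (eta_unique chi_nt two_neq0 nB oscS (omO_pair osc) (pair_comm om) howe_tr ht ht').
by move=> v v0 vv; split; apply: kill.
Qed.

Lemma cfRepr_congruent B' d' R' (om' : mx_representation algC [set: Sp] d') :
  nondeg_sym B' -> congruent B B' -> osc_sys chi B' R' om' -> cfRepr om' = cfRepr omS.
Proof.
move=> nB' [P uP PE] o'.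
have := osc_sys_congr (mulmxV uP) (mulVmx uP) oscS; rewrite PE => o.
exact: (osc_char_unique chi_nt two_neq0 nB' n_gt1 o' o).
Qed.

End OneForm.

(** A left inverse Y of x expresses Bp through Bm. *)
Lemma moment_congruent (F : finFieldType) n k (Bp Bm : 'M[F]_k) (x y : 'M[F]_(n, k)) :
  nondeg_sym Bp -> row_full x -> x *m Bp *m x^T = y *m Bm *m y^T -> congruent Bp Bm.
Proof.
move=> [_ up] /row_fullP[Y Yx] E; pose P0 := Y *m y.
have BpE : Bp = P0 *m Bm *m P0^T.
  have := congr1 (fun Z => Y *m Z *m Y^T) E; rewrite /P0 trmx_mul !mulmxA Yx mul1mx.
  by rewrite -!mulmxA -trmx_mul Yx trmx1 mulmx1.
clearbody P0; have uP0 : P0 \in unitmx by move: up; rewrite {1}BpE !unitmx_mul => /andP[/andP[]].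
exists (invmx P0)^T; first by rewrite unitmx_tr unitmx_inv.
rewrite trmxK BpE !mulmxA mulVmx // mul1mx -mulmxA -trmx_mul mulVmx //.
by rewrite trmx1 mulmx1.
Qed.

Theorem theorem0p4p13 (F : finFieldType) (p : nat)
  (charF : p \in [pchar F]) (p_odd : odd p)
  (n k : nat) (k_gt0 : (0 < k)%N) (lt_kn : (k < n)%N)
  (* the two inequivalent non-degenerate symmetric forms on F^k *)
  (Bp Bm : 'M[F]_k)
  (symBp : Bp^T = Bp) (ndBp : Bp \in unitmx)
  (symBm : Bm^T = Bm) (ndBm : Bm \in unitmx)
  (ineqB : ~ exists2 P : 'M[F]_k, P \in unitmx & P^T *m Bp *m P = Bm)
  (* chi defines the oscillator representations, chi0 the U-rank *)
  (chi chi0 : 'CF([set: F]))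
  (chi_nt : nontrivial_char chi) (chi0_nt : nontrivial_char chi0)
  (dp dm : nat)
  (rhop : mx_representation algC [set: heis (tensmx (symplJ F n) Bp)] dp)
  (rhom : mx_representation algC [set: heis (tensmx (symplJ F n) Bm)] dm)
  (omp : mx_representation algC [set: form_isometry (tensmx (symplJ F n) Bp)] dp)
  (omm : mx_representation algC [set: form_isometry (tensmx (symplJ F n) Bm)] dm)
  (osc_omp : is_oscillator chi rhop omp)
  (osc_omm : is_oscillator chi rhom omm)
  (Omegap : Iirr [set: form_isometry Bp] -> 'CF([set: form_isometry (symplJ F n)]))
  (Omegam : Iirr [set: form_isometry Bm] -> 'CF([set: form_isometry (symplJ F n)]))
  (howep : howe_decomposition omp Omegap)
  (howem : howe_decomposition omm Omegam) :
  let eta_p := [set eta chi0 Omegap tau | tau : Iirr [set: form_isometry Bp]] in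
  let eta_m := [set eta chi0 Omegam tau | tau : Iirr [set: form_isometry Bm]] in
  [disjoint eta_p & eta_m] /\
  forall sigma : Iirr [set: form_isometry (symplJ F n)],
    sigma \in eta_p :|: eta_m <-> has_tensor_rank sigma k.
Proof.
have two_neq0 : (2 : F) != 0.
  rewrite -(dvdn_pcharf charF); have /andP[pr_p _] := charF.
  apply: contraL p_odd => /(dvdn_leq (isT : (0 < 2)%N)) p2.
  by have /prime_gt1 := pr_p; case: p p2 {charF pr_p} => [|[|[|]]].
have np : nondeg_sym Bp by split.
have nm : nondeg_sym Bm by split.
have [al al0 chi_al] := chi_scale_ex chi_nt chi0_nt.
have n1 : (1 < n)%N := leq_ltn_trans k_gt0 lt_kn.
have oscp := pair_osc np osc_omp; have oscm := pair_osc nm osc_omm.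
move=> eta_p eta_m; split.
  rewrite disjoint_subset; apply/subsetP=> s /imsetP[t _ ->].
  rewrite inE; apply/negP=> /imsetP[t' _ Et].
  have [h1 h2] := eta_spec chi_nt chi0_nt two_neq0 al0 chi_al k_gt0 lt_kn np osc_omp howep t.
  have [h3 _] := eta_spec chi_nt chi0_nt two_neq0 al0 chi_al k_gt0 lt_kn nm osc_omm howem t'.
  have {}h1 := constt_Om howep h1.
  have {}h3 := constt_Om howem h3; rewrite -Et in h3.
  have [x [ax rx]] := Urank_max_moment chi_nt chi0_nt two_neq0 n1 chi_al np oscp k_gt0 h1 h2.
  have [y Exy] := appears_moment chi_nt chi0_nt two_neq0 n1 chi_al nm oscm h3
    (moment_sym al np x) ax.
  case: ineqB; apply: (moment_congruent np (rank_moment_full rx) (y := y)).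
  have a2 : al / 2 != 0 by rewrite mulf_neq0 ?invr_eq0.
  by have := congr1 ( *:%R (al / 2)^-1) Exy; rewrite /moment !scalerK.
move=> s; split.
  rewrite inE => /orP[] /imsetP[t _ ->].
    exact: (eta_tensor_rank chi_nt chi0_nt two_neq0 al0 chi_al k_gt0 lt_kn np osc_omp howep).
  exact: (eta_tensor_rank chi_nt chi0_nt two_neq0 al0 chi_al k_gt0 lt_kn nm osc_omm howem).
move=> hk; have [le_k min_k] := hk.
(* A product of oscillator characters that contains s is the character
   attached to a diagonal form, of dimension k by minimality. *)
have [l [phi [lk [u [su hu phiE]] hs]]] := tensor_rank_osc chi_nt le_k.
have kl : k = l.
  apply/eqP; rewrite eqn_leq lk andbT; apply: min_k.
  by apply: (osc_tensor_rank chi_nt (leqnn l) _ hs); exists u.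
have [B'] := osc_product_sys chi_nt hu; rewrite -phiE => -[d' [R' [om' [nB' o' c']]]].
move: B' R' nB' o'; rewrite su -kl => B' R' nB' o'.
rewrite -c' in hs.
rewrite inE; case: (form_dichotomy two_neq0 np nm nB' ineqB) => cg; apply/orP.
  left; rewrite (cfRepr_congruent chi_nt two_neq0 k_gt0 lt_kn np osc_omp nB' cg o') in hs.
  have [t ->] := eta_exhausts chi_nt chi0_nt two_neq0 al0 chi_al k_gt0 lt_kn np
    osc_omp howep hs hk.
  exact: imset_f.
right; rewrite (cfRepr_congruent chi_nt two_neq0 k_gt0 lt_kn nm osc_omm nB' cg o') in hs.
have [t ->] := eta_exhausts chi_nt chi0_nt two_neq0 al0 chi_al k_gt0 lt_kn nm
  osc_omm howem hs hk.
exact: imset_f.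
Qed.
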